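(* For every integer $g>1$ and for all but finitely many primes $p>2$ (the finite set of exceptions depending on $g$), the number of $\mathbf{F}_p(t)$-rational points on smooth non-isotrivial curves of genus $g$ over $\mathbf{F}_p(t)$ is not uniformly bounded; that is, for every positive integer $N$ there exists a smooth, projective, geometrically irreducible, non-isotrivial curve $C$ of genus $g$ over $\mathbf{F}_p(t)$ such that $C$ has at least $N$ rational points over $\mathbf{F}_p(t)$.
   Context: $\mathbf{F}_p$ denotes the field with $p$ elements and $\mathbf{F}_p(t)$ the field of rational functions in one variable $t$ over $\mathbf{F}_p$. A smooth projective curve $C$ over $\mathbf{F}_p(t)$ is called isotrivial if, over an algebraic closure of $\mathbf{F}_p(t)$, it becomes isomorphic to the base change of a curve defined over an algebraic closure of $\mathbf{F}_p$; it is non-isotrivial otherwise. It is a known fact that a smooth projective non-isotrivial curve of genus at least two over $\mathbf{F}_p(t)$ has only finitely many $\mathbf{F}_p(t)$-rational points. *)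

(* Defs.v *)
From HB Require Import structures.
From mathcomp Require Import all_boot all_order all_algebra all_field.
From mathcomp Require Import generic_quotient mpoly.

Set Implicit Arguments.
Unset Strict Implicit.
Unset Printing Implicit Defensive.

Import GRing.Theory.
Local Open Scope ring_scope.

(* A closed subscheme of projective n-space over k is given by a finite list  *)
(* X of homogeneous equations in n + 1 variables.  A rational point is given  *)
(* by homogeneous coordinates, i.e. a nonzero row vector u; u and v stand for *)
(* the same point when they span the same line, (u == v)%MS.                  *)

Definition homogeneous (k : fieldType) (n : nat)
    (X : seq {mpoly k[n.+1]}) : Prop :=
  forall f, f \in X -> exists d : nat, f \is d.-homog.

Definition point_of (k : fieldType) (n : nat)
    (X : seq {mpoly k[n.+1]}) (u : 'rV[k]_n.+1) : bool :=
  (u != 0) && all (fun f => f.@[u 0] == 0) X.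

Definition at_least_points (k : fieldType) (n : nat)
    (X : seq {mpoly k[n.+1]}) (N : nat) : Prop :=
  exists s : seq 'rV[k]_n.+1,
    [/\ size s = N, all (point_of X) s
      & pairwise (fun u v => ~~ (u == v)%MS) s].

Definition base_change (k K : fieldType) (iota : {rmorphism k -> K}) (n : nat)
    (X : seq {mpoly k[n.+1]}) : seq {mpoly K[n.+1]} :=
  [seq map_mpoly iota f | f <- X].

(* The homogeneous ideal I(X) generated by the equations.                     *)
Definition in_ideal (k : fieldType) (n : nat)
    (X : seq {mpoly k[n.+1]}) (f : {mpoly k[n.+1]}) : Prop :=
  exists h : 'I_(size X) -> {mpoly k[n.+1]}, f = \sum_i h i * X`_i.

(* The degree d part of k[x_0, ..., x_n] / I(X) has dimension h.              *)
Definition hilbert_fun (k : fieldType) (n : nat)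
    (X : seq {mpoly k[n.+1]}) (d h : nat) : Prop :=
  exists U : {vspace dhomog n.+1 k d},
    (forall f : dhomog n.+1 k d, f \in U <-> in_ideal X (val f))
    /\ (\dim {: dhomog n.+1 k d} = h + \dim U)%N.

Definition hilbert_poly (k : fieldType) (n : nat)
    (X : seq {mpoly k[n.+1]}) (P : {poly rat}) : Prop :=
  exists d0 : nat, forall d : nat, (d0 <= d)%N ->
    exists2 h : nat, hilbert_fun X d h & P.[d%:R] = h%:R.

(* The arithmetic genus 1 - P(0), P the Hilbert polynomial; it is the genus   *)
(* when X is a smooth geometrically irreducible curve.                        *)
Definition has_genus (k : fieldType) (n : nat)
    (X : seq {mpoly k[n.+1]}) (g : nat) : Prop :=
  exists2 P : {poly rat}, hilbert_poly X P & 1 - P.[0] = g%:R.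

(* Over an algebraically closed field K, closed subsets of projective space   *)
(* are identified with their sets of K-points.                                *)

Definition closed_sub (K : closedFieldType) (n : nat)
    (X Y : seq {mpoly K[n.+1]}) : Prop :=
  forall u, point_of X u -> point_of Y u.

Definition irreducible (K : closedFieldType) (n : nat)
    (X : seq {mpoly K[n.+1]}) : Prop :=
  (exists u, point_of X u) /\
  forall Y Z : seq {mpoly K[n.+1]}, homogeneous Y -> homogeneous Z ->
    (forall u, point_of X u -> point_of Y u || point_of Z u) ->
    closed_sub X Y \/ closed_sub X Z.

Definition irreducible_chain (K : closedFieldType) (n : nat)
    (X : seq {mpoly K[n.+1]}) (d : nat) : Prop :=
  exists Z : nat -> seq {mpoly K[n.+1]},
    (forall i, (i <= d)%N ->
       [/\ homogeneous (Z i), irreducible (Z i) & closed_sub (Z i) X]) /\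
    (forall i, (i < d)%N ->
       closed_sub (Z i) (Z i.+1) /\ ~ closed_sub (Z i.+1) (Z i)).

Definition has_dim (K : closedFieldType) (n : nat)
    (X : seq {mpoly K[n.+1]}) (d : nat) : Prop :=
  irreducible_chain X d /\ ~ irreducible_chain X d.+1.

Definition jacobian (K : fieldType) (n : nat)
    (X : seq {mpoly K[n.+1]}) (u : 'rV[K]_n.+1) : 'M[K]_(size X, n.+1) :=
  \matrix_(i, j) (mderiv j X`_i).@[u 0].

(* Smoothness is the Jacobian criterion, rank = n - 1, at every point.  It is *)
(* imposed on the given equations, so the scheme they define is reduced.      *)
Definition smooth_irreducible_curve (K : closedFieldType) (n : nat)
    (X : seq {mpoly K[n.+1]}) : Prop :=
  [/\ homogeneous X, irreducible X, has_dim X 1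
    & forall u, point_of X u -> (\rank (jacobian X u)).+1 = n].

(* phi acts on homogeneous coordinates; near each point it is given, up to    *)
(* scaling, by forms of a common degree with no common zero there.            *)
Definition is_morphism (K : closedFieldType) (m n : nat)
    (X : seq {mpoly K[m.+1]}) (Y : seq {mpoly K[n.+1]})
    (phi : 'rV[K]_m.+1 -> 'rV[K]_n.+1) : Prop :=
  forall u, point_of X u ->
    point_of Y (phi u) /\
    exists (d : nat) (F : 'I_n.+1 -> {mpoly K[m.+1]}),
      let F_at (v : 'rV[K]_m.+1) : 'rV[K]_n.+1 := \row_i (F i).@[v 0] in
      [/\ forall i, F i \is d.-homog, F_at u != 0
        & forall v, point_of X v -> F_at v != 0 -> (phi v == F_at v)%MS].

Definition isomorphic (K : closedFieldType) (m n : nat)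
    (X : seq {mpoly K[m.+1]}) (Y : seq {mpoly K[n.+1]}) : Prop :=
  exists (phi : 'rV[K]_m.+1 -> 'rV[K]_n.+1)
         (psi : 'rV[K]_n.+1 -> 'rV[K]_m.+1),
    [/\ is_morphism X Y phi, is_morphism Y X psi,
        forall u, point_of X u -> (psi (phi u) == u)%MS
      & forall v, point_of Y v -> (phi (psi v) == v)%MS].

Definition algebraic_closure (k : fieldType) (K : closedFieldType)
    (iota : {rmorphism k -> K}) : Prop :=
  forall x : K, algebraicOver iota x.

(* The field F_p(t); 'F_p is the field with p elements when p is prime.       *)
Definition Fpt (p : nat) : fieldType := {fraction {poly 'F_p}}.

(* In particular the quantification over algebraic closures below is never    *)
(* vacuous for the field F_p(t).                                              *)
Lemma algebraic_closure_Fpt (p : nat) :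
  exists (K : closedFieldType) (iota : {rmorphism Fpt p -> K}),
    algebraic_closure iota.
Proof.
pose F := {fraction {poly 'F_p}}.
pose enc (x : F) : {poly 'F_p} * {poly 'F_p} := \val (repr x).
pose dec u : F := (\pi_F (insubd (ratio0 _) u))%qT.
have encK : pcancel (pickle \o enc) (omap dec \o unpickle).
  by move=> x /=; rewrite pickleK /= /dec /enc valKd reprK.
pose C : isCountable F := isCountable.Build _ encK.
pose cF := HB.pack_for countFieldType F C.
have [K [iota intK]] := countable_algebraic_closure cF.
by exists K, iota => x; apply/integral_algebraic/intK.
Qed.

Definition smooth_geom_irreducible_curve (k : fieldType) (n : nat)
    (X : seq {mpoly k[n.+1]}) : Prop :=
  forall (K : closedFieldType) (iota : {rmorphism k -> K}),
    algebraic_closure iota -> smooth_irreducible_curve (base_change iota X).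

Definition isotrivial (p n : nat) (X : seq {mpoly (Fpt p)[n.+1]}) : Prop :=
  exists (K : closedFieldType) (iota : {rmorphism Fpt p -> K})
         (k0 : closedFieldType) (j : {rmorphism 'F_p -> k0})
         (sigma : {rmorphism k0 -> K})
         (m : nat) (Y : seq {mpoly k0[m.+1]}),
    [/\ algebraic_closure iota, algebraic_closure j,
        smooth_irreducible_curve Y
      & isomorphic (base_change iota X) (base_change sigma Y)].

(* Main.v *)
(* Put k = g + 1 and consider C_b : y^2 = (x^k + 1) (x^k + b), of genus g.       *)
(*                                                                            *)
(* Points.  Let b = t^(2 k (p^n + 1)) with n = 3^N.  For every m = 3^i, i < N, *)
(* p^m + 1 divides p^n + 1, so b = s^(k (q + 1)) with q = p^m and s a square   *)
(* in F_p(t).  Then s^k + b = s^k (1 + s^k)^q, and the right-hand side of the  *)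
(* equation at x = s is the square s^k (1 + s^k)^(q + 1).                      *)
(*                                                                            *)
(* Non-isotriviality.  If C_b became isomorphic to a curve Y defined over an   *)
(* algebraic extension of F_p, then a power of Frobenius, x |-> x^Q, fixes Y,  *)
(* so that C_b, Y and the twist C_(b^Q) are isomorphic.  The isomorphism       *)
(* C_b -> C_(b^Q) induces a Moebius transformation between the x-lines, which  *)
(* maps branch points to branch points.  Hence Frobenius permutes the finite   *)
(* set of cross ratios of the branch points of C_b, these cross ratios are     *)
(* algebraic over F_p, and so is b: a contradiction.                           *)
Require Import Defs.
From HB Require Import structures.
From mathcomp Require Import all_boot all_order all_algebra all_field.
From mathcomp Require Import mpoly ring zify.

Set Implicit Arguments.
Unset Strict Implicit.
Unset Printing Implicit Defensive.

Import GRing.Theory.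
Local Open Scope ring_scope.

(** For p > g + 1 one explicit family suffices, the curves [curve g b] with k = g + 1, where b is a
    power of t that depends on N. The points come from Frobenius: if b = s^(k (q + 1)) with q a
    power of p and s a square, then s^k + b = s^k (1 + s^k)^q, and the equation has a solution above
    x = s ([ordinateE]). By [dvdn_succ_pow3] a single b has this shape for N different q.

    The geometry of the curve is reduced to the ring of functions a(x) + c(x) y on the affine double
    cover y^2 = f(x), controlled by the conjugation y -> -y and the norm to K[x]. This yields
    irreducibility and dimension 1. Smoothness follows from an explicit kernel of the Jacobian
    ([curve_smooth]), and the genus from normal forms modulo the ideal ([curve_genus]).

    Non-isotriviality is the hard part. [isotrivial_frobenius] turns a model over an algebraic
    extension of F_p into an isomorphism from the curve to its Frobenius twist. Let u be the
    x-coordinate of the image point. A function regular on the affine curve with poles of order less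
    than g + 1 at infinity is a polynomial in x ([phi_quotient]); applied to quotients N / (u - c),
    this shows that u is a Moebius function of x ([phi_moebius]). Branch points go to branch points
    ([phi_branch_points]), so Frobenius permutes their cross ratios ([cross_ratio_frob_fixed]). Then
    b is fixed by a power of Frobenius, which is false for a positive power of t. *)

Definition hornE := (hornerD, hornerN, hornerM, hornerC, hornerX, horner_exp).

(** * Polynomials over an algebraically closed field *)

Lemma poly_nonroot (K : closedFieldType) (N : {poly K}) : N != 0 -> exists x, N.[x] != 0.
Proof.
move=> nzN; have /closed_rootP[x] : size (N * 'X + 1%:P) != 1%N.
  by rewrite size_MXaddC (negPf nzN) /= eqSS size_poly_eq0.
rewrite rootE !hornE => e; exists x; apply: contraTneq e => ->.
by rewrite mul0r add0r oner_eq0.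
Qed.

Lemma closed_poly_eq0 (K : closedFieldType) (p : {poly K}) :
  (forall x, p.[x] = 0) -> p = 0.
Proof.
move=> p0; apply/eqP; apply: contraT => /poly_nonroot[x].
by rewrite p0 eqxx.
Qed.

Lemma closed_poly_eq0_generic (K : closedFieldType) (N p : {poly K}) :
  N != 0 -> (forall x, N.[x] != 0 -> p.[x] = 0) -> p = 0.
Proof.
move=> nzN pN; suff /eqP : p * N = 0 by rewrite mulf_eq0 (negPf nzN) orbF => /eqP.
apply: closed_poly_eq0 => x; rewrite hornerM.
by have [->|/pN->] := eqVneq N.[x] 0; rewrite ?mulr0 ?mul0r.
Qed.

Lemma closed_avoid (K : closedFieldType) (s : seq K) : exists x, x \notin s.
Proof.
pose N := \prod_(a <- s) ('X - a%:P).
have nzN : N != 0 by rewrite monic_neq0 // monic_prod_XsubC.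
have [x nx] := poly_nonroot nzN.
by exists x; move: nx; rewrite -rootE root_prod_XsubC.
Qed.

Lemma closed_nth_root (K : closedFieldType) (n : nat) (x : K) : (0 < n)%N ->
  exists y, y ^+ n == x.
Proof.
move=> n_gt0; have /closed_rootP[y] : size ('X^n - x%:P : {poly K}) != 1%N.
  by rewrite size_XnsubC // eqSS -lt0n.
by rewrite rootE !hornerE subr_eq0; exists y.
Qed.

(** The order of vanishing at the simple root r is even on the left and odd on the right; the
    descent divides [a] and [c] by X - r until the size of [c] runs out. Hence f is not a square in
    K(x), and the double cover y^2 = f is irreducible. *)
Lemma poly_square_simple_root (K : fieldType) (f a c : {poly K}) (r : K) :
  root f r -> f^`().[r] != 0 -> a ^+ 2 = c ^+ 2 * f -> c = 0.
Proof.
move=> /factor_theorem[f1 ->]; rewrite derivM derivXsubC !hornerE subrr mulr0 add0r.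
move=> nz1; have [n] := ubnP (size c); elim: n a c => // n IHn a c.
have nzX : 'X - r%:P != 0 :> {poly K} by rewrite polyXsubC_eq0.
move=> lec e; have /factor_theorem[a1 ea] : root a r.
  by rewrite rootE -sqrf_eq0 -horner_exp e !hornerE subrr !mulr0.
have {}e : a1 ^+ 2 * ('X - r%:P) = c ^+ 2 * f1.
  by apply: (mulIf nzX); rewrite -e ea; ring.
have /factor_theorem[c1 ec] : root c r.
  rewrite rootE -sqrf_eq0 -horner_exp -(mulIr_eq0 _ (mulIf nz1)) -hornerM -e.
  by rewrite !hornerE subrr mulr0.
have {}e : a1 ^+ 2 = c1 ^+ 2 * (f1 * ('X - r%:P)).
  by apply: (mulIf nzX); rewrite e ec; ring.
have [c10 | nzc] := eqVneq c1 0; first by rewrite ec c10 mul0r.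
suff c10 : c1 = 0 by rewrite ec c10 mul0r.
apply: (IHn a1); last by rewrite e mulrA.
by move: lec; rewrite ec size_Mmonic ?monicXsubC // size_XsubC addn2 /= ltnS.
Qed.

(** * Functions on a double cover of the affine line *)

(* The coordinate ring of y^2 = f(x), seen as a ring of functions on the      *)
(* points: [pf f h] says that h = a(x) + c(x) y on the curve.                 *)
Section DoubleCover.

Variables (K : closedFieldType) (f : {poly K}).
Hypothesis nz2 : (2%:R : K) != 0.

Definition onC (v : K * K) := v.2 ^+ 2 == f.[v.1].

Definition pev (a : {poly K} * {poly K}) (v : K * K) := a.1.[v.1] + a.2.[v.1] * v.2.

Definition pf (h : K * K -> K) :=
  exists a, forall v, onC v -> h v = pev a v.

Definition flip (v : K * K) := (v.1, - v.2).

Lemma onC_flip v : onC (flip v) = onC v.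
Proof. by rewrite /onC /= sqrrN. Qed.

Lemma onC_lift x : exists y, onC (x, y).
Proof. by have [y ey] := @closed_nth_root K 2 f.[x] isT; exists y. Qed.

Lemma pf_ext h1 h2 : (forall v, onC v -> h1 v = h2 v) -> pf h1 -> pf h2.
Proof. by move=> e [a ea]; exists a => v vC; rewrite -e // ea. Qed.

Lemma pf_poly (p : {poly K}) : pf (fun v => p.[v.1]).
Proof. by exists (p, 0) => v _; rewrite /pev /= horner0 mul0r addr0. Qed.

Lemma pf_const c : pf (fun=> c).
Proof. by apply: pf_ext (pf_poly c%:P) => v _; rewrite hornerC. Qed.

Lemma pf_y : pf (fun v => v.2).
Proof. by exists (0, 1) => v _; rewrite /pev /= horner0 hornerC mul1r add0r. Qed.

Lemma pfD h1 h2 : pf h1 -> pf h2 -> pf (fun v => h1 v + h2 v).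
Proof.
move=> [a ea] [c ec]; exists (a.1 + c.1, a.2 + c.2) => v vC.
by rewrite ea // ec // /pev /= !hornerD; ring.
Qed.

Lemma pfM h1 h2 : pf h1 -> pf h2 -> pf (fun v => h1 v * h2 v).
Proof.
move=> [a ea] [c ec].
exists (a.1 * c.1 + a.2 * c.2 * f, a.1 * c.2 + a.2 * c.1) => v vC.
rewrite ea // ec // /pev /= !hornerD !hornerM -(eqP vC); ring.
Qed.

Lemma pfN h : pf h -> pf (fun v => - h v).
Proof. by move/(pfM (pf_const (-1))); apply: pf_ext => v _; rewrite mulN1r. Qed.

Lemma pfB h1 h2 : pf h1 -> pf h2 -> pf (fun v => h1 v - h2 v).
Proof. by move=> ph1 /pfN; apply: pfD. Qed.

Lemma pfX h n : pf h -> pf (fun v => h v ^+ n).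
Proof.
move=> ph; elim: n => [|n IHn]; first exact: pf_const.
by apply: pf_ext (pfM ph IHn) => v _; rewrite exprS.
Qed.

Lemma pf_prod I (r : seq I) (F : I -> K * K -> K) :
  (forall i, pf (F i)) -> pf (fun v => \prod_(i <- r) F i v).
Proof.
move=> pF; elim: r => [|i r IHr].
  by apply: pf_ext (pf_const 1) => v _; rewrite big_nil.
by apply: pf_ext (pfM (pF i) IHr) => v _; rewrite big_cons.
Qed.

Lemma pf_sum I (r : seq I) (F : I -> K * K -> K) :
  (forall i, pf (F i)) -> pf (fun v => \sum_(i <- r) F i v).
Proof.
move=> pF; elim: r => [|i r IHr].
  by apply: pf_ext (pf_const 0) => v _; rewrite big_nil.
by apply: pf_ext (pfD (pF i) IHr) => v _; rewrite big_cons.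
Qed.

Lemma pf_meval n (F : {mpoly K[n]}) (q : 'I_n -> K * K -> K) :
  (forall i, pf (q i)) -> pf (fun v => F.@[fun i => q i v]).
Proof.
move=> pq; pose t m v := F@_m * \prod_(i < n) q i v ^+ m i.
have pt m : pf (t m).
  by apply: pfM; [exact: pf_const | apply: pf_prod => i; exact: pfX].
by apply: pf_ext (pf_sum (msupp F) pt) => v _; rewrite mevalE.
Qed.

Lemma pf_flip h : pf h -> pf (fun v => h (flip v)).
Proof.
move=> [a ea]; exists (a.1, - a.2) => v vC.
by rewrite ea ?onC_flip // /pev /= hornerN mulrN mulNr.
Qed.

(** Adding the values at (x, y) and (x, -y) isolates a.1, since 2 is invertible; what remains gives
    a.2 f = 0. The polynomial [N] allows finitely many exceptional x. *)
Lemma pev0P a N : f != 0 -> N != 0 ->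
  (forall v, onC v -> N.[v.1] != 0 -> pev a v = 0) -> a = (0, 0).
Proof.
move=> nzf nzN a0.
have a_pm x : N.[x] != 0 -> a.1.[x] = 0 /\ a.2.[x] * f.[x] = 0.
  move=> Nx; have [y yC] := onC_lift x.
  have := a0 _ yC Nx; have := a0 (flip (x, y)); rewrite onC_flip => /(_ yC Nx).
  rewrite /pev /= => e1 e2.
  have a1 : a.1.[x] = 0.
    apply: (mulfI nz2); rewrite mulr0.
    by rewrite -[RHS](addr0 0) -{1}e1 -e2; ring.
  by split=> //; rewrite -(eqP yC) /= expr2 mulrA -[a.2.[x] * y]add0r -a1 e2 mul0r.
rewrite [a]surjective_pairing; congr (_, _).
  by apply: (closed_poly_eq0_generic nzN) => x /a_pm[].
apply: (closed_poly_eq0_generic (N := N * f)); first by rewrite mulf_neq0.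
move=> x; rewrite hornerM mulf_eq0 negb_or => /andP[/a_pm[_ /eqP]].
by rewrite mulf_eq0 => /orP[/eqP-> // | ->].
Qed.

Hypothesis f_simple : exists2 r, root f r & f^`().[r] != 0.

Let nzf : f != 0.
Proof.
by have [r _] := f_simple; apply: contraNneq => ->; rewrite linear0 horner0.
Qed.

(* [N] is the norm of [h] down to K[x]. *)
Lemma pf_norm h : pf h -> exists2 N : {poly K},
  (forall v, onC v -> h v * h (flip v) = N.[v.1]) &
  (N = 0 -> forall v, onC v -> h v = 0).
Proof.
move=> [a ea]; exists (a.1 ^+ 2 - a.2 ^+ 2 * f) => [v vC|].
  rewrite !ea ?onC_flip // /pev /= hornerD hornerN !(hornerM, horner_exp) -(eqP vC).
  ring.
move/eqP; rewrite subr_eq0 => /eqP e v vC.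
have [r rf df] := f_simple; have a2 := poly_square_simple_root rf df e.
move/eqP: e; rewrite a2 expr0n mul0r expf_eq0 /= => /eqP a1.
by rewrite ea // /pev a1 a2 !horner0 mul0r addr0.
Qed.

Lemma pf_generic h v0 : pf h -> onC v0 -> h v0 != 0 ->
  exists2 N : {poly K}, N != 0 & forall v, onC v -> N.[v.1] != 0 -> h v != 0.
Proof.
move=> /pf_norm[N eN N0] v0C hv0; exists N.
  by apply: contraNneq hv0 => /N0->.
by move=> v vC; rewrite -eN // mulf_eq0 negb_or => /andP[].
Qed.

Lemma pf_eq0_generic h N : pf h -> N != 0 ->
  (forall v, onC v -> N.[v.1] != 0 -> h v = 0) -> forall v, onC v -> h v = 0.
Proof.
move=> [a ea] nzN h0 v vC; rewrite ea // (@pev0P a N) //.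
  by rewrite /pev !horner0 mul0r addr0.
by move=> w wC Nw; rewrite -ea // h0.
Qed.

(** The coordinate ring is an integral domain: a nonzero h1 vanishes only above roots of its
    norm. *)
Lemma pf_domain h1 h2 v0 : pf h1 -> pf h2 -> onC v0 -> h1 v0 != 0 ->
  (forall v, onC v -> h1 v * h2 v = 0) -> forall v, onC v -> h2 v = 0.
Proof.
move=> ph1 ph2 v0C hv0 h0; have [N nzN eN] := pf_generic ph1 v0C hv0.
apply: (pf_eq0_generic ph2 nzN) => v vC Nv.
by have /eqP := h0 _ vC; rewrite mulf_eq0 (negPf (eN _ vC Nv)) => /eqP.
Qed.

(* The local condition says that [n / N] belongs to the local ring of every   *)
(* point; the coordinate ring is the intersection of its local rings.         *)
Lemma pf_div_poly (N : {poly K}) n : N != 0 -> pf n ->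
  (forall P, onC P -> exists a e, [/\ pf a, pf e, a P != 0
     & forall v, onC v -> a v * n v = N.[v.1] * e v]) ->
  exists2 e, pf e & forall v, onC v -> n v = N.[v.1] * e v.
Proof.
have [m] := ubnP (size N); elim: m N n => // m IHm N n leN nzN pn loc.
have [szN|/closed_rootP[r rN]] := eqVneq (size N) 1%N.
  have /size_poly1P[c nzc ->] : size N == 1%N by rewrite szN.
  exists (fun v => c^-1 * n v); first by apply: pfM => //; apply: pf_const.
  by move=> v _; rewrite hornerC mulVKf.
have [N1 eN] := factor_theorem _ _ rN.
have nzN1 : N1 != 0 by apply: contraNneq nzN => N10; rewrite eN N10 mul0r.
have [a0 en] := pn.
(* [n] vanishes at the points above a root r of [N]. This kills a0.1 at r, and also a0.2 unless y =
   0 there. *)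
have a0r : a0.1.[r] = 0 /\ a0.2.[r] = 0.
  have zN : N.[r] = 0 by apply/eqP.
  have loc0 y : onC (r, y) -> n (r, y) = 0.
    move=> yC; have [a [e [_ _ nza /(_ _ yC)/eqP]]] := loc _ yC.
    by rewrite zN mul0r mulf_eq0 (negPf nza) => /eqP.
  have [y yC] := onC_lift r.
  have yC' : onC (r, - y) by rewrite /onC /= sqrrN.
  have := loc0 _ yC; have := loc0 _ yC'; rewrite !en // /pev /= => e1 e2.
  have a1 : a0.1.[r] = 0.
    apply: (mulfI nz2); rewrite mulr0.
    by rewrite -[RHS](addr0 0) -{1}e1 -e2; ring.
  split=> //; have [y0|nzy] := eqVneq y 0; last first.
    by apply: (mulIf nzy); rewrite mul0r -e2 a1 add0r.
  (* At a branch point the value of [n] says nothing about a0.2; the coefficients of y in a n = N e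
     do, because [a] is nonzero there. *)
  have [a [e [[a' ea] [e' ee] nza h]]] := loc _ yC.
  pose d := (a'.1 * a0.1 + a'.2 * a0.2 * f - N * e'.1,
             a'.1 * a0.2 + a'.2 * a0.1 - N * e'.2).
  have /(congr1 (fun p => p.2.[r])) : d = (0, 0).
    apply: (@pev0P d 1) => // [|v vC _]; first exact: oner_neq0.
    rewrite /pev /d /= !(hornerD, hornerN, hornerM) -(eqP vC).
    have /eqP := h v vC; rewrite -subr_eq0 en // ea // ee // /pev => /eqP <-; ring.
  rewrite /d /= !(hornerD, hornerN, hornerM) a1 zN mulr0 mul0r subr0 addr0 horner0.
  move/eqP; rewrite mulf_eq0 => /orP[z|/eqP//].
  by case/negP: nza; rewrite ea // /pev /= y0 mulr0 addr0.
have [b1 eb1] := factor_theorem _ _ (introT eqP a0r.1).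
have [b2 eb2] := factor_theorem _ _ (introT eqP a0r.2).
have en' v : onC v -> n v = (v.1 - r) * pev (b1, b2) v.
  by move=> vC; rewrite en // /pev eb1 eb2 /= !hornE; ring.
have [|//||P PC|e pe h] := IHm N1 (pev (b1, b2)).
- by move: leN; rewrite eN size_Mmonic ?monicXsubC // size_XsubC addn2.
- by exists (b1, b2).
- have [a [e [pa pe nza h]]] := loc P PC.
  exists a, e; split=> // v vC; apply/eqP; rewrite -subr_eq0; apply/eqP.
  apply: (pf_eq0_generic (N := 'X - r%:P)
    (h := fun v => a v * pev (b1, b2) v - N1.[v.1] * e v)) vC.
  + by apply: pfB; apply: pfM => //; [exists (b1, b2) | apply: pf_poly].
  + by rewrite polyXsubC_eq0.
  move=> w wC; rewrite !hornE => nzw; apply: (mulfI nzw).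
  rewrite mulr0 mulrBr mulrCA -en' // h // eN !hornE; ring.
exists e => // v vC.
by rewrite en' // h // eN !hornE; ring.
Qed.

(** Multiplying [n] and [d] by the conjugate of [d] turns the denominator into a polynomial, the
    norm of [d], so that [pf_div_poly] applies. *)
Lemma pf_div n d v0 : pf n -> pf d -> onC v0 -> d v0 != 0 ->
  (forall P, onC P -> exists a e, [/\ pf a, pf e, a P != 0
     & forall v, onC v -> a v * n v = d v * e v]) ->
  exists2 e, pf e & forall v, onC v -> n v = d v * e v.
Proof.
move=> pn pd v0C dv0 loc; have [N eN N0] := pf_norm pd.
have nzN : N != 0 by apply: contraNneq dv0 => /N0->.
have [||e pe h] := @pf_div_poly N (fun v => n v * d (flip v)) nzN.
- by apply: pfM => //; apply: pf_flip.
- move=> P PC; have [a [e [pa pe nza h]]] := loc P PC.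
  exists a, e; split=> // v vC.
  by rewrite mulrA h // -eN //; ring.
exists e => // v vC; apply/eqP; rewrite -subr_eq0; apply/eqP.
apply: (pf_eq0_generic (h := fun v => n v - d v * e v) _ nzN) vC.
  by apply: pfB => //; apply: pfM.
move=> w wC; rewrite -eN // mulf_eq0 negb_or => /andP[_ nzd].
by apply: (mulIf nzd); rewrite mul0r mulrBl h // -eN //; ring.
Qed.

End DoubleCover.

(** * The curves *)

(* The curve y^2 = (x^k + 1) (x^k + b), k = g + 1, of genus g, embedded in    *)
(* P^(g+2) by (1 : x : ... : x^k : y): a quadric section of the cone over the *)
(* rational normal curve of degree k.                                         *)
Section Curve.

Variables (k : fieldType) (g : nat).

(* Every quadratic monomial is rewritten as x_i x_j = x_lo x_hi with lo = 0 or *)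
(* lo = k; these relations generate those of the rational normal curve.        *)
Definition lo (i j : nat) := if (i + j <= g.+1)%N then 0%N else g.+1.
Definition hi (i j : nat) := (i + j - lo i j)%N.

Definition xv (i : nat) : {mpoly k[g.+3]} := 'X_(inord i).
Definition yv : {mpoly k[g.+3]} := 'X_ord_max.

Definition veronese (i j : nat) := xv i * xv j - xv (lo i j) * xv (hi i j).

Definition quadric (b : k) :=
  yv ^+ 2 - (xv g.+1 + xv 0) * (xv g.+1 + b *: xv 0).

Definition curve (b : k) : seq {mpoly k[g.+3]} :=
  quadric b :: [seq veronese i j | i <- iota 0 g.+2, j <- iota 0 g.+2].

Lemma lo_hi i j : (i <= g.+1)%N -> (j <= g.+1)%N ->
  [/\ (lo i j <= g.+1)%N, (hi i j <= g.+1)%N & (lo i j + hi i j = i + j)%N].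
Proof. by rewrite /hi /lo; case: ifP; split; lia. Qed.

Lemma mem_curve b F : reflect
  (F = quadric b \/ exists i j, [/\ (i <= g.+1)%N, (j <= g.+1)%N & F = veronese i j])
  (F \in curve b).
Proof.
have mem_i i : (i \in iota 0 g.+2) = (i <= g.+1)%N by rewrite mem_iota add0n.
rewrite inE; apply: (iffP orP) => [[/eqP->|/allpairsP[ij []]]|[->|[i [j [li lj ->]]]]].
- by left.
- by rewrite !mem_i => li lj ->; right; exists ij.1, ij.2.
- by left.
- by right; apply/allpairsP; exists (i, j); rewrite !mem_i.
Qed.

Lemma xv_homog i : xv i \is 1.-homog.
Proof. by rewrite dhomogX /= mdeg1. Qed.

Lemma yv_homog : yv \is 1.-homog.
Proof. by rewrite dhomogX /= mdeg1. Qed.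

Lemma veronese_homog i j : veronese i j \is 2.-homog.
Proof.
by rewrite rpredB //; apply: (@dhomogM _ _ _ 1 _ 1); apply: xv_homog.
Qed.

Lemma quadric_homog b : quadric b \is 2.-homog.
Proof.
apply: rpredB; first exact: (@dhomogMn _ _ _ 1 _ 2 yv_homog).
apply: (@dhomogM _ _ _ 1 _ 1); apply: rpredD; try exact: xv_homog.
by apply: rpredZ; apply: xv_homog.
Qed.

Lemma curve_homog b F : F \in curve b -> F \is 2.-homog.
Proof.
case/mem_curve => [->|[i [j [_ _ ->]]]]; [exact: quadric_homog | exact: veronese_homog].
Qed.

Lemma curve_homogeneous b : homogeneous (curve b).
Proof. by move=> F /curve_homog; exists 2%N. Qed.

Definition cx (u : 'rV[k]_g.+3) (i : nat) := u 0 (inord i).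
Definition cy (u : 'rV[k]_g.+3) := u 0 ord_max.

Lemma cxZ c u i : cx (c *: u) i = c * cx u i.
Proof. by rewrite /cx mxE. Qed.

Lemma cyZ c u : cy (c *: u) = c * cy u.
Proof. by rewrite /cy mxE. Qed.

Lemma row_ext (u v : 'rV[k]_g.+3) :
  (forall i, (i <= g.+1)%N -> cx u i = cx v i) -> cy u = cy v -> u = v.
Proof.
move=> ex ey; apply/rowP => i; have [->|ni] := eqVneq i ord_max; first exact: ey.
rewrite -(inord_val i); apply: ex.
have := ltn_ord i; rewrite ltnS leq_eqVlt => /orP[/eqP e|//].
by case/eqP: ni; apply: val_inj.
Qed.

Lemma meval_veronese (u : 'rV[k]_g.+3) i j :
  (veronese i j).@[u 0] = cx u i * cx u j - cx u (lo i j) * cx u (hi i j).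
Proof. by rewrite mevalB !mevalM !mevalXU. Qed.

Lemma meval_quadric b (u : 'rV[k]_g.+3) :
  (quadric b).@[u 0] =
  cy u ^+ 2 - (cx u g.+1 + cx u 0) * (cx u g.+1 + b * cx u 0).
Proof. by rewrite /quadric mevalB rmorphXn /= mevalM !mevalD mevalZ !mevalXU. Qed.

Lemma point_of_curveP b u : reflect
  [/\ u != 0, cy u ^+ 2 = (cx u g.+1 + cx u 0) * (cx u g.+1 + b * cx u 0) &
     forall i j, (i <= g.+1)%N -> (j <= g.+1)%N ->
       cx u i * cx u j = cx u (lo i j) * cx u (hi i j)]
  (point_of (curve b) u).
Proof.
apply: (iffP andP) => [[nzu /allP h]|[nzu hq hv]]; split=> //.
- have /h : quadric b \in curve b by apply/mem_curve; left.
  by rewrite meval_quadric subr_eq0 => /eqP.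
- move=> i j li lj.
  have /h : veronese i j \in curve b by apply/mem_curve; right; exists i, j.
  by rewrite meval_veronese subr_eq0 => /eqP.
apply/allP => F /mem_curve[->|[i [j [li lj ->]]]].
  by rewrite meval_quadric hq subrr.
by rewrite meval_veronese hv ?subrr.
Qed.

(* The affine charts x_0 != 0 ([r = false]) and x_k != 0 ([r = true]).        *)

Definition qexp (r : bool) (i : nat) := if r then (g.+1 - i)%N else i.

Definition cpoly (r : bool) (i : nat) : {poly k} := 'X^(qexp r i).

Definition fpoly (b : k) (r : bool) : {poly k} :=
  (cpoly r g.+1 + cpoly r 0) * (cpoly r g.+1 + b%:P * cpoly r 0).

Definition pt (r : bool) (v : k * k) : 'rV[k]_g.+3 :=
  \row_i if i == ord_max then v.2 else v.1 ^+ qexp r i.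

Lemma cx_pt r v i : (i <= g.+1)%N -> cx (pt r v) i = (cpoly r i).[v.1].
Proof.
move=> li; rewrite /cx mxE hornerXn -val_eqE /= inordK; last by rewrite ltnS leqW.
by rewrite ltn_eqF.
Qed.

Lemma cy_pt r v : cy (pt r v) = v.2.
Proof. by rewrite /cy mxE eqxx. Qed.

Lemma cpoly_rel r i j : (i <= g.+1)%N -> (j <= g.+1)%N ->
  cpoly r i * cpoly r j = cpoly r (lo i j) * cpoly r (hi i j).
Proof.
move=> li lj; have [llo lhi e] := lo_hi li lj.
by rewrite -!exprD /qexp; case: r; congr ('X^_); lia.
Qed.

Definition base (r : bool) := if r then g.+1 else 0%N.

Lemma base_le r : (base r <= g.+1)%N.
Proof. by case: r. Qed.

Lemma cpoly_base r : cpoly r (base r) = 1.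
Proof. by rewrite /cpoly /qexp; case: r; rewrite ?subnn expr0. Qed.

Lemma pt_neq0 r v : pt r v != 0.
Proof.
apply/eqP => /(congr1 (fun u => cx u (base r))).
rewrite cx_pt ?base_le // cpoly_base hornerC /cx mxE => /eqP.
by rewrite oner_eq0.
Qed.

Lemma pt_on b r v : v.2 ^+ 2 = (fpoly b r).[v.1] -> point_of (curve b) (pt r v).
Proof.
move=> e; apply/point_of_curveP; split; first exact: pt_neq0.
  by rewrite cy_pt e !cx_pt // /fpoly !hornE.
move=> i j li lj; have [llo lhi _] := lo_hi li lj.
by rewrite !cx_pt // -!hornerM cpoly_rel.
Qed.

Lemma veronese_coords u : cx u 0 != 0 ->
  (forall j, (j <= g)%N -> cx u 1 * cx u j = cx u 0 * cx u j.+1) ->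
  forall i, (i <= g.+1)%N -> cx u i = cx u 0 * (cx u 1 / cx u 0) ^+ i.
Proof.
move=> nz0 h; elim=> [|i IHi] li; first by rewrite expr0 mulr1.
apply: (mulfI nz0); rewrite -h // IHi 1?ltnW // exprS; field; exact: nz0.
Qed.

Lemma veronese_coords_rev u : cx u g.+1 != 0 ->
  (forall j, (j <= g)%N -> cx u g * cx u j.+1 = cx u g.+1 * cx u j) ->
  forall i, (i <= g.+1)%N -> cx u i = cx u g.+1 * (cx u g / cx u g.+1) ^+ (g.+1 - i).
Proof.
move=> nz0 h i; move: {2}(_ - _)%N (erefl (g.+1 - i)%N) => n.
elim: n i => [|n IHn] i en li.
  have -> : i = g.+1 by lia.
  by rewrite subnn expr0 mulr1.
apply: (mulfI nz0); rewrite -h; last by lia.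
rewrite (IHn i.+1); [|by lia..]; rewrite en exprS.
have -> : (g.+1 - i.+1 = n)%N by lia.
by field; exact: nz0.
Qed.

Lemma point_chart b u r : point_of (curve b) u -> cx u (base r) != 0 ->
  exists v, v.2 ^+ 2 = (fpoly b r).[v.1] /\ u = cx u (base r) *: pt r v.
Proof.
move=> /point_of_curveP[nzu hq hv] nz0.
have [x ex] : exists x, forall i, (i <= g.+1)%N -> cx u i = cx u (base r) * x ^+ qexp r i.
  case: r nz0 => /= nz0; [exists (cx u g / cx u g.+1) | exists (cx u 1 / cx u 0)].
    apply: veronese_coords_rev => // j lj; rewrite hv; [|by lia..].
    rewrite /hi /lo; case: ifP => le.
      have -> : j = 0%N by lia.
      by rewrite addn1 subn0 mulrC.
    by congr (_ * cx u _); lia.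
  apply: veronese_coords => // j lj; rewrite hv; [|by lia..].
  by rewrite /hi /lo add1n ltnS lj subn0.
set c := cx u _ in nz0 ex *; pose y := cy u / c.
have ey : cy u = c * y by rewrite mulrC divfK.
exists (x, y); split=> /=; last first.
  apply: row_ext => [i li|]; first by rewrite ex // cxZ cx_pt // /cpoly hornerXn.
  by rewrite ey cyZ cy_pt.
apply: (mulfI (expf_neq0 2 nz0)); rewrite -exprMn -ey hq !ex // /fpoly /cpoly !hornE.
ring.
Qed.

(** In the relation x_i^2 = x_lo x_hi either lo = 0 or hi < i, so the x_i with i < k vanish by
    strong induction. If x_k vanished too, the quadric would kill y. *)
Lemma point_cx0 b u : point_of (curve b) u -> cx u 0 = 0 ->
  (forall i, (i <= g)%N -> cx u i = 0) /\ cx u g.+1 != 0.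
Proof.
move=> /point_of_curveP[nzu hq hv] u0.
have z i : (i <= g)%N -> cx u i = 0.
  have [n] := ubnP i; elim: n i => // n IHn i len li.
  apply/eqP; rewrite -sqrf_eq0 expr2 hv; [|by lia..]; rewrite /hi /lo.
  case: ifP => h; first by rewrite u0 mul0r.
  by rewrite (IHn (i + i - g.+1)%N) ?mulr0 //; lia.
split=> //; apply: contraNneq nzu => uk; apply/eqP; apply: row_ext.
  move=> i li; have -> : cx u i = 0.
    by have [/z//|] := leqP i g => lg; have -> : i = g.+1 by lia.
  by rewrite /cx mxE.
by rewrite /cy [RHS]mxE; apply/eqP; rewrite -sqrf_eq0 hq uk u0 mulr0 addr0 mul0r.
Qed.

Lemma point_charts b u : point_of (curve b) u ->
  exists r v, v.2 ^+ 2 = (fpoly b r).[v.1] /\ (cx u (base r) != 0 /\ u = cx u (base r) *: pt r v).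
Proof.
move=> pu; have [u0|nz] := eqVneq (cx u 0) 0.
  have [_ nz] := point_cx0 pu u0.
  by have [v [vC e]] := point_chart (r := true) pu nz; exists true, v.
by have [v [vC e]] := point_chart (r := false) pu nz; exists false, v.
Qed.

Lemma fpolyE b : fpoly b false = ('X^(g.+1) + 1) * ('X^(g.+1) + b%:P).
Proof. by rewrite /fpoly /cpoly /= expr0 mulr1. Qed.

Lemma fpoly_revE b : fpoly b true = (1 + 'X^(g.+1)) * (1 + b%:P * 'X^(g.+1)).
Proof. by rewrite /fpoly /cpoly /= subnn subn0 expr0. Qed.

(** The usual gluing of the two charts of a hyperelliptic curve. *)
Lemma pt_glue x y : x != 0 ->
  pt true (x^-1, y / x ^+ g.+1) = x ^- g.+1 *: pt false (x, y).
Proof.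
move=> nzx; apply: row_ext => [i li|].
  rewrite cxZ !cx_pt // /cpoly !hornerXn /qexp.
  by rewrite exprVn expfB_cond ?(negPf nzx) ?add0n // invf_div mulrC.
by rewrite cyZ !cy_pt mulrC.
Qed.

Lemma fpoly_glue b x : x != 0 ->
  (fpoly b true).[x^-1] = (fpoly b false).[x] / (x ^+ g.+1) ^+ 2.
Proof.
move=> nzx; rewrite fpolyE fpoly_revE !hornE exprVn.
by field; rewrite expf_neq0.
Qed.

End Curve.

Lemma base_change_curve (k K : fieldType) (iota : {rmorphism k -> K}) g b :
  base_change iota (curve g b) = curve g (iota b).
Proof.
have mX i : map_mpoly iota ('X_i : {mpoly k[g.+3]}) = 'X_i by rewrite map_mpolyX.
rewrite /base_change /curve map_cons; congr (_ :: _).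
  rewrite rmorphB rmorphXn rmorphM !rmorphD /= map_mpolyZ /= !mX //.
rewrite map_allpairs; apply: eq_allpairs => i j.
by rewrite rmorphB !rmorphM /= !mX.
Qed.

Lemma meval_homog (k : fieldType) n d (F : {mpoly k[n]}) c (u : 'rV[k]_n) :
  F \is d.-homog -> F.@[(c *: u) 0] = c ^+ d * F.@[u 0].
Proof.
move=> /dhomogP hF; rewrite !mevalE big_distrr /= [LHS]big_seq [RHS]big_seq.
apply: eq_bigr => m /hF /= dm; rewrite mulrCA; congr (_ * _).
rewrite -dm mdegE expr_sum -big_split /=.
by apply: eq_bigr => i _; rewrite mxE exprMn.
Qed.

Lemma point_of_scale (k : fieldType) n (X : seq {mpoly k[n.+1]}) u c :
  homogeneous X -> c != 0 -> point_of X (c *: u) = point_of X u.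
Proof.
move=> hX nzc; rewrite /point_of scaler_eq0 (negPf nzc) /=; congr (_ && _).
apply: eq_in_all => F /hX[d hF].
by rewrite (meval_homog _ _ hF) mulf_eq0 expf_eq0 (negPf nzc) andbF.
Qed.

(** * Irreducibility, dimension and smoothness *)

Section Projective.

Variables (K : closedFieldType) (n : nat).

Definition vanishes (X : seq {mpoly K[n.+1]}) (F : {mpoly K[n.+1]}) :=
  forall u, point_of X u -> F.@[u 0] = 0.

Lemma irreducible_prime X F G dF dG : irreducible X ->
  F \is dF.-homog -> G \is dG.-homog -> vanishes X (F * G) ->
  vanishes X F \/ vanishes X G.
Proof.
move=> [_ irrX] hF hG FG0.
have hom H d : H \is d.-homog -> homogeneous [:: H].
  by move=> hH E; rewrite inE => /eqP->; exists d.
have [||u pu|XF|XG] := irrX [:: F] [:: G]; first exact: hom hF.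
- exact: hom hG.
- have /eqP := FG0 u pu; rewrite mevalM mulf_eq0.
  by case/andP: (pu) => nzu _; rewrite /point_of /= nzu !andbT.
- by left=> u /XF /andP[_ /=]; rewrite andbT => /eqP.
- by right=> u /XG /andP[_ /=]; rewrite andbT => /eqP.
Qed.

Lemma irreducible_prime_prod X (s : seq {mpoly K[n.+1]}) : irreducible X ->
  (forall F, F \in s -> F \is 1.-homog) -> vanishes X (\prod_(F <- s) F) ->
  exists2 F, F \in s & vanishes X F.
Proof.
move=> irrX; elim: s => [|F s IHs] hs.
  case: irrX => -[u pu] _; rewrite big_nil => /(_ u pu).
  by rewrite meval1 => /eqP; rewrite oner_eq0.
have hs' G : G \in s -> G \is 1.-homog by move=> Gs; apply: hs; rewrite inE Gs orbT.
have [d hd] : exists d, \prod_(G <- s) G \is d.-homog.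
  by apply/homogP; apply: homog_prod; apply/allP => G /hs' hG; apply/homogP; exists 1%N.
rewrite big_cons => /(irreducible_prime irrX (hs F (mem_head _ _)) hd)[vF|/IHs[]//].
  by exists F; rewrite ?mem_head.
by move=> G Gs vG; exists G; rewrite // inE Gs orbT.
Qed.

Definition point_eqs (u : 'rV[K]_n.+1) : seq {mpoly K[n.+1]} :=
  [seq u 0 i *: 'X_j - u 0 j *: 'X_i | i <- enum 'I_n.+1, j <- enum 'I_n.+1].

Lemma point_eqs_homog u : homogeneous (point_eqs u).
Proof.
move=> F /allpairsP[ij [_ _ ->]]; exists 1%N.
by apply: rpredB; apply: rpredZ; rewrite dhomogX /= mdeg1.
Qed.

Lemma point_eqsP u w : u != 0 ->
  reflect (exists2 c, c != 0 & w = c *: u) (point_of (point_eqs u) w).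
Proof.
move=> nzu; apply: (iffP andP) => [[nzw /allP h]|[c nzc ->]].
  have [i ui] : exists i, u 0 i != 0.
    apply/existsP; apply: contraNT nzu; rewrite negb_exists => /forallP u0.
    by apply/eqP/rowP => j; rewrite mxE; apply/eqP; rewrite -[_ == _]negbK u0.
  have ew : w = (w 0 i / u 0 i) *: u.
    apply/rowP => j; rewrite mxE.
    have /h : u 0 i *: 'X_j - u 0 j *: 'X_i \in point_eqs u.
      by apply/allpairsP; exists (i, j); rewrite !mem_enum.
    rewrite mevalB !mevalZ !mevalXU subr_eq0 => /eqP e.
    by rewrite -mulrAC -[w 0 i * _]mulrC -e mulrAC mulfV ?mul1r.
  by exists (w 0 i / u 0 i) => //; apply: contraNneq nzw => c0; rewrite ew c0 scale0r.
split; first by rewrite scaler_eq0 (negPf nzc).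
apply/allP => F /allpairsP[ij [_ _ ->]].
by rewrite mevalB !mevalZ !mevalXU !mxE mulrCA [u 0 ij.2 * _]mulrCA (mulrC (u 0 ij.1)) subrr.
Qed.

Lemma point_irreducible u : u != 0 -> irreducible (point_eqs u).
Proof.
move=> nzu; have pu : point_of (point_eqs u) u.
  by apply/point_eqsP => //; exists 1; rewrite ?oner_neq0 ?scale1r.
split=> [|Y Z hY hZ h]; first by exists u.
by have /orP[p|p] := h u pu; [left|right] => w /(point_eqsP _ nzu)[c nzc ->];
  rewrite point_of_scale.
Qed.

End Projective.

Section CurveGeometry.

Variables (K : closedFieldType) (g : nat) (b : K).
Hypotheses (nz2 : (2%:R : K) != 0) (nzk : (g.+1%:R : K) != 0).
Hypotheses (nzb : b != 0) (nb1 : b != 1).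

Local Notation C := (curve g b).
Local Notation f := (fpoly g b).

(** The two factors are separable because k and b are invertible, and they have no common root
    because b != 1. *)
Lemma fpoly_sep r x : (f r).[x] = 0 -> (f r)^`().[x] != 0.
Proof.
have dXn : ('X^(g.+1) : {poly K})^`() = g.+1%:R *: 'X^g.
  by rewrite derivXn scaler_nat.
have pow0 c : c != 0 -> x ^+ g.+1 = c -> g.+1%:R * x ^+ g != 0.
  move=> nzc e; rewrite mulf_neq0 //; move: nzc.
  by rewrite -e exprS mulf_eq0 negb_or => /andP[].
have nz1b : 1 - b != 0 by rewrite subr_eq0 eq_sym.
have nzN1 : -1 != 0 :> K by rewrite oppr_eq0 oner_eq0.
case: r.
  have -> : (f true)^`().[x] =
      g.+1%:R * x ^+ g * ((1 + b * x ^+ g.+1) + (1 + x ^+ g.+1) * b).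
    rewrite fpoly_revE derivM !derivD !derivM !derivC dXn !(hornE, hornerZ); ring.
  rewrite fpoly_revE !hornE => /eqP; rewrite mulf_eq0 => /orP[/eqP e|/eqP e].
    have ex : x ^+ g.+1 = -1 by apply/eqP; rewrite -addr_eq0 addrC e.
    by rewrite mulf_neq0 ?(pow0 (-1)) // e mul0r addr0 ex mulrN1.
  have ex : x ^+ g.+1 = - b^-1.
    by apply: (mulfI nzb); rewrite mulrN mulfV //; apply/eqP; rewrite -addr_eq0 addrC e.
  rewrite mulf_neq0 ?(pow0 (- b^-1)) ?oppr_eq0 ?invr_eq0 // e add0r ex.
  by rewrite mulrDl mul1r mulNr mulVf // -oppr_eq0 opprB.
have -> : (f false)^`().[x] =
    g.+1%:R * x ^+ g * ((x ^+ g.+1 + b) + (x ^+ g.+1 + 1)).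
  rewrite fpolyE derivM !derivD !derivC dXn !(hornE, hornerZ); ring.
rewrite fpolyE !hornE => /eqP; rewrite mulf_eq0 => /orP[/eqP e|/eqP e].
  have ex : x ^+ g.+1 = -1 by apply/eqP; rewrite -addr_eq0 e.
  by rewrite mulf_neq0 ?(pow0 (-1)) // e addr0 ex addrC -oppr_eq0 opprB.
have ex : x ^+ g.+1 = - b by apply/eqP; rewrite -addr_eq0 e.
by rewrite mulf_neq0 ?(pow0 (- b)) ?oppr_eq0 // e add0r ex addrC.
Qed.

Lemma fpoly_simple r : exists2 x, root (f r) x & (f r)^`().[x] != 0.
Proof.
have /closed_rootP[x] : size ('X^(g.+1) + 1%:P : {poly K}) != 1%N by rewrite size_XnaddC.
move=> rx; have fx : (f r).[x] = 0.
  move: rx; rewrite rootE; case: r.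
    by rewrite fpoly_revE !hornE addrC => /eqP->; rewrite mul0r.
  by rewrite fpolyE !hornE => /eqP->; rewrite mul0r.
by exists x; [apply/eqP | apply: fpoly_sep].
Qed.

Lemma pf_pt r (F : {mpoly K[g.+3]}) : pf (f r) (fun v => F.@[pt g r v 0]).
Proof.
apply: (@pf_meval _ _ _ F (fun i v => pt g r v 0 i)) => i.
have [e|ne] := eqVneq i ord_max.
  by apply: pf_ext (pf_y (f r)) => v _; rewrite mxE e eqxx.
apply: (pf_ext _ (pf_poly (f r) (cpoly K g r i))) => v _.
by rewrite mxE (negPf ne) hornerXn.
Qed.

Lemma pf_nonzero r h : pf (f r) h -> (forall v, onC (f r) v -> h v = 0) \/
  (exists2 v, onC (f r) v & h v != 0).
Proof.
move=> ph; have [N eN N0] := pf_norm (fpoly_simple r) ph.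
have [/N0|nzN] := eqVneq N 0; first by left.
have [x Nx] := poly_nonroot nzN; have [y yC] := onC_lift (f r) x.
right; exists (x, y) => //; apply: contraNneq Nx => h0.
by rewrite -(eN _ yC) h0 mul0r.
Qed.

Lemma ptC r v : onC (f r) v -> point_of C (pt g r v).
Proof. by move/eqP; apply: pt_on. Qed.

Lemma curve_pointP u : point_of C u ->
  exists r v c, [/\ onC (f r) v, c != 0 & u = c *: pt g r v].
Proof.
move=> /point_charts[r [v [/eqP vC [nz e]]]].
by exists r, v, (cx u (base g r)).
Qed.

(** The chart x_0 != 0 is dense: on the other chart the form vanishes wherever the coordinate is
    nonzero, hence everywhere. *)
Lemma homog_vanish d F : F \is d.-homog ->
  (forall v, onC (f false) v -> F.@[pt g false v 0] = 0) -> vanishes C F.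
Proof.
move=> hF F0 u /curve_pointP[r [v [c [vC nzc ->]]]].
rewrite (meval_homog _ _ hF); case: r vC => vC; last by rewrite F0 ?mulr0.
rewrite (pf_eq0_generic nz2 (fpoly_simple true) (pf_pt true F) (N := 'X)) ?mulr0 //.
  by rewrite polyX_eq0.
move=> w wC; rewrite hornerX => nzw.
pose x := w.1^-1; have nzx : x != 0 by rewrite invr_eq0.
have ew : w = (x^-1, (w.2 * x ^+ g.+1) / x ^+ g.+1).
  by rewrite invrK mulfK ?expf_neq0 // -surjective_pairing.
rewrite ew pt_glue // (meval_homog _ _ hF) F0 ?mulr0 // /onC /=.
rewrite exprMn (eqP wC) -[w.1]invrK -/x fpoly_glue // divfK //.
by rewrite !expf_neq0.
Qed.

Lemma homog_nonzero d F : F \is d.-homog -> vanishes C F \/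
  (exists2 v, onC (f false) v & F.@[pt g false v 0] != 0).
Proof.
move=> hF; have [/(homog_vanish hF)|] := pf_nonzero (pf_pt false F); first by left.
by right.
Qed.

Lemma curve_domain d e F G u : F \is d.-homog -> G \is e.-homog ->
  point_of C u -> F.@[u 0] != 0 -> vanishes C (F * G) -> vanishes C G.
Proof.
move=> hF hG pu Fu FG; have [/(_ u pu)/eqP|[v vC Fv]] := homog_nonzero hF.
  by rewrite (negPf Fu).
apply: (homog_vanish hG) => w wC.
apply: (pf_domain nz2 (fpoly_simple false) (pf_pt false F) (pf_pt false G) vC) => // z zC.
by rewrite -mevalM FG // ptC.
Qed.

Lemma curve_closed_sub Y : homogeneous Y -> closed_sub C Y \/
  exists2 F, F \in Y & exists2 u, point_of C u & F.@[u 0] != 0.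
Proof.
elim: Y => [|F Y IHY] hY; first by left=> u /andP[nzu _]; apply/andP.
have [|sub|[G GY ?]] := IHY; first by move=> G GY; apply: hY; rewrite inE GY orbT.
  have [d hF] := hY F (mem_head _ _).
  have [F0|[v vC Fv]] := homog_nonzero hF.
    left=> u pu; have /andP[nzu aY] := sub u pu.
    by apply/and3P; rewrite F0.
  by right; exists F; rewrite ?mem_head //; exists (pt g false v) => //; apply: ptC.
by right; exists G => //; rewrite inE GY orbT.
Qed.

Lemma curve_irreducible : irreducible C.
Proof.
split=> [|Y Z hY hZ cov].
  by have [y yC] := onC_lift (f false) 0; exists (pt g false (0, y)); apply: ptC.
have [|[F FY [u pu Fu]]] := curve_closed_sub hY; first by left.
have [|[G GZ [w pw Gw]]] := curve_closed_sub hZ; first by right.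
have [[d hF] [e hG]] := (hY F FY, hZ G GZ).
case/eqP: Gw; apply: (curve_domain hF hG pu Fu _ pw) => z /cov.
by case/orP => /andP[_ /allP]; rewrite mevalM; [move/(_ _ FY) | move/(_ _ GZ)] => /eqP->;
  rewrite ?mul0r ?mulr0.
Qed.

Let lin_homog (c : K) i j : xv K g i - c *: xv K g j \is 1.-homog.
Proof. by apply: rpredB; [|apply: rpredZ]; apply: xv_homog. Qed.

(** The norm of F leaves finitely many x-coordinates for W, and then the equation leaves two
    opposite values of y (y = x_k or y = - x_k at infinity). Each time a product of linear forms
    vanishes on W, so one factor does, and W shrinks to a point. *)
Lemma irreducible_proper_point W F d u1 : irreducible W -> closed_sub W C ->
  F \in W -> F \is d.-homog -> point_of C u1 -> F.@[u1 0] != 0 ->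
  exists u0, forall u, point_of W u -> exists2 c, c != 0 & u = c *: u0.
Proof.
move=> irrW subW FW hF pu1 Fu1.
have ev1 i j c (u : 'rV[K]_g.+3) : (xv K g i - c *: xv K g j).@[u 0] = cx u i - c * cx u j.
  by rewrite mevalB mevalZ !mevalXU.
have evy c j (u : 'rV[K]_g.+3) : (yv K g - c *: xv K g j).@[u 0] = cy u - c * cx u j.
  by rewrite mevalB mevalZ !mevalXU.
have evx i (u : 'rV[K]_g.+3) : (xv K g i).@[u 0] = cx u i by rewrite mevalXU.
have hy c j : yv K g - c *: xv K g j \is 1.-homog.
  by apply: rpredB; [exact: yv_homog | apply: rpredZ; apply: xv_homog].
have inf_case : vanishes W (xv K g 0) ->
    exists u0, forall u, point_of W u -> exists2 c, c != 0 & u = c *: u0.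
  move=> W0; have : vanishes W ((yv K g - 1 *: xv K g g.+1) * (yv K g - (-1) *: xv K g g.+1)).
    move=> u pu; rewrite mevalM !evy; have := W0 u pu; rewrite evx => u0.
    have /point_of_curveP[_ hq _] := subW u pu.
    rewrite [LHS](_ : _ = cy u ^+ 2 - cx u g.+1 ^+ 2); last by ring.
    by rewrite hq u0; ring.
  move=> prod0.
  have [e We] : exists e, vanishes W (yv K g - e *: xv K g g.+1).
    by have [] := irreducible_prime irrW (hy _ _) (hy _ _) prod0; eexists; eassumption.
  exists (pt g true (0, e)) => u pu; have pC := subW u pu.
  have := W0 u pu; rewrite evx => u0; have [z nzk'] := point_cx0 pC u0.
  exists (cx u g.+1) => //; apply: row_ext => [i li|].
    rewrite cxZ cx_pt // /cpoly hornerXn /qexp.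
    have [lig|] := leqP i g; first by rewrite z // subSn // expr0n mulr0.
    move=> gi; have -> : i = g.+1 by apply/eqP; rewrite eqn_leq li.
    by rewrite subnn expr0 mulr1.
  by rewrite cyZ cy_pt /=; have /eqP := We u pu; rewrite evy subr_eq0 mulrC => /eqP.
have [/(_ u1 pu1)/eqP|[v0 v0C Fv0]] := homog_nonzero hF; first by rewrite (negPf Fu1).
have [N eN N0] := pf_norm (fpoly_simple false) (pf_pt false F).
have nzN : N != 0 by apply: contraNneq Fv0 => /N0->.
have [rs eNr] := closed_field_poly_normal N.
(* Every point of W lies at infinity or has its x-coordinate among the roots of the norm, so the
   product of these forms vanishes on W. *)
pose s := xv K g 0 :: [seq xv K g 1 - rho *: xv K g 0 | rho <- rs].
have [||G] := @irreducible_prime_prod _ _ W s irrW.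
- by move=> G; rewrite inE => /predU1P[->|/mapP[rho _ ->]]; [exact: xv_homog|].
- move=> u pu; rewrite big_cons mevalM evx.
  have [->|nzu] := eqVneq (cx u 0) 0; first by rewrite mul0r.
  have pC := subW u pu; have [v [/eqP vC eu]] := point_chart (r := false) pC nzu.
  have Fv : F.@[pt g false v 0] = 0.
    have /andP[_ /allP/(_ F FW)] := pu.
    by rewrite eu (meval_homog _ _ hF) mulf_eq0 expf_eq0 (negPf nzu) andbF => /eqP.
  have : root N v.1 by rewrite rootE -eN // Fv mul0r.
  rewrite eNr rootZ ?lead_coef_eq0 // root_prod_XsubC => rv.
  rewrite big_map (big_rem _ rv) /= mevalM ev1 eu !cxZ !cx_pt //.
  by rewrite /cpoly !hornerXn expr0 expr1 mulr1 [v.1 * _]mulrC subrr mul0r mulr0.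
rewrite inE => /predU1P[->|/mapP[rho _ ->] W1]; first exact: inf_case.
have [eta etaC] := onC_lift (f false) rho.
pose s2 := [:: xv K g 0; yv K g - eta *: xv K g 0; yv K g - (- eta) *: xv K g 0].
have aff u : point_of W u -> cx u 0 != 0 ->
    exists w, onC (f false) (rho, w) /\ u = cx u 0 *: pt g false (rho, w).
  move=> pu nz0; have pC := subW u pu.
  have [[x y] [/eqP vC eu]] := point_chart (r := false) pC nz0.
  suff <- : x = rho by exists y.
  have e1 : cx u 1 = cx u 0 * x by rewrite {1}eu cxZ cx_pt // /cpoly hornerXn expr1.
  have := W1 u pu; rewrite ev1 e1 => /eqP; rewrite subr_eq0 [rho * _]mulrC => /eqP.
  exact: mulfI.
have [||G2] := @irreducible_prime_prod _ _ W s2 irrW.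
- by move=> G1; rewrite !inE => /or3P[] /eqP->; rewrite ?xv_homog ?hy.
- move=> u pu; rewrite 2!big_cons big_seq1 !mevalM evx !evy.
  have [->|nzu] := eqVneq (cx u 0) 0; first by rewrite mul0r.
  have [w [wC eu]] := aff u pu nzu.
  rewrite eu cyZ !cxZ cy_pt !cx_pt // /cpoly !hornerXn /= expr0.
  have := etaC; rewrite /onC /= -(eqP wC) /= => /eqP ew.
  apply/eqP; rewrite [X in X == _](_ : _ = cx u 0 ^+ 3 * (w ^+ 2 - eta ^+ 2)); last by ring.
  by rewrite ew subrr mulr0.
have fin e : vanishes W (yv K g - e *: xv K g 0) ->
    exists u0, forall u, point_of W u -> exists2 c, c != 0 & u = c *: u0.
  move=> We; exists (pt g false (rho, e)) => u pu; have pC := subW u pu.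
  have := We u pu; rewrite evy => /eqP; rewrite subr_eq0 => /eqP ey.
  have nz0 : cx u 0 != 0.
    apply/negP => /eqP u0; have [_ nzk'] := point_cx0 pC u0.
    have /point_of_curveP[_ /eqP] := pC.
    by rewrite ey u0 !mulr0 !addr0 expr0n /= eq_sym mulf_eq0 (negPf nzk').
  have [w [_ eu]] := aff u pu nz0; exists (cx u 0) => //.
  suff -> : e = w by [].
  by move: ey; rewrite {1}eu cyZ cy_pt /= mulrC => /(mulIf nz0).
by rewrite !inE => /or3P[] /eqP->; [exact: inf_case | exact: fin | exact: fin].
Qed.

Lemma curve_has_dim1 : has_dim C 1.
Proof.
split.
  have [y yC] := onC_lift (f false) 0; have [z zC] := onC_lift (f false) 1.
  exists (fun i => if i == 0%N then point_eqs (pt g false (0, y)) else C).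
  have nzp := pt_neq0 g false (0, y).
  have sub0 : closed_sub (point_eqs (pt g false (0, y))) C.
    move=> u /(point_eqsP _ nzp)[c nzc ->]; rewrite point_of_scale ?ptC //.
    exact: curve_homogeneous.
  split=> [[|i] _ /=|[|i] //= _].
  - by split=> //; [exact: point_eqs_homog | exact: point_irreducible].
  - by split=> //; [exact: curve_homogeneous | exact: curve_irreducible].
  split=> // /(_ _ (ptC zC))/(point_eqsP _ nzp)[c _ e].
  have := congr1 (fun u => cx u 0) e; have := congr1 (fun u => cx u 1) e.
  rewrite !cxZ !cx_pt // /cpoly !hornerXn /= !expr0 !expr1 mulr0 => /eqP.
  by rewrite oner_eq0.
(* In a chain of length 2 the middle term is a proper closed subset of the curve, hence a single
   point, and cannot properly contain the nonempty first term. *)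
case=> Z [hZ chain]; have [//|hom0 irr0 sub0] := hZ 0%N.
have [//|hom1 irr1 sub1] := hZ 1%N; have [//|hom2 irr2 sub2] := hZ 2%N.
have [//|s01 ns10] := chain 0%N; have [//|s12 ns21] := chain 1%N.
have [CZ|[F FZ [u pu Fu]]] := curve_closed_sub hom1; first by case: ns21 => w /sub2/CZ.
have [d hF] := hom1 F FZ.
have [u0 h] := irreducible_proper_point irr1 sub1 FZ hF pu Fu.
case: ns10 => w /h[c nzc ->]; case: irr0 => -[z z0] _.
have [c' nzc' ez] := h z (s01 z z0).
by move: z0; rewrite ez !point_of_scale.
Qed.

End CurveGeometry.

(** * Ranks, directional derivatives and the kernel of the Jacobian *)

Section Corank2.

Variables (F : fieldType) (m n : nat) (A : 'M[F]_(m, n)).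

(** Adjoining to A the rows that read off coordinates i and j gives an injective matrix, and two
    rows add at most 2 to the rank. *)
Lemma rank_geq_corank2 (i j : 'I_n) :
  (forall w : 'rV_n, w *m A^T = 0 -> w 0 i = 0 -> w 0 j = 0 -> w = 0) ->
  (n <= \rank A + 2)%N.
Proof.
move=> h; pose B := col_mx (delta_mx 0 i : 'rV[F]_n) (delta_mx 0 j : 'rV_n).
have fr : row_free (col_mx A B)^T.
  apply: inj_row_free => w; rewrite !tr_col_mx !mul_mx_row !trmx_delta -!colE.
  rewrite -[0]row_mx0 => /eq_row_mx[w0]; rewrite -[0]row_mx0 => /eq_row_mx[wi wj].
  have c0 (l : 'I_n) : col l w = 0 -> w 0 l = 0.
    by move/(congr1 (fun M : 'M[F]_1 => M 0 0)); rewrite !mxE.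
  by apply: h w0 (c0 _ wi) (c0 _ wj).
move: fr; rewrite /row_free mxrank_tr => /eqP {1}<-.
rewrite -addsmxE (leq_trans (mxrank_adds_leqif _ _)) // leq_add2l.
exact: rank_leq_row.
Qed.

Lemma rank_leq_corank2 (w1 w2 : 'rV[F]_n) (i : 'I_n) :
  w1 *m A^T = 0 -> w2 *m A^T = 0 -> w1 0 i != 0 -> w2 0 i = 0 -> w2 != 0 ->
  (\rank A + 2 <= n)%N.
Proof.
move=> k1 k2 nz1 z2 nz2; have fr : row_free (col_mx w1 w2).
  apply: inj_row_free => v; rewrite -[v]hsubmxK mul_row_col.
  set a := lsubmx v; set c := rsubmx v => e.
  have ez (x : 'M[F]_1) (w : 'rV[F]_n) : x *m w = x 0 0 *: w.
    by rewrite {1}[x]mx11_scalar mul_scalar_mx.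
  rewrite !ez in e; have /eqP := congr1 (fun w : 'rV_n => w 0 i) e.
  rewrite !mxE z2 mulr0 addr0 mulf_eq0 (negPf nz1) orbF => /eqP av.
  have a0 : a 0 0 = 0 by rewrite mxE.
  move/eqP: e; rewrite a0 scale0r add0r scaler_eq0 (negPf nz2) orbF => /eqP c0.
  by rewrite [a]mx11_scalar [c]mx11_scalar a0 c0 !raddf0 row_mx0.
have /mulmx0_rank_max : col_mx w1 w2 *m A^T = 0 by rewrite mul_col_mx k1 k2 col_mx0.
by rewrite (eqP fr) mxrank_tr addnC.
Qed.

End Corank2.

Section DirectionalDerivative.

Variables (K : fieldType) (n : nat) (u w : 'rV[K]_n).

Definition ddir (F : {mpoly K[n]}) := \sum_j w 0 j * (mderiv j F).@[u 0].

Lemma ddirB F G : ddir (F - G) = ddir F - ddir G.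
Proof.
by rewrite -sumrB; apply: eq_bigr => j _; rewrite mderivB mevalB mulrBr.
Qed.

Lemma ddirD F G : ddir (F + G) = ddir F + ddir G.
Proof.
by rewrite -big_split; apply: eq_bigr => j _; rewrite mderivD mevalD mulrDr.
Qed.

Lemma ddirZ c F : ddir (c *: F) = c * ddir F.
Proof.
by rewrite big_distrr; apply: eq_bigr => j _; rewrite mderivZ mevalZ mulrCA.
Qed.

Lemma ddirM F G : ddir (F * G) = ddir F * G.@[u 0] + F.@[u 0] * ddir G.
Proof.
rewrite big_distrl big_distrr -big_split; apply: eq_bigr => j _.
by rewrite mderivM mevalD !mevalM /=; ring.
Qed.

Lemma ddirX i : ddir 'X_i = w 0 i.
Proof.
rewrite /ddir (bigD1 i) //= big1 => [|j nj].
  by rewrite mderivX mnm1E eqxx scale1r mevalX big1 ?mulr1 ?addr0 // => l _; rewrite mnmBE subnn expr0.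
by rewrite mderivX mnm1E eq_sym (negPf nj) scale0r meval0 mulr0.
Qed.

End DirectionalDerivative.

Lemma jacobian_kernel (K : fieldType) n (X : seq {mpoly K[n.+1]}) u w :
  reflect (forall F, F \in X -> ddir u w F = 0) (w *m (jacobian X u)^T == 0).
Proof.
have e i : (w *m (jacobian X u)^T) 0 i = ddir u w X`_i.
  by rewrite mxE; apply: eq_bigr => j _; rewrite !mxE.
apply: (iffP eqP) => [h F FX | h].
  have iX : (index F X < size X)%N by rewrite index_mem.
  by have := e (Ordinal iX); rewrite h mxE /= nth_index.
by apply/rowP => i; rewrite e h ?mxE // mem_nth.
Qed.

(** * Smoothness of the curves *)

Section Smooth.

Variables (K : closedFieldType) (g : nat) (b : K).
Hypotheses (nz2 : (2%:R : K) != 0) (nzk : (g.+1%:R : K) != 0).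
Hypotheses (nzb : b != 0) (nb1 : b != 1).

Local Notation C := (curve g b).
Local Notation f := (fpoly g b).

Lemma ddir_veronese (u w : 'rV[K]_g.+3) i j : ddir u w (veronese K g i j) =
  cx w i * cx u j + cx u i * cx w j
  - (cx w (lo g i j) * cx u (hi g i j) + cx u (lo g i j) * cx w (hi g i j)).
Proof. by rewrite ddirB !ddirM !ddirX !mevalXU. Qed.

Lemma ddir_quadric (u w : 'rV[K]_g.+3) : ddir u w (quadric g b) =
  2%:R * cy u * cy w - ((cx w g.+1 + cx w 0) * (cx u g.+1 + b * cx u 0)
    + (cx u g.+1 + cx u 0) * (cx w g.+1 + b * cx w 0)).
Proof.
rewrite ddirB expr2 !ddirM !ddirD ddirZ !ddirX !mevalD mevalZ !mevalXU.
rewrite /cy /cx; ring.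
Qed.

(** In the exponents of chart [r] this Veronese relation reads x * x^n = 1 * x^(n+1), up to the
    order of factors. Differentiated, it becomes the recursion [step] for tangent vectors in
    [curve_smooth]. *)
Lemma lo_hi_succ r n : (n <= g)%N ->
  let i := qexp g r 1 in let j := qexp g r n in
  (lo g i j = base g r /\ hi g i j = qexp g r n.+1) \/
  (hi g i j = base g r /\ lo g i j = qexp g r n.+1).
Proof.
rewrite /= /qexp /hi /lo /base; case: r => ln.
  case: ifP => h; first by right; lia.
  by left; lia.
by left; rewrite add1n ltnS ln subn0.
Qed.

Lemma qexpK r i : (i <= g.+1)%N -> qexp g r (qexp g r i) = i.
Proof. by case: r => //= li; rewrite subKn. Qed.

Lemma qexp_le r i : (i <= g.+1)%N -> (qexp g r i <= g.+1)%N.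
Proof. by case: r => //= li; rewrite leq_subr. Qed.

(* The derivative of the parametrization along 2 y d/dx; unlike d/dx it is     *)
(* defined and nonzero at the branch points.                                   *)
Definition tangent r (v : K * K) : 'rV[K]_g.+3 :=
  \row_i if i == ord_max then ((f r)^`()).[v.1]
         else 2%:R * v.2 * ((cpoly K g r i)^`()).[v.1].

Lemma cx_tangent r v i : (i <= g.+1)%N ->
  cx (tangent r v) i = 2%:R * v.2 * ((cpoly K g r i)^`()).[v.1].
Proof.
move=> li; rewrite /cx mxE -val_eqE /= inordK; last by rewrite ltnS leqW.
by rewrite ltn_eqF.
Qed.

Lemma cy_tangent r v : cy (tangent r v) = ((f r)^`()).[v.1].
Proof. by rewrite /cy mxE eqxx. Qed.

Lemma deriv_fpoly r x : ((f r)^`()).[x] =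
  (((cpoly K g r g.+1)^`()).[x] + ((cpoly K g r 0)^`()).[x])
     * ((cpoly K g r g.+1).[x] + b * (cpoly K g r 0).[x])
  + ((cpoly K g r g.+1).[x] + (cpoly K g r 0).[x])
     * (((cpoly K g r g.+1)^`()).[x] + b * ((cpoly K g r 0)^`()).[x]).
Proof. rewrite /fpoly !derivM !derivD !derivM derivC !hornE; ring. Qed.

(** The kernel of the Jacobian is the tangent space of the affine cone, spanned by the point itself
    and by [tangent]; so the rank is (g + 3) - 2. *)
Lemma curve_smooth u : point_of C u -> (\rank (jacobian C u)).+1 = g.+2.
Proof.
move=> /curve_pointP[r [[x y] [c [vC nzc ->]]]]; have ey := eqP vC; rewrite /= in ey.
set u0 := pt g r (x, y); set q := fun i => (cpoly K g r i).[x].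
pose q' i := ((cpoly K g r i)^`()).[x].
have eu i : (i <= g.+1)%N -> cx (c *: u0) i = c * q i by move=> li; rewrite cxZ cx_pt.
have qM i j : (i <= g.+1)%N -> (j <= g.+1)%N -> q i * q j = q (lo g i j) * q (hi g i j).
  by move=> li lj; rewrite /q -!hornerM cpoly_rel.
have q'M i j : (i <= g.+1)%N -> (j <= g.+1)%N ->
    q' i * q j + q i * q' j = q' (lo g i j) * q (hi g i j) + q (lo g i j) * q' (hi g i j).
  by move=> li lj; rewrite /q /q' -!hornerM -!hornerD -!derivM cpoly_rel.
have fx : (f r).[x] = (q g.+1 + q 0%N) * (q g.+1 + b * q 0%N).
  by rewrite /fpoly /q !hornE.
have q1 : q (base g r) = 1 by rewrite /q cpoly_base hornerC.
have q'1 : q' (base g r) = 0 by rewrite /q' cpoly_base derivC horner0.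
have expC n : (n <= g.+1)%N -> cpoly K g r (qexp g r n) = 'X^n.
  by move=> ln; rewrite /cpoly qexpK.
have upper : (\rank (jacobian C (c *: u0)) + 2 <= g.+3)%N.
  apply: (@rank_leq_corank2 _ _ _ _ u0 (tangent r (x, y)) (inord (base g r))).
  - apply/eqP/jacobian_kernel => F /mem_curve[->|[i [j [li lj ->]]]].
      rewrite ddir_quadric !eu // cyZ !cy_pt !cx_pt // -/(q _) -/(q 0%N) /=.
      rewrite [LHS](_ : _ = 2%:R * c * (y ^+ 2 - (f r).[x])); last by rewrite fx; ring.
      by rewrite ey subrr mulr0.
    have [l1 l2 _] := lo_hi li lj.
    rewrite ddir_veronese !eu // !cx_pt // -/(q i) -/(q j) -/(q (lo g i j)) -/(q (hi g i j)).
    by rewrite [LHS](_ : _ = 2%:R * c * (q i * q j - q (lo g i j) * q (hi g i j)));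
      [rewrite qM // subrr mulr0 | ring].
  - apply/eqP/jacobian_kernel => F /mem_curve[->|[i [j [li lj ->]]]].
      rewrite ddir_quadric !eu // cyZ cy_pt cy_tangent deriv_fpoly !cx_tangent //= /q; ring.
    have [l1 l2 _] := lo_hi li lj.
    rewrite ddir_veronese !eu // !cx_tangent //= -!/(q' _).
    rewrite [LHS](_ : _ = 2%:R * y * c * ((q' i * q j + q i * q' j)
      - (q' (lo g i j) * q (hi g i j) + q (lo g i j) * q' (hi g i j)))); last by ring.
    by rewrite q'M // subrr mulr0.
  - by rewrite -/(cx u0 _) cx_pt ?base_le // -/(q _) q1 oner_neq0.
  - by rewrite -/(cx (tangent _ _) _) cx_tangent ?base_le // -/(q' _) q'1 mulr0.
  have [y0|nzy] := eqVneq y 0.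
    apply: contraTneq (fpoly_sep nzk nzb nb1 (x := x) (r := r) _) => [t0|].
      by have := congr1 (fun u => cy u) t0; rewrite cy_tangent /cy mxE /= => ->; rewrite eqxx.
    by rewrite -ey y0 expr0n.
  have l1 : (qexp g r 1 <= g.+1)%N by rewrite qexp_le.
  apply: contraTneq isT => /(congr1 (fun u => cx u (qexp g r 1))).
  rewrite cx_tangent // expC // expr1 derivX hornerC /cx mxE => /eqP.
  by rewrite !mulf_eq0 (negPf nz2) (negPf nzy) oner_eq0.
have lower : (g.+3 <= \rank (jacobian C (c *: u0)) + 2)%N.
  (* At a branch point y is a local parameter and x is not, so y is the second coordinate set to
     zero there; elsewhere it is the coordinate equal to x. *)
  pose i2 : 'I_g.+3 := if y == 0 then ord_max else inord (qexp g r 1).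
  apply: (@rank_geq_corank2 _ _ _ _ (inord (base g r)) i2) => w /eqP/jacobian_kernel h w0 w2.
  have {}w0 : cx w (base g r) = 0 by [].
  pose w1 := cx w (qexp g r 1).
  have step n : (n <= g)%N ->
      cx w (qexp g r n.+1) = w1 * q (qexp g r n) + x * cx w (qexp g r n).
    move=> ln; have l1 : (qexp g r 1 <= g.+1)%N by rewrite qexp_le.
    have l2 : (qexp g r n <= g.+1)%N by rewrite qexp_le // leqW.
    have l3 : (qexp g r n.+1 <= g.+1)%N by rewrite qexp_le.
    have /h : veronese K g (qexp g r 1) (qexp g r n) \in C.
      by apply/mem_curve; right; exists (qexp g r 1), (qexp g r n).
    have qx : q (qexp g r 1) = x by rewrite /q expC // hornerXn expr1.
    have [ll lh _] := lo_hi l1 l2; rewrite ddir_veronese !eu // -/w1 qx.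
    have [[-> ->]|[-> ->]] := lo_hi_succ r ln; rewrite q1 w0 => e;
      apply: (mulfI nzc); apply/eqP; rewrite eq_sym -subr_eq0; apply/eqP;
      rewrite -[RHS]e; ring.
  have wE i : (i <= g.+1)%N -> cx w i = w1 * q' i.
    move=> li; rewrite -(qexpK r li); have := qexp_le r li.
    elim: (qexp g r i) => [|n IHn] ln.
      have -> : qexp g r 0 = base g r by rewrite /qexp /base; case: (r); rewrite ?subn0.
      by rewrite w0 q'1 mulr0.
    rewrite step // IHn 1?ltnW // /q' /q !expC // 1?ltnW //.
    by rewrite exprS derivM derivX mul1r !hornE; ring.
  have := h (quadric g b); rewrite ddir_quadric !eu // !wE // cyZ cy_pt /=.
  move=> /(_ (introT (mem_curve _ _) (or_introl erefl))) hq.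
  (* This is y^2 = f(x) differentiated along w. At a branch point it forces w1 = 0 because the roots
     of f are simple. *)
  have hq2 : 2%:R * y * cy w = w1 * ((f r)^`()).[x].
    apply: (mulfI nzc); apply/eqP; rewrite -subr_eq0; apply/eqP; rewrite -[RHS]hq.
    rewrite deriv_fpoly /q /q'; ring.
  have [w10 wy0] : w1 = 0 /\ cy w = 0.
    move: w2; rewrite /i2; have [y0|nzy] := eqVneq y 0 => w2.
      split=> //; apply/eqP; move/eqP: hq2; rewrite y0 mulr0 mul0r eq_sym mulf_eq0.
      by rewrite (negPf (fpoly_sep _ _ _ _)) ?orbF // -ey y0 expr0n.
    split=> //; have {}w2 : w1 = 0 by [].
    by apply/eqP; move/eqP: hq2; rewrite w2 mul0r !mulf_eq0 (negPf nz2) (negPf nzy).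
  apply: row_ext => [i li|]; first by rewrite wE // w10 mul0r /cx mxE.
  by rewrite wy0 /cy mxE.
by apply/eqP; rewrite eqn_leq; move: upper lower; rewrite !addn2 !ltnS => -> ->.
Qed.

Lemma curve_smooth_irreducible : smooth_irreducible_curve C.
Proof.
split; first exact: curve_homogeneous.
- exact: curve_irreducible.
- exact: curve_has_dim1.
- exact: curve_smooth.
Qed.

End Smooth.

(** * Hilbert polynomial *)

Section Ideal.

Variables (k : fieldType) (n : nat) (X : seq {mpoly k[n.+1]}).

Lemma in_ideal0 : in_ideal X 0.
Proof. by exists (fun=> 0); rewrite big1 // => i _; rewrite mul0r. Qed.

Lemma in_idealD F G : in_ideal X F -> in_ideal X G -> in_ideal X (F + G).
Proof.
move=> [h ->] [l ->]; exists (fun i => h i + l i).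
by rewrite -big_split; apply: eq_bigr => i _; rewrite mulrDl.
Qed.

Lemma in_idealMl F G : in_ideal X F -> in_ideal X (G * F).
Proof.
move=> [h ->]; exists (fun i => G * h i).
by rewrite big_distrr; apply: eq_bigr => i _; rewrite /= mulrA.
Qed.

Lemma in_ideal_mem F : F \in X -> in_ideal X F.
Proof.
move=> FX; have iX : (index F X < size X)%N by rewrite index_mem.
exists (fun i => (i == Ordinal iX)%:R); rewrite (bigD1 (Ordinal iX)) //= eqxx mul1r.
by rewrite nth_index // big1 ?addr0 // => i /negPf->; rewrite mul0r.
Qed.

Definition cong F G := in_ideal X (F - G).

Lemma cong_refl F : cong F F.
Proof. by rewrite /cong subrr; apply: in_ideal0. Qed.

Lemma cong_eq F G : F = G -> cong F G.
Proof. by move->; apply: cong_refl. Qed.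

Lemma cong_trans G F H : cong F G -> cong G H -> cong F H.
Proof. by move=> c1 c2; have := in_idealD c1 c2; rewrite addrA subrK. Qed.

Lemma congD F G F' G' : cong F F' -> cong G G' -> cong (F + G) (F' + G').
Proof.
move=> c1 c2; have := in_idealD c1 c2; rewrite /cong.
by rewrite opprD addrACA.
Qed.

Lemma congM H F G : cong F G -> cong (H * F) (H * G).
Proof. by move=> c; rewrite /cong -mulrBr; apply: in_idealMl. Qed.

Lemma congZ c F G : cong F G -> cong (c *: F) (c *: G).
Proof. by rewrite -!mul_mpolyC; apply: congM. Qed.

Lemma cong_sum I (r : seq I) (F G : I -> {mpoly k[n.+1]}) :
  (forall i, cong (F i) (G i)) -> cong (\sum_(i <- r) F i) (\sum_(i <- r) G i).
Proof.
move=> c; elim: r => [|i r IHr]; first by rewrite !big_nil; apply: cong_refl.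
by rewrite !big_cons; apply: congD.
Qed.

End Ideal.

(** * Normal forms modulo the ideal of the curve *)

Section Hilbert.

Variables (k : fieldType) (g : nat) (b : k).

Local Notation C := (curve g b).
Local Notation f := (fpoly g b false).
Local Notation "F =I G" := (cong C F G) (at level 70).
Local Notation x := (xv k g).
Local Notation y := (yv k g).

Lemma veronese_cong i j : (i <= g.+1)%N -> (j <= g.+1)%N ->
  x i * x j =I x (lo g i j) * x (hi g i j).
Proof.
by move=> li lj; apply: in_ideal_mem; apply/mem_curve; right; exists i, j.
Qed.

Lemma quadric_cong : y ^+ 2 =I (x g.+1 + x 0) * (x g.+1 + b *: x 0).
Proof. by apply: in_ideal_mem; apply/mem_curve; left. Qed.

(* A monomial of degree d and weight w in the x_i, using x_k as often as       *)
(* possible; it is congruent to all monomials of this degree and weight.       *)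
Fixpoint smon (d w : nat) : {mpoly k[g.+3]} :=
  if d is d'.+1 then x (minn w g.+1) * smon d' (w - g.+1) else 1.

(** If w >= k a factor x_k splits off and induction applies. Otherwise [smon] consists of x_w and
    powers of x_0, and one Veronese relation rewrites x_i x_w. *)
Lemma smon_mul d w i : (i <= g.+1)%N -> (w <= g.+1 * d)%N ->
  x i * smon d w =I smon d.+1 (w + i).
Proof.
move=> li; elim: d w => [|d IHd] w lw.
  have -> : w = 0%N by rewrite muln0 in lw; apply/eqP; rewrite -leqn0.
  by rewrite /= add0n (minn_idPl li); apply: cong_refl.
have [lkw|lwk] := leqP g.+1 w.
  rewrite [smon d.+1 w]/= (minn_idPr lkw) mulrCA.
  have -> : smon d.+2 (w + i) = x g.+1 * smon d.+1 (w - g.+1 + i).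
    by rewrite [LHS]/= (minn_idPr (leq_trans lkw (leq_addr _ _))) addnBAC.
  by apply: congM; apply: IHd; rewrite leq_subLR -mulnS.
rewrite [smon d.+1 w]/= (minn_idPl (ltnW lwk)) (eqP (ltnW lwk)) mulrA mulrC.
apply: (@cong_trans _ _ _ (smon d 0 * (x (lo g i w) * x (hi g i w)))).
  by apply: congM; apply: veronese_cong => //; apply: ltnW.
apply: cong_eq; rewrite mulrC /lo /hi /lo; case: ifP => le.
  rewrite subn0 /= [(w + i)%N]addnC (minn_idPl le) (eqP le) min0n sub0n; ring.
have le' : (g.+1 <= w + i)%N by rewrite addnC ltnW // ltnNge le.
have le2 : (w + i - g.+1 <= g.+1)%N by rewrite leq_subLR leq_add // ltnW.
by rewrite /= (minn_idPr le') (minn_idPl le2) (eqP le2) [(i + w)%N]addnC mulrA.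
Qed.

(** Homogenization in degree d of a polynomial in the affine coordinate x. *)
Definition spoly d (P : {poly k}) := \sum_(w < size P) P`_w *: smon d w.

Lemma spolyE N d (P : {poly k}) : (size P <= N)%N -> spoly d P = \sum_(w < N) P`_w *: smon d w.
Proof.
move=> le; rewrite /spoly -!(big_mkord xpredT (fun w => P`_w *: smon d w)).
rewrite [RHS](@big_cat_nat _ _ _ (size P)) //= [X in _ = _ + X]big_nat [X in _ = _ + X]big1 ?addr0 // => w /andP[lw _].
by rewrite nth_default // scale0r.
Qed.

Lemma spolyD d (P Q : {poly k}) : spoly d (P + Q) = spoly d P + spoly d Q.
Proof.
pose N := maxn (size P) (size Q).
rewrite !(spolyE (N := N)) ?leq_maxl ?leq_maxr ?size_polyD // -big_split.
by apply: eq_bigr => w _; rewrite coefD scalerDl.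
Qed.

Lemma spolyZ d c (P : {poly k}) : spoly d (c *: P) = c *: spoly d P.
Proof.
rewrite !(spolyE (N := size P)) ?size_scale_leq // scaler_sumr.
by apply: eq_bigr => w _; rewrite coefZ scalerA.
Qed.

Lemma spoly_mul d i (P : {poly k}) : (i <= g.+1)%N -> (size P <= (g.+1 * d).+1)%N ->
  x i * spoly d P =I spoly d.+1 ('X^i * P).
Proof.
move=> li leP; have leX : (size ('X^i * P)%R <= i + size P)%N.
  by rewrite (leq_trans (size_polyMleq _ _)) // size_polyXn.
rewrite (spolyE d.+1 leX) big_split_ord /= [X in _ =I X + _]big1 ?add0r; last first.
  by move=> w _; rewrite coefXnM ltn_ord scale0r.
rewrite big_distrr /= /spoly; apply: cong_sum => w.
rewrite coefXnM ltnNge leq_addr addKn -scalerAr addnC; apply: congZ.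
by apply: smon_mul => //; rewrite -ltnS (leq_trans _ leP).
Qed.

Lemma size_XnM i (P : {poly k}) N : (size P <= N)%N -> (size ('X^i * P)%R <= i + N)%N.
Proof.
move=> leP; rewrite (leq_trans (size_polyMleq _ _)) // size_polyXn /=.
by rewrite leq_add2l.
Qed.

Lemma size_fpolyM (P : {poly k}) N : (size P <= N)%N -> (size (f * P)%R <= (g.+1).*2 + N)%N.
Proof.
move=> leP; rewrite (leq_trans (size_polyMleq _ _)) //.
have s2 : (size f <= (g.+1).*2.+1)%N.
  rewrite fpolyE -polyC1 (leq_trans (size_polyMleq _ _)) // !size_XnaddC //.
  by rewrite -addnn addnS.
by move: s2 leP; lia.
Qed.

Lemma spoly_y2 d (P : {poly k}) : (size P <= (g.+1 * d).+1)%N ->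
  y ^+ 2 * spoly d P =I spoly d.+2 (f * P).
Proof.
move=> leP; have [l0 lk] : (0 <= g.+1)%N /\ (g.+1 <= g.+1)%N by [].
have key i j : (i <= g.+1)%N -> (j <= g.+1)%N ->
    x i * x j * spoly d P =I spoly d.+2 ('X^i * ('X^j * P)).
  move=> li lj; rewrite -mulrA.
  apply: (cong_trans (congM (x i) (spoly_mul lj leP))); apply: spoly_mul => //.
  by rewrite (leq_trans (size_XnM j leP)) // addnS ltnS mulnS leq_add2r.
rewrite mulrC.
apply: (@cong_trans _ _ _ (spoly d P * ((x g.+1 + x 0) * (x g.+1 + b *: x 0)))).
  by apply: congM; apply: quadric_cong.
have -> : spoly d P * ((x g.+1 + x 0) * (x g.+1 + b *: x 0)) =
    (x g.+1 * x g.+1 * spoly d P + b *: (x g.+1 * x 0 * spoly d P))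
    + (x 0 * x g.+1 * spoly d P + b *: (x 0 * x 0 * spoly d P)).
  by rewrite -!mul_mpolyC; ring.
have -> : f * P = ('X^(g.+1) * ('X^(g.+1) * P) + b *: ('X^(g.+1) * ('X^0 * P)))
    + ('X^0 * ('X^(g.+1) * P) + b *: ('X^0 * ('X^0 * P))).
  by rewrite fpolyE expr0 -!mul_polyC; ring.
rewrite !spolyD !spolyZ.
by do 2!apply: congD; try apply: congZ; apply: key.
Qed.

(** The outer variable of {poly {poly k}} stands for y and the inner one for x. *)
Definition vals (i : 'I_g.+3) : {poly {poly k}} :=
  if i == ord_max then 'X else ('X^i)%:P.

Definition evb (F : {mpoly k[g.+3]}) : {poly {poly k}} :=
  mmap (polyC \o polyC) vals F.

(* F (1, x, ..., x^k, y) = redA F + redB F y modulo y^2 = f.                    *)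
Definition redA F := (even_poly (evb F)).[f].
Definition redB F := (odd_poly (evb F)).[f].

Lemma evb_x i F : (i <= g.+1)%N -> evb (x i * F) = 'X^i *: evb F.
Proof.
move=> li; rewrite /evb rmorphM /= mmapX mmap1U /vals -val_eqE /= inordK; last by rewrite ltnS leqW.
by rewrite ltn_eqF // mul_polyC.
Qed.

Lemma evb_y F : evb (y * F) = evb F * 'X.
Proof. by rewrite /evb rmorphM /= mmapX mmap1U /vals eqxx mulrC. Qed.

Lemma evbZ c F : evb (c *: F) = c%:P *: evb F.
Proof. by rewrite /evb mmapZ /= mul_polyC. Qed.

Lemma evbD F G : evb (F + G) = evb F + evb G.
Proof. exact: mmapD. Qed.

Lemma evb1 : evb 1 = 1.
Proof. exact: rmorph1. Qed.

Lemma evbM F G : evb (F * G) = evb F * evb G.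
Proof. exact: rmorphM. Qed.

Lemma evb_xE i : (i <= g.+1)%N -> evb (x i) = ('X^i)%:P.
Proof. by move=> li; rewrite -[x i]mulr1 evb_x // evb1 -mul_polyC mulr1. Qed.

Lemma evb_quadric : evb (quadric g b) = 'X ^+ 2 - f%:P.
Proof.
have eN F : evb (- F) = - evb F by apply: rmorphN.
rewrite /quadric evbD eN expr2 evb_y !evbM !evbD evbZ !evb_xE // expr0.
rewrite -[y]mulr1 evb_y evb1 mul1r fpolyE -mul_polyC polyCM !polyCD; ring.
Qed.

Lemma evb_veronese i j : (i <= g.+1)%N -> (j <= g.+1)%N -> evb (veronese k g i j) = 0.
Proof.
move=> li lj; have [l1 l2 e] := lo_hi li lj; have eN F : evb (- F) = - evb F by apply: rmorphN.
by rewrite /veronese evbD eN !evbM !evb_xE // -!polyCM -!exprD e subrr.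
Qed.

Lemma redA_x i F : (i <= g.+1)%N -> redA (x i * F) = 'X^i * redA F.
Proof. by move=> li; rewrite /redA evb_x // even_polyZ hornerZ. Qed.

Lemma redB_x i F : (i <= g.+1)%N -> redB (x i * F) = 'X^i * redB F.
Proof. by move=> li; rewrite /redB evb_x // odd_polyZ hornerZ. Qed.

Lemma redA_y F : redA (y * F) = f * redB F.
Proof. by rewrite /redA evb_y even_polyMX hornerMX mulrC. Qed.

Lemma redB_y F : redB (y * F) = redA F.
Proof. by rewrite /redB evb_y odd_polyMX. Qed.

Lemma redAZ c F : redA (c *: F) = c *: redA F.
Proof. by rewrite /redA evbZ even_polyZ hornerZ mul_polyC. Qed.

Lemma redBZ c F : redB (c *: F) = c *: redB F.
Proof. by rewrite /redB evbZ odd_polyZ hornerZ mul_polyC. Qed.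

Lemma redAD F G : redA (F + G) = redA F + redA G.
Proof. by rewrite /redA evbD even_polyD hornerD. Qed.

Lemma redBD F G : redB (F + G) = redB F + redB G.
Proof. by rewrite /redB evbD odd_polyD hornerD. Qed.

Lemma redA1 : redA 1 = 1.
Proof. by rewrite /redA evb1 even_polyC hornerC. Qed.

Lemma redB1 : redB 1 = 0.
Proof. by rewrite /redB evb1 odd_polyC horner0. Qed.

Lemma redA0 : redA 0 = 0. Proof. by rewrite -(scale0r 0) redAZ scale0r. Qed.
Lemma redB0 : redB 0 = 0. Proof. by rewrite -(scale0r 0) redBZ scale0r. Qed.

Lemma red_sum I (r : seq I) (F : I -> {mpoly k[g.+3]}) :
  redA (\sum_(i <- r) F i) = \sum_(i <- r) redA (F i) /\
  redB (\sum_(i <- r) F i) = \sum_(i <- r) redB (F i).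
Proof.
elim: r => [|i r [IHA IHB]]; first by rewrite !big_nil redA0 redB0.
by rewrite !big_cons redAD redBD IHA IHB.
Qed.

(** The Veronese relations evaluate to 0 and the quadric to Y^2 - f; in a multiple of the latter the
    even and odd parts vanish once Y^2 is replaced by f. *)
Lemma red_ideal F : in_ideal C F -> redA F = 0 /\ redB F = 0.
Proof.
move=> [h ->]; have [-> ->] := red_sum (index_enum _) (fun i => h i * C`_i).
suff e F0 G : F0 \in C -> redA (G * F0) = 0 /\ redB (G * F0) = 0.
  by rewrite !big1 // => i _; have [] := e C`_i (h i) (mem_nth _ (ltn_ord i)).
case/mem_curve => [->|[i [j [li lj ->]]]]; rewrite /redA /redB evbM.
  rewrite evb_quadric mulrBr [X in _ - X]mulrC mul_polyC expr2 mulrA.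
  rewrite even_polyD odd_polyD !raddfN /= even_polyZ odd_polyZ.
  rewrite !(even_polyMX, odd_polyMX) !hornerD !hornerN !hornerZ !hornerMX.
  by split; rewrite [_ * f]mulrC subrr.
by rewrite evb_veronese // mulr0 even_polyC odd_polyC !horner0.
Qed.

Definition nrmB d (Q : {poly k}) := if d is d'.+1 then y * spoly d' Q else 0.

(** The factor y uses up one degree, which explains the smaller bound on the second part; in degree
    0 that part has to be zero. *)
Definition normal_form d F := [/\ (size (redA F) <= (g.+1 * d).+1)%N,
  (size (redB F) <= if d is d'.+1 then (g.+1 * d').+1 else 0)%N &
  F =I spoly d (redA F) + nrmB d (redB F)].

Lemma normal_form_lin d c F G :
  normal_form d F -> normal_form d G -> normal_form d (c *: F + G).
Proof.
move=> [a1 b1 c1] [a2 b2 c2]; rewrite /normal_form redAD redAZ redBD redBZ; split.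
- by rewrite (leq_trans (size_polyD _ _)) // geq_max a2 (leq_trans (size_scale_leq _ _)).
- by rewrite (leq_trans (size_polyD _ _)) // geq_max b2 (leq_trans (size_scale_leq _ _)).
have -> : nrmB d (c *: redB F + redB G) = c *: nrmB d (redB F) + nrmB d (redB G).
  rewrite /nrmB; case: (d) => [|d']; first by rewrite scaler0 addr0.
  by rewrite spolyD spolyZ mulrDr -scalerAr.
rewrite spolyD spolyZ addrACA -scalerDr; exact: congD (congZ c c1) c2.
Qed.

Lemma normal_form_x d i F : (i <= g.+1)%N -> normal_form d F -> normal_form d.+1 (x i * F).
Proof.
move=> li [sA sB cF]; rewrite /normal_form redA_x // redB_x //; split.
- by rewrite (leq_trans (size_XnM i sA)) // addnS ltnS mulnS leq_add2r.
- case: d sB {sA cF} => [|d] sB; last first.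
    by rewrite (leq_trans (size_XnM i sB)) // addnS ltnS mulnS leq_add2r.
  by move: sB; rewrite leqn0 size_poly_eq0 => /eqP->; rewrite mulr0 size_poly0.
apply: (cong_trans (congM (x i) cF)); rewrite mulrDr; apply: congD.
  exact: spoly_mul.
case: d sB {sA cF} => [|d] sB.
  move: sB; rewrite leqn0 size_poly_eq0 => /eqP->.
  by rewrite /nrmB mulr0 mulr0 /spoly size_poly0 big_ord0 mulr0; apply: cong_refl.
by rewrite /nrmB mulrCA; apply: congM; apply: spoly_mul.
Qed.

Lemma normal_form_y d F : normal_form d F -> normal_form d.+1 (y * F).
Proof.
move=> [sA sB cF]; rewrite /normal_form redA_y redB_y; split=> //.
  case: d sB {sA cF} => [|d] sB; last by rewrite (leq_trans (size_fpolyM sB)) //; lia.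
  by move: sB; rewrite leqn0 size_poly_eq0 => /eqP->; rewrite mulr0 size_poly0.
apply: (cong_trans (congM y cF)); rewrite mulrDr addrC; apply: congD; last first.
  exact: cong_refl.
case: d sB {sA cF} => [|d] sB.
  move: sB; rewrite leqn0 size_poly_eq0 => /eqP->.
  by rewrite /nrmB mulr0 mulr0 /spoly size_poly0 big_ord0; apply: cong_refl.
by rewrite /nrmB mulrA -expr2; apply: spoly_y2.
Qed.

Lemma normal_form0 d : normal_form d 0.
Proof.
have sp0 e : spoly e 0 = 0 by rewrite /spoly size_poly0 big_ord0.
rewrite /normal_form redA0 redB0 size_poly0 sp0 add0r; split=> //.
by case: d => [|d]; rewrite /nrmB ?sp0 ?mulr0; apply: cong_refl.
Qed.

Lemma normal_form_mon d (m : 'X_{1..g.+3}) : mdeg m = d -> normal_form d 'X_[m].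
Proof.
elim: d m => [|d IHd] m dm.
  have -> : m = 0%MM by apply/eqP; rewrite -mdeg_eq0 dm.
  rewrite mpolyX0 /normal_form redA1 redB1 size_poly1 size_poly0 muln0; split=> //.
  by rewrite /spoly size_poly1 big_ord1 coef1 /= scale1r addr0; apply: cong_refl.
have [i mi] : exists i, (0 < m i)%N.
  apply/existsP; apply: contraPT (esym dm) => /existsPn m0.
  by rewrite mdegE big1 // => i _; apply/eqP; rewrite -leqn0 leqNgt m0.
have lm : (U_(i) <= m)%MM by rewrite lep1mP -lt0n.
have dm' : mdeg (m - U_(i))%MM = d by apply/eqP; rewrite -eqSS -dm -{2}(submK lm) mdegD mdeg1 addn1.
rewrite -(submK lm) addmC mpolyXD; have [ei|ni] := eqVneq i ord_max.
  by rewrite ei in dm' *; apply: normal_form_y; apply: IHd.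
have li : (i <= g.+1)%N.
  have := ltn_ord i; rewrite ltnS leq_eqVlt => /orP[/eqP e|//].
  by case/eqP: ni; apply: val_inj.
by rewrite -[i]inord_val; apply: normal_form_x => //; apply: IHd; rewrite inord_val.
Qed.

Lemma normal_formP d F : F \is d.-homog -> normal_form d F.
Proof.
move=> /dhomogP hF; rewrite [F]mpolyE big_seq; apply: big_ind => [|G H nG nH|m mF].
- exact: normal_form0.
- by rewrite -[G]scale1r; apply: normal_form_lin.
rewrite -[_ *: _]addr0; apply: normal_form_lin; last exact: normal_form0.
by apply: normal_form_mon; apply: hF.
Qed.

Lemma smon_homog d w : smon d w \is d.-homog.
Proof.
elim: d w => [|d IHd] w /=; first exact: dhomog1.
exact: (dhomogM (xv_homog k g _) (IHd _)).
Qed.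

Lemma spoly_homog d P : spoly d P \is d.-homog.
Proof. by apply: rpred_sum => w _; apply: rpredZ; apply: smon_homog. Qed.

Lemma red_smon d w : (w <= g.+1 * d)%N -> redA (smon d w) = 'X^w /\ redB (smon d w) = 0.
Proof.
elim: d w => [|d IHd] w lw.
  have -> : w = 0%N by rewrite muln0 in lw; apply/eqP; rewrite -leqn0.
  by rewrite redA1 redB1 expr0.
have [|eA eB] := IHd (w - g.+1)%N; first by rewrite leq_subLR -mulnS.
rewrite /= redA_x ?redB_x ?geq_minr // eA eB mulr0 -exprD.
by split=> //; congr ('X^_); rewrite minnE; lia.
Qed.

Lemma red_spoly d (P : {poly k}) : (size P <= (g.+1 * d).+1)%N ->
  redA (spoly d P) = P /\ redB (spoly d P) = 0.
Proof.
move=> leP; rewrite /spoly.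
have [-> ->] := red_sum (index_enum _) (fun w : 'I_(size P) => P`_w *: smon d w).
have e (w : 'I_(size P)) := @red_smon d w (leq_trans (ltn_ord w) leP).
split; last by rewrite big1 // => w _; rewrite redBZ (e w).2 scaler0.
rewrite -[RHS]coefK poly_def; apply: eq_bigr => w _.
by rewrite redAZ (e w).1.
Qed.

Section Degree.

Variable d : nat.

Definition coordsA (F : dhomog g.+3 k d.+1) : 'rV[k]_(g.+1 * d.+1).+1 :=
  \row_w (redA (val F))`_w.

Definition coordsB (F : dhomog g.+3 k d.+1) : 'rV[k]_(g.+1 * d).+1 :=
  \row_w (redB (val F))`_w.

Definition coords F := row_mx (coordsA F) (coordsB F).

Lemma coords_is_linear : linear coords.
Proof.
move=> c F G; rewrite scale_row_mx add_row_mx; congr row_mx; apply/rowP => w.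
  by rewrite !mxE /= redAD redAZ coefD coefZ.
by rewrite !mxE /= redBD redBZ coefD coefZ.
Qed.

HB.instance Definition _ := GRing.isLinear.Build k (dhomog g.+3 k d.+1)
  'rV[k]_((g.+1 * d.+1).+1 + (g.+1 * d).+1) _ coords coords_is_linear.

Lemma coords_eq0 F : coords F = 0 <-> in_ideal C (val F).
Proof.
split=> [|/red_ideal[A0 B0]]; last first.
  rewrite /coords /coordsA /coordsB A0 B0 -row_mx0.
  by congr row_mx; apply/rowP => w; rewrite !mxE coef0.
rewrite /coords -[0]row_mx0 => /eq_row_mx[A0 B0].
have [sA sB] := normal_formP (dhomog_is_dhomog F).
have -> : redA (val F) = 0.
  apply/polyP => w; rewrite coef0; have [lw|lw] := ltnP w (g.+1 * d.+1).+1.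
    by have := congr1 (fun M : 'rV_(_) => M 0 (Ordinal lw)) A0; rewrite !mxE.
  by rewrite nth_default // (leq_trans sA).
have -> : redB (val F) = 0.
  apply/polyP => w; rewrite coef0; have [lw|lw] := ltnP w (g.+1 * d).+1.
    by have := congr1 (fun M : 'rV_(_) => M 0 (Ordinal lw)) B0; rewrite !mxE.
  by rewrite nth_default // (leq_trans sB).
by rewrite /nrmB /spoly size_poly0 !big_ord0 mulr0 addr0 /cong subr0.
Qed.

Lemma coords_surj (M : 'rV[k]_((g.+1 * d.+1).+1 + (g.+1 * d).+1)) : exists F, coords F = M.
Proof.
pose P := rVpoly (lsubmx M); pose Q := rVpoly (rsubmx M).
have sP : (size P <= (g.+1 * d.+1).+1)%N by apply: size_poly.
have sQ : (size Q <= (g.+1 * d).+1)%N by apply: size_poly.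
have hom : spoly d.+1 P + y * spoly d Q \is d.+1.-homog.
  apply: rpredD; first exact: spoly_homog.
  exact: (dhomogM (yv_homog k g) (spoly_homog _ _)).
exists (DHomog hom); rewrite -[M]hsubmxK /coords /coordsA /coordsB /=.
have [eA eB] := red_spoly sP; have [eA' eB'] := red_spoly sQ.
rewrite redAD redBD redA_y redB_y eA eB eA' eB' mulr0 addr0 add0r.
by congr row_mx; apply/rowP => w; rewrite mxE coef_rVpoly_ord.
Qed.

(** Rank-nullity for [coords], a surjective linear map whose kernel is the ideal in degree d + 1. *)
Lemma curve_hilbert_fun : hilbert_fun C d.+1 ((g.+1 * d.+1).+1 + (g.+1 * d).+1).
Proof.
exists (lker (linfun coords)); split=> [F|].
  rewrite memv_ker lfunE /=.
  by split=> [/eqP/coords_eq0 | /coords_eq0/eqP].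
have := limg_ker_dim (linfun coords) fullv; rewrite capfv => <-; rewrite addnC; congr addn.
suff -> : limg (linfun coords) = fullv by rewrite dimvf /dim /= mul1n.
apply/eqP; rewrite eqEsubv subvf; apply/subvP => M _.
by have [F <-] := coords_surj M; rewrite -[coords F]lfunE memv_img ?memvf.
Qed.

End Degree.

(** For d >= 1 the Hilbert function is (k d + 1) + (k (d - 1) + 1) = 2 k d + 1 - g. *)
Lemma curve_genus : has_genus C g.
Proof.
exists ((g.+1.*2)%:R *: 'X + (1 - g%:R)%:P).
  (* Degree 0 is left out: the formula would give 1 - g there. *)
  exists 1%N => -[|d] // _; exists ((g.+1 * d.+1).+1 + (g.+1 * d).+1)%N.
    exact: curve_hilbert_fun.
  have e : (g.+1.*2 * d.+1 + 1 = (g.+1 * d.+1).+1 + (g.+1 * d).+1 + g)%N by lia.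
  move/(congr1 (fun m => m%:R : rat)): e; rewrite natrD natrM [in RHS]natrD => e.
  by rewrite hornerD hornerZ hornerX hornerC addrA e addrK.
by rewrite hornerD hornerZ hornerX hornerC mulr0 add0r opprB addrC subrK.
Qed.

End Hilbert.

(** * Composition and Frobenius twist of isomorphisms *)

Lemma line_eqP (F : fieldType) n (u v : 'rV[F]_n) : v != 0 ->
  reflect (exists2 c, c != 0 & u = c *: v) (u == v)%MS.
Proof.
move=> nzv; apply: (iffP idP) => [/andP[/sub_rVP[c ->] /sub_rVP[e ev]]|[c nzc ->]].
  exists c => //; apply: contraNneq nzv => c0.
  by rewrite ev c0 scale0r scaler0.
by apply/eqmxP/eqmx_scale.
Qed.

Lemma line_sym (F : fieldType) n (u v : 'rV[F]_n) : (u == v)%MS = (v == u)%MS.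
Proof. by rewrite andbC. Qed.

Lemma line_trans (F : fieldType) n (v u w : 'rV[F]_n) :
  (u == v)%MS -> (v == w)%MS -> (u == w)%MS.
Proof. by move=> /eqmxP e /eqmxP e'; apply/eqmxP; apply: eqmx_trans e e'. Qed.

Lemma dhomog_comp (k : fieldType) n m d e (G : {mpoly k[n]}) (F : n.-tuple {mpoly k[m]}) :
  G \is d.-homog -> (forall i, tnth F i \is e.-homog) -> G \mPo F \is (e * d).-homog.
Proof.
move=> /dhomogP hG hF; rewrite comp_mpolyEX big_seq; apply: rpred_sum => M MG.
apply: rpredZ; rewrite comp_mpolyX -(hG M MG) /= mdegE big_distrr /=.
apply: (big_ind2 (fun P l => P \is l.-homog)); first exact: dhomog1.
  by move=> P1 l1 P2 l2; apply: dhomogM.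
by move=> i _; apply: dhomogMn.
Qed.

Definition row_eval (k : fieldType) m n (F : 'I_n -> {mpoly k[m]}) (v : 'rV[k]_m) :
  'rV[k]_n := \row_i (F i).@[v 0].

Lemma row_evalZ (k : fieldType) m n (F : 'I_n -> {mpoly k[m]}) d c v :
  (forall i, F i \is d.-homog) -> row_eval F (c *: v) = c ^+ d *: row_eval F v.
Proof. by move=> hF; apply/rowP => i; rewrite !mxE (meval_homog _ _ (hF i)). Qed.

Section Morphisms.

Variable K : closedFieldType.

(** [phi] is a mere function on row vectors; its compatibility with scaling has to be drawn from the
    forms that represent it locally. *)
Lemma morphism_eqmx m n (X : seq {mpoly K[m.+1]}) (Y : seq {mpoly K[n.+1]}) phi u v :
  is_morphism X Y phi -> point_of X u -> point_of X v -> (u == v)%MS ->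
  (phi u == phi v)%MS.
Proof.
move=> mor pu pv; have nzv : v != 0 by case/andP: pv.
have [_ [d [F [hF Fu agree]]]] := mor u pu.
move=> /(line_eqP _ nzv)[c nzc eu].
have Fu' : row_eval F u = c ^+ d *: row_eval F v by rewrite eu (row_evalZ c v hF).
have Fv : row_eval F v != 0.
  by apply: contraNneq Fu => F0; rewrite -/(row_eval F u) Fu' F0 scaler0.
apply: (line_trans (agree u pu Fu)); rewrite line_sym; apply: (line_trans (agree v pv Fv)).
by rewrite line_sym -/(row_eval F u) Fu'; apply/(line_eqP _ Fv); exists (c ^+ d); rewrite ?expf_neq0.
Qed.

Lemma morphism_comp l m n (X : seq {mpoly K[l.+1]}) (Y : seq {mpoly K[m.+1]})
    (Z : seq {mpoly K[n.+1]}) phi psi :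
  is_morphism X Y phi -> is_morphism Y Z psi -> is_morphism X Z (psi \o phi).
Proof.
move=> mphi mpsi u pu; have [pphi [d [F [hF Fu Fagree]]]] := mphi u pu.
have [ppsi [e [G [hG Gu Gagree]]]] := mpsi _ pphi; split=> //=.
rewrite -/(row_eval F u) -/(row_eval G _) in Fu Gu.
have [j Fj] : exists j, row_eval F u 0 j != 0.
  apply/existsP; apply: contraNT Fu => /existsPn F0.
  by apply/eqP/rowP => j; have /negPn/eqP -> := F0 j; rewrite mxE.
(* The extra factor F_j makes H vanish wherever all the forms F vanish, so that F represents [phi]
   wherever H is nonzero. *)
pose H i := F j * (G i \mPo [tuple F a | a < m.+1]).
have hH i : H i \is (d + d * e).-homog.
  by apply: dhomogM => //; apply: dhomog_comp => // a; rewrite tnth_mktuple.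
have eH v : row_eval H v = row_eval F v 0 j *: row_eval G (row_eval F v).
  apply/rowP => i; rewrite !mxE mevalM comp_mpoly_meval; congr (_ * _).
  by apply: meval_eq => a; rewrite tnth_mktuple mxE.
have GF v : point_of X v -> row_eval F v != 0 ->
    exists2 c, c != 0 & row_eval G (phi v) = c *: row_eval G (row_eval F v).
  move=> pv Fv; have /(line_eqP _ Fv)[c nzc ->] := Fagree v pv Fv.
  by exists (c ^+ e); rewrite ?expf_neq0 // (row_evalZ _ _ hG).
exists (d + d * e)%N, H; split=> //; rewrite -/(row_eval H _).
  rewrite eH scaler_eq0 negb_or Fj; have [c nzc ec] := GF u pu Fu.
  by apply: contraNneq Gu => G0; rewrite ec G0 scaler0.
move=> v pv; rewrite -/(row_eval H v) eH scaler_eq0 negb_or => /andP[Fjv GFv].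
have Fv : row_eval F v != 0 by apply: contraNneq Fjv => ->; rewrite mxE.
have [c nzc ec] := GF v pv Fv; have [pv' _] := mphi v pv.
have Gv : row_eval G (phi v) != 0 by rewrite ec scaler_eq0 negb_or nzc.
apply: (line_trans (Gagree _ pv' Gv)); rewrite -/(row_eval G _) ec.
apply: (@line_trans _ _ (row_eval G (row_eval F v))).
  by apply/(line_eqP _ GFv); exists c.
by rewrite line_sym; apply/(line_eqP _ GFv); eexists; first exact: Fjv.
Qed.

Lemma isomorphic_sym m n (X : seq {mpoly K[m.+1]}) (Y : seq {mpoly K[n.+1]}) :
  isomorphic X Y -> isomorphic Y X.
Proof. by move=> [phi [psi [m1 m2 i1 i2]]]; exists psi, phi; split. Qed.

Lemma isomorphic_trans l m n (X : seq {mpoly K[l.+1]}) (Y : seq {mpoly K[m.+1]})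
    (Z : seq {mpoly K[n.+1]}) :
  isomorphic X Y -> isomorphic Y Z -> isomorphic X Z.
Proof.
move=> [phi [psi [m1 m2 i1 i2]]] [phi' [psi' [m1' m2' i1' i2']]].
exists (phi' \o phi), (psi \o psi'); split=> [||u pu|u pu] /=; try exact: morphism_comp m1 m1'.
- exact: morphism_comp m2' m2.
- have [p1 _] := m1 u pu; have [p2 _] := m1' _ p1; have [p3 _] := m2' _ p2.
  exact: line_trans (morphism_eqmx m2 p3 p1 (i1' _ p1)) (i1 u pu).
have [p1 _] := m2' u pu; have [p2 _] := m2 _ p1; have [p3 _] := m1 _ p2.
exact: line_trans (morphism_eqmx m1' p3 p1 (i2 _ p1)) (i2' u pu).
Qed.

Section Twist.

Variables (tau : {rmorphism K -> K}) (rho : K -> K).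
Hypothesis rhoK : cancel rho tau.

Let tauK : cancel tau rho.
Proof. by move=> x; apply: (fmorph_inj tau); rewrite rhoK. Qed.

Lemma meval_map_mpoly n (F : {mpoly K[n]}) (u : 'rV[K]_n) :
  (map_mpoly tau F).@[map_mx tau u 0] = tau F.@[u 0].
Proof.
rewrite !mevalE (perm_big _ (msupp_map_mpoly _ (fmorph_inj tau))) rmorph_sum /=.
apply: eq_bigr => m _; rewrite mcoeff_map_mpoly rmorphM rmorph_prod; congr (_ * _).
by apply: eq_bigr => i _; rewrite mxE rmorphXn.
Qed.

Lemma point_of_twist n (X : seq {mpoly K[n.+1]}) u :
  point_of (base_change tau X) (map_mx tau u) = point_of X u.
Proof.
rewrite /point_of map_mx_eq0; congr (_ && _); rewrite all_map.
by apply: eq_all => F /=; rewrite meval_map_mpoly fmorph_eq0.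
Qed.

(** The conjugate of [phi] by the automorphism [tau] with inverse [rho]; it is represented by the
    forms of [phi] with [tau] applied to their coefficients. *)
Definition twist m n (phi : 'rV[K]_m -> 'rV[K]_n) (v : 'rV[K]_m) : 'rV[K]_n :=
  map_mx tau (phi (map_mx rho v)).

Lemma map_rhoK n (v : 'rV[K]_n) : map_mx tau (map_mx rho v) = v.
Proof. by apply/rowP => i; rewrite !mxE rhoK. Qed.

Lemma map_tauK n (v : 'rV[K]_n) : map_mx rho (map_mx tau v) = v.
Proof. by apply/rowP => i; rewrite !mxE tauK. Qed.

Lemma line_map n (u v : 'rV[K]_n) : (map_mx tau u == map_mx tau v)%MS = (u == v)%MS.
Proof. by rewrite !map_submx. Qed.

Lemma morphism_twist m n (X : seq {mpoly K[m.+1]}) (Y : seq {mpoly K[n.+1]}) phi :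
  is_morphism X Y phi ->
  is_morphism (base_change tau X) (base_change tau Y) (twist phi).
Proof.
move=> mphi v; rewrite -[v]map_rhoK; set u := map_mx rho v; rewrite point_of_twist => pu.
have [pphi [d [F [hF Fu Fagree]]]] := mphi u pu.
have eF w : row_eval (fun i => map_mpoly tau (F i)) (map_mx tau w) = map_mx tau (row_eval F w).
  by apply/rowP => i; rewrite !mxE meval_map_mpoly.
rewrite /twist map_tauK point_of_twist; split=> //.
exists d, (fun i => map_mpoly tau (F i)); rewrite /= -!/(row_eval _ _); split.
- move=> i; apply/dhomogP => M; rewrite (perm_mem (msupp_map_mpoly _ (fmorph_inj tau))).
  exact: (dhomogP _ _ _ (hF i)).
- by rewrite eF map_mx_eq0.
move=> w; rewrite -[w]map_rhoK point_of_twist -/(row_eval _ _) eF map_mx_eq0 => pw Fw.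
by rewrite map_tauK line_map; apply: Fagree.
Qed.

Lemma isomorphic_twist m n (X : seq {mpoly K[m.+1]}) (Y : seq {mpoly K[n.+1]}) :
  isomorphic X Y -> isomorphic (base_change tau X) (base_change tau Y).
Proof.
move=> [phi [psi [m1 m2 i1 i2]]]; exists (twist phi), (twist psi).
split=> [||u|u]; try exact: morphism_twist.
  rewrite -[u]map_rhoK point_of_twist => pu.
  by rewrite /twist !map_tauK line_map; apply: i1.
rewrite -[u]map_rhoK point_of_twist => pu.
by rewrite /twist !map_tauK line_map; apply: i2.
Qed.

End Twist.

End Morphisms.

(** * Elements fixed by a power of Frobenius *)

Lemma frobenius_iter (F : fieldType) (p m : nat) : p \in [pchar F] ->
  exists tau : {rmorphism F -> F}, forall x, tau x = x ^+ (p ^ m).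
Proof.
move=> charFp; elim: m => [|m [tau e]].
  by exists [the {rmorphism F -> F} of idfun] => x; rewrite expn0 expr1.
exists [the {rmorphism F -> F} of pFrobenius_aut charFp \o tau] => x /=.
by rewrite pFrobenius_autE e -exprM expnSr.
Qed.

Lemma frobenius_inj (F : fieldType) (p m : nat) : p \in [pchar F] ->
  injective (fun x : F => x ^+ (p ^ m)).
Proof.
by move=> /(frobenius_iter m)[tau e] x y /= exy; apply: (fmorph_inj tau); rewrite !e.
Qed.

Lemma iter_pow (F : fieldType) (p m i : nat) (x : F) :
  x ^+ (p ^ m) = x -> x ^+ (p ^ (m * i)) = x.
Proof.
move=> e; elim: i => [|i IHi]; first by rewrite muln0 expn0 expr1.
by rewrite mulnS expnD exprM e.
Qed.

(* In characteristic p, these are the elements algebraic over the prime field. *)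
Definition frob_fixed (F : fieldType) (p : nat) (x : F) :=
  exists2 m, (0 < m)%N & x ^+ (p ^ m) = x.

Lemma frob_fixed_seq (F : fieldType) (p : nat) (s : seq F) :
  (forall x, x \in s -> frob_fixed p x) ->
  exists2 m, (0 < m)%N & forall x, x \in s -> x ^+ (p ^ m) = x.
Proof.
elim: s => [|x s IHs] h; first by exists 1%N.
have [m m0 hm] := IHs (fun y ys => h y (mem_behead (s := x :: s) ys)).
have [l l0 hl] := h x (mem_head _ _).
exists (m * l)%N; first by rewrite muln_gt0 m0.
move=> y; rewrite inE => /predU1P[->|/hm e]; last exact: iter_pow.
by rewrite mulnC; apply: iter_pow.
Qed.

(** A power of Frobenius fixing the coefficients of P maps roots to roots. The iterates of z lie
    among finitely many roots, so two coincide, and injectivity of Frobenius cancels the common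
    part. *)
Lemma frob_fixed_root (F : fieldType) (p : nat) (P : {poly F}) (z : F) :
  p \in [pchar F] -> P != 0 -> (forall i, frob_fixed p P`_i) -> root P z ->
  frob_fixed p z.
Proof.
move=> charFp nzP fixP rz.
have [|m m0 hm] := @frob_fixed_seq F p P.
  by move=> x /(nthP 0)[i _ <-].
have [tau etau] := frobenius_iter m charFp.
have tauP : map_poly tau P = P.
  apply/polyP => i; rewrite coef_map /= etau.
  have [li|li] := ltnP i (size P); first by rewrite hm ?mem_nth.
  by rewrite nth_default // expr0n expn_eq0 eqn0Ngt (prime_gt0 (pcharf_prime charFp)).
have rts i : root P (z ^+ (p ^ (m * i))).
  elim: i => [|i IHi]; first by rewrite muln0 expn0 expr1.
  by rewrite mulnS mulnC expnD mulnC exprM -etau -tauP fmorph_root mulnC.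
pose s := [seq z ^+ (p ^ (m * i)) | i <- iota 0 (size P)].
have : ~~ uniq s.
  apply/negP => us; have := max_poly_roots nzP _ us.
  rewrite size_map size_iota ltnn => /(_ _)/negP[] //.
  by apply/allP => x /mapP[i _ ->].
case/(uniqPn 0) => i [j [lij]]; rewrite size_map size_iota => lj.
rewrite !(nth_map 0%N) ?size_iota ?nth_iota ?(ltn_trans lij) // !add0n => e.
exists (m * (j - i))%N; first by rewrite muln_gt0 m0 subn_gt0.
apply: (frobenius_inj (m := m * i) charFp); rewrite /= -exprM -expnD -mulnDr.
by rewrite subnK 1?ltnW.
Qed.

Lemma frob_fixed_algebraic (p : nat) (F : fieldType) (j : {rmorphism 'F_p -> F}) (x : F) :
  prime p -> algebraicOver j x -> frob_fixed p x.
Proof.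
move=> p_pr [P nzP rx].
have charFp : p \in [pchar F] by rewrite (fmorph_pchar j) pchar_Fp.
apply: (frob_fixed_root charFp _ _ rx); first by rewrite map_poly_eq0.
move=> i; rewrite coef_map /=; exists 1%N => //; rewrite expn1 -rmorphXn.
by congr (j _); have := expf_card P`_i; rewrite card_Fp.
Qed.

(* Y has finitely many coefficients, all fixed by a power of Frobenius: the    *)
(* twist of X by that power is again isomorphic to Y.                          *)
Lemma isotrivial_frobenius (p n : nat) (X : seq {mpoly (Fpt p)[n.+1]}) :
  prime p -> isotrivial X ->
  exists (K : closedFieldType) (iota : {rmorphism Fpt p -> K}) (m : nat)
         (tau : {rmorphism K -> K}),
    [/\ (0 < m)%N, forall x, tau x = x ^+ (p ^ m) &
      isomorphic (base_change iota X) (base_change tau (base_change iota X))].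
Proof.
move=> p_pr [K [iota [k0 [j [sigma [l [Y [algK algk0 _ iso]]]]]]]].
have chark0 : p \in [pchar k0] by rewrite (fmorph_pchar j) pchar_Fp.
have charK : p \in [pchar K] by rewrite (fmorph_pchar sigma).
have [|m m0 hm] := @frob_fixed_seq k0 p (flatten [seq [seq G@_M | M <- msupp G] | G <- Y]).
  by move=> x _; apply: frob_fixed_algebraic p_pr (algk0 x).
have [tau etau] := frobenius_iter m charK.
exists K, iota, m, tau; split=> //.
have tauY : base_change tau (base_change sigma Y) = base_change sigma Y.
  rewrite /base_change -map_comp; apply/eq_in_map => G GY /=.
  apply/mpolyP => M; rewrite !mcoeff_map_mpoly /= etau -rmorphXn; congr (sigma _).
  have [MG|nMG] := boolP (M \in msupp G).
    by apply: hm; apply/flatten_mapP; exists G => //; apply: map_f.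
  rewrite memN_msupp_eq0 // expr0n expn_eq0 eqn0Ngt (prime_gt0 p_pr) //.
have q0 : (0 < p ^ m)%N by rewrite expn_gt0 prime_gt0.
(* The inverse of [tau] extracts p^m-th roots, which exist in the algebraically closed field K. *)
pose rho (x : K) := xchoose (closed_nth_root x q0).
have rhoK : cancel rho tau by move=> x; rewrite etau; apply/eqP/(xchooseP (closed_nth_root x q0)).
apply: (isomorphic_trans iso); rewrite -tauY; apply: isomorphic_sym.
exact: (isomorphic_twist rhoK iso).
Qed.

(** * Isomorphisms act on x-coordinates by Moebius transformations *)

Lemma horner_rev (F : fieldType) (q : {poly F}) n : (size q <= n.+1)%N ->
  exists2 r : {poly F}, (size r <= n.+1)%N &
    forall x, x != 0 -> r.[x] = x ^+ n * q.[x^-1].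
Proof.
move=> lq; exists (\poly_(i < n.+1) q`_(n - i)); first exact: size_poly.
move=> x nzx; rewrite horner_poly (horner_coef_wide _ lq) big_distrr /=.
rewrite (reindex_inj rev_ord_inj) /=; apply: eq_bigr => i _; rewrite subSS.
rewrite subKn ?leq_ord // mulrCA exprVn -expfB_cond ?(negPf nzx) ?add0n ?leq_ord //.
Qed.

(** The right-hand side grows at most like x^e at infinity, and the left-hand side like x^(deg p +
    j). *)
Lemma size_horner_rev (K : closedFieldType) (p q N : {poly K}) j e : N != 0 ->
  (forall x, N.[x] != 0 -> x != 0 -> p.[x] * x ^+ j = x ^+ e * q.[x^-1]) ->
  p != 0 -> (size p + j <= e.+1)%N.
Proof.
move=> nzN h nzp; pose n := size q.
have [r sr er] := horner_rev (leqnSn n : (size q <= n.+1)%N).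
have eq_pr : p * 'X^(j + n) = 'X^e * r.
  apply/eqP; rewrite -subr_eq0; apply/eqP.
  apply: (@closed_poly_eq0_generic _ (N * 'X)); first by rewrite mulf_neq0 ?polyX_eq0.
  move=> x; rewrite !hornE mulf_eq0 negb_or => /andP[Nx nzx].
  by rewrite er // exprD mulrA h //; ring.
have := congr1 (fun s : {poly K} => size s) eq_pr.
rewrite size_Mmonic ?monicXn // size_polyXn addnS /= => es.
have : (size ('X^e * r)%R <= e + n.+1)%N.
  by rewrite (leq_trans (size_polyMleq _ _)) // size_polyXn /= leq_add2l.
by rewrite -es addnA addnS -addSn leq_add2r.
Qed.

(* When w0 != 0, [v.1 - c] generates the maximal ideal of the local ring at    *)
(* (c, w0), where [v.2 + w0] is a unit.                                        *)
Lemma pf_local_parameter (K : closedFieldType) (f : {poly K}) h c w0 :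
  pf f h -> onC f (c, w0) -> h (c, w0) = 0 ->
  exists2 m, pf f m & forall v, onC f v -> (v.2 + w0) * h v = (v.1 - c) * m v.
Proof.
move=> [a ea] cC; rewrite (ea _ cC) /pev /= => h0.
have div (P : {poly K}) : exists P1 : {poly K}, forall x, P.[x] - P.[c] = (x - c) * P1.[x].
  have /factor_theorem[P1 e1] : root (P - P.[c]%:P) c by rewrite rootE !hornE subrr.
  exists P1 => x; have := congr1 (fun P : {poly K} => P.[x]) e1; rewrite !hornE => ->; ring.
have [a1 e1] := div a.1; have [a2 e2] := div a.2; have [f1 ef] := div f.
exists (fun v => (v.2 + w0) * (a1.[v.1] + a2.[v.1] * v.2) + a.2.[c] * f1.[v.1]).
  apply: pfD; last by apply: pfM; [exact: pf_const | exact: pf_poly].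
  apply: pfM; apply: pfD; try apply: pfM; try exact: pf_poly; try exact: pf_y.
  exact: pf_const.
move=> v vC; rewrite ea // /pev.
have -> : a.1.[v.1] = (v.1 - c) * a1.[v.1] - a.2.[c] * w0.
  by rewrite -e1; apply/eqP; rewrite -subr_eq0; apply/eqP; rewrite -[RHS]h0; ring.
have -> : a.2.[v.1] = (v.1 - c) * a2.[v.1] + a.2.[c] by rewrite -e2 subrK.
have e : (v.1 - c) * f1.[v.1] = (v.2 + w0) * (v.2 - w0).
  by rewrite -ef -(eqP vC) -(eqP cC) /=; ring.
rewrite [RHS](_ : _ = (v.1 - c) * ((v.2 + w0) * (a1.[v.1] + a2.[v.1] * v.2))
  + a.2.[c] * ((v.1 - c) * f1.[v.1])); last by ring.
by rewrite e; ring.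
Qed.

(** The pullback of a regular function along a map with homogeneous coordinates (G0 : G1 : Gy)
    becomes regular after multiplication by a power of G0. *)
Lemma pf_clear_denominators (K : closedFieldType) (f f' : {poly K}) h G0 G1 Gy :
  pf f' h -> pf f G0 -> pf f G1 -> pf f Gy ->
  (forall v, onC f v -> G0 v != 0 -> onC f' (G1 v / G0 v, Gy v / G0 v)) ->
  exists M e, pf f e /\ forall v, onC f v -> G0 v != 0 ->
    e v = G0 v ^+ M * h (G1 v / G0 v, Gy v / G0 v).
Proof.
move=> [a ea] p0 p1 py C'.
have poly_case (P : {poly K}) : exists M e, pf f e /\
    forall v, onC f v -> G0 v != 0 -> e v = G0 v ^+ M * P.[G1 v / G0 v].
  elim/poly_ind: P => [|P c [M [e [pe he]]]].
    by exists 0%N, (fun=> 0); split=> [|v _ _]; rewrite ?horner0 ?mulr0 //; apply: pf_const.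
  exists M.+1, (fun v => e v * G1 v + c * G0 v ^+ M.+1); split=> [|v vC nz0].
    by apply: pfD; apply: pfM => //; [exact: pf_const | exact: pfX].
  by rewrite he // !hornE exprS; field.
have [M1 [e1 [pe1 h1]]] := poly_case a.1; have [M2 [e2 [pe2 h2]]] := poly_case a.2.
exists (M1 + M2).+1, (fun v => e1 v * G0 v ^+ M2.+1 + e2 v * G0 v ^+ M1 * Gy v); split.
  by apply: pfD; apply: pfM => //; [exact: pfX | apply: pfM => //; exact: pfX].
move=> v vC nz0; rewrite ea ?C' // h1 // h2 // /pev /= !exprS exprD; field; exact: nz0.
Qed.

Lemma line_pt_false (F : fieldType) g (v w : F * F) : (pt g false v == pt g false w)%MS -> v = w.
Proof.
move=> /(line_eqP _ (pt_neq0 g false w))[l _ e].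
have l1 : l = 1.
  have := congr1 (fun u => cx u 0) e; rewrite cxZ !cx_pt // /cpoly !hornerXn !expr0 mulr1.
  by move->.
rewrite l1 scale1r in e; have := congr1 (fun u => cx u 1) e; have := congr1 (fun u => cy u) e.
rewrite !cy_pt !cx_pt // /cpoly !hornerXn /= !expr1 => e2 e1.
by rewrite [v]surjective_pairing e1 e2 -surjective_pairing.
Qed.

Lemma line_pt_true (F : fieldType) g (v w : F * F) : (pt g true v == pt g false w)%MS -> v.1 * w.1 = 1.
Proof.
move=> /(line_eqP _ (pt_neq0 g false w))[l nzl e].
have e0 : v.1 ^+ g.+1 = l.
  by have := congr1 (fun u => cx u 0) e; rewrite cxZ !cx_pt // /cpoly !hornerXn expr0 mulr1 /= subn0.
have e1 : v.1 ^+ g = l * w.1.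
  by have := congr1 (fun u => cx u 1) e; rewrite cxZ !cx_pt // /cpoly !hornerXn expr1 /= subn1.
have nzv : v.1 ^+ g != 0.
  by move: nzl; rewrite -e0 exprS mulf_eq0 negb_or => /andP[].
by apply: (mulfI nzv); rewrite mulr1 [in RHS]e1 -e0 exprS; ring.
Qed.

(** * Isomorphisms between two curves of the family *)

Section CurveMap.

Variables (K : closedFieldType) (g : nat) (b b' : K).
Hypotheses (nz2 : (2%:R : K) != 0) (nzk : (g.+1%:R : K) != 0) (g_gt1 : (1 < g)%N).
Hypotheses (nzb : b != 0) (nb1 : b != 1) (nzb' : b' != 0) (nb1' : b' != 1).

Local Notation C := (curve g b).
Local Notation C' := (curve g b').
Local Notation f := (fpoly g b).
Local Notation f' := (fpoly g b').

Variables (phi psi : 'rV[K]_g.+3 -> 'rV[K]_g.+3).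
Hypotheses (mphi : is_morphism C C' phi) (mpsi : is_morphism C' C psi).
Hypothesis psiK : forall u, point_of C u -> (psi (phi u) == u)%MS.
Hypothesis phiK : forall u, point_of C' u -> (phi (psi u) == u)%MS.

(* The forms F compute phi wherever they have no common zero.                  *)
Definition represents (F : 'I_g.+3 -> {mpoly K[g.+3]}) :=
  exists2 d, (forall i, F i \is d.-homog) &
    forall v, point_of C v -> row_eval F v != 0 -> (phi v == row_eval F v)%MS.

Lemma represents_exists u : point_of C u -> exists2 F, represents F & row_eval F u != 0.
Proof.
by move=> /mphi[_ [d [F [hF Fu agree]]]]; exists F; first by exists d.
Qed.

Lemma point_neq0 (X : seq {mpoly K[g.+3]}) u : point_of X u -> u != 0.
Proof. by case/andP. Qed.

Lemma phi_point u : point_of C u -> point_of C' (phi u).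
Proof. by case/mphi. Qed.

Lemma row_eval_point F u : represents F -> point_of C u -> row_eval F u != 0 ->
  point_of C' (row_eval F u).
Proof.
move=> [d hF agree] pu Fu; have := agree u pu Fu.
rewrite line_sym => /(line_eqP _ (point_neq0 (phi_point pu)))[c nzc ->].
rewrite point_of_scale ?phi_point //; exact: curve_homogeneous.
Qed.

Lemma represents_prop F G u : represents F -> represents G -> point_of C u ->
  row_eval F u != 0 -> exists c, row_eval G u = c *: row_eval F u.
Proof.
move=> [d hF aF] [e hG aG] pu Fu; have [->|Gu] := eqVneq (row_eval G u) 0.
  by exists 0; rewrite scale0r.
have := aG u pu Gu; rewrite line_sym => h.
by have /(line_eqP _ Fu)[c _ ->] := line_trans h (aF u pu Fu); exists c.
Qed.

Lemma represents_cross F G u i j : represents F -> represents G -> point_of C u ->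
  row_eval F u 0 i * row_eval G u 0 j = row_eval F u 0 j * row_eval G u 0 i.
Proof.
move=> rF rG pu; have [->|Fu] := eqVneq (row_eval F u) 0; first by rewrite !mxE !mul0r.
by have [c ->] := represents_prop rF rG pu Fu; rewrite !mxE; ring.
Qed.

Local Notation cxr F r v i := (cx (row_eval F (pt g r v)) i).
Local Notation cyr F r v := (cy (row_eval F (pt g r v))).

Lemma pf_row F r (i : 'I_g.+3) : pf (f r) (fun v => row_eval F (pt g r v) 0 i).
Proof. by apply: pf_ext (pf_pt _ r (F i)) => v _; rewrite mxE. Qed.

(** This Veronese relation expresses 1 / u as x_g / x_(g+1), which makes sense at points that phi
    sends to infinity. *)
Lemma represents_glue F r v : represents F -> onC (f r) v ->
  cxr F r v 0 * cxr F r v g.+1 = cxr F r v 1 * cxr F r v g.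
Proof.
move=> rF vC; have pv := ptC vC.
have [->|Fv] := eqVneq (row_eval F (pt g r v)) 0; first by rewrite /cx !mxE !mul0r.
have /point_of_curveP[_ _ hv] := row_eval_point rF pv Fv.
by rewrite (hv 1%N g) // /hi /lo add1n leqnn subn0.
Qed.

(* The x-coordinate of phi u is c; false when phi u is a point at infinity.    *)
Definition has_value (c : K) (u : 'rV[K]_g.+3) :=
  (cx (phi u) 0 != 0) && (cx (phi u) 1 == c * cx (phi u) 0).

Lemma has_value_row F c u : represents F -> point_of C u -> row_eval F u != 0 ->
  has_value c u = (cx (row_eval F u) 0 != 0) &&
    (cx (row_eval F u) 1 == c * cx (row_eval F u) 0).
Proof.
move=> [d hF agree] pu Fu; have /(line_eqP _ Fu)[e nze eF] := agree u pu Fu.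
rewrite /has_value eF !cxZ mulf_eq0 (negPf nze) /= mulrCA.
by rewrite (inj_eq (mulfI nze)).
Qed.

(* If x(phi P) = c, the coordinate function [v.1 - P.1] is the pullback by phi *)
(* of a function vanishing at phi P, hence a regular multiple of x(phi) - c.   *)
Lemma local_div_value F c (N : {poly K}) r P : represents F -> (f' false).[c] != 0 ->
  onC (f r) P -> has_value c (pt g r P) -> root N P.1 ->
  exists a e, [/\ pf (f r) a, pf (f r) e, a P != 0 & forall v, onC (f r) v ->
    a v * (N.[v.1] * cxr F r v 0) = (cxr F r v 1 - c * cxr F r v 0) * e v].
Proof.
move=> rF nzfc PC valP /factor_theorem[N1 eN].
have pP := ptC PC; have [G rG GP] := represents_exists pP.
have := valP; rewrite (has_value_row c rG pP GP) => /andP[nzG0 /eqP vG1].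
have [_ [dH [H [hH Hu agreeH]]]] := mpsi (phi_point pP).
rewrite -/(row_eval H _) in Hu.
(* H represents [psi] near phi P. The quotient R / Hb is the chart coordinate of [psi] minus P.1, so
   R vanishes at phi P. *)
pose Hb := H (inord (base g r)); pose R := H (inord (qexp g r 1)) - P.1 *: Hb.
have hR : R \is dH.-homog by apply: rpredB; [|apply: rpredZ]; apply: hH.
pose G0 v := cxr G r v 0; pose G1 v := cxr G r v 1; pose Gy v := cyr G r v.
pose HB v := Hb.@[row_eval G (pt g r v) 0]; pose RR v := R.@[row_eval G (pt g r v) 0].
have pfG i : pf (f r) (fun v => row_eval G (pt g r v) 0 i) by apply: pf_row.
have p0 : pf (f r) G0 by apply: pfG.
have p1 : pf (f r) G1 by apply: pfG.
have py : pf (f r) Gy by apply: pfG.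
have pHB : pf (f r) HB by apply: (pf_meval Hb pfG).
have pRR : pf (f r) RR by apply: (pf_meval R pfG).
have [dG hG agreeG] := rG.
have G0_neq0 v : G0 v != 0 -> row_eval G (pt g r v) != 0.
  by apply: contraNneq => e; rewrite /G0 e /cx mxE.
have on' v : onC (f r) v -> G0 v != 0 ->
    onC (f' false) (G1 v / G0 v, Gy v / G0 v) /\
    row_eval G (pt g r v) = G0 v *: pt g false (G1 v / G0 v, Gy v / G0 v).
  move=> vC nz0; have pG := row_eval_point rG (ptC vC) (G0_neq0 v nz0).
  have [[x y] [/= xyC e]] := point_chart (r := false) pG nz0.
  have e1 : G1 v = G0 v * x by rewrite /G1 e cxZ cx_pt // /cpoly hornerXn expr1.
  have ey : Gy v = G0 v * y by rewrite /Gy e cyZ cy_pt.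
  by rewrite e1 ey ![G0 v * _]mulrC !mulfK //; split=> //; apply/eqP.
have t_pt (v : K * K) : cx (pt g r v) (qexp g r 1) = v.1 /\ cx (pt g r v) (base g r) = 1.
  have l1 : (qexp g r 1 <= g.+1)%N by case: (r); rewrite ?leq_subr.
  rewrite !cx_pt ?base_le // cpoly_base hornerC /cpoly hornerXn; split=> //.
  by rewrite -[RHS]expr1 /qexp; case: (r) => //; rewrite subKn.
(* Since psi (phi v) = v, the pullback of R / Hb is v.1 - P.1. The factor G0 makes the identity
   trivial where G0 vanishes. *)
have key1 v : onC (f r) v -> G0 v * ((v.1 - P.1) * HB v) = G0 v * RR v.
  move=> vC; have [->|nz0] := eqVneq (G0 v) 0; first by rewrite !mul0r.
  congr (_ * _); have Gv := G0_neq0 v nz0; have pv := ptC vC.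
  have /(line_eqP _ Gv)[e nze eG] := agreeG _ pv Gv.
  have HG : row_eval H (phi (pt g r v)) = e ^+ dH *: row_eval H (row_eval G (pt g r v)).
    by rewrite eG (row_evalZ _ _ hH).
  have HBv : HB v = row_eval H (row_eval G (pt g r v)) 0 (inord (base g r)) by rewrite mxE.
  have RRv : RR v = row_eval H (row_eval G (pt g r v)) 0 (inord (qexp g r 1)) - P.1 * HB v.
    by rewrite /RR /R mevalB mevalZ mxE.
  have [H0|Hnz] := eqVneq (row_eval H (row_eval G (pt g r v))) 0.
    by rewrite RRv HBv H0 !mxE !mulr0 subrr.
  have Hphi : row_eval H (phi (pt g r v)) != 0 by rewrite HG scaler_eq0 negb_or Hnz expf_neq0.
  have := agreeH _ (phi_point pv) Hphi; rewrite -/(row_eval H _) HG line_sym => l1.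
  have l2 : (row_eval H (row_eval G (pt g r v)) == e ^+ dH *: row_eval H (row_eval G (pt g r v)))%MS.
    rewrite line_sym; apply/(line_eqP _ Hnz); exists (e ^+ dH) => //; exact: expf_neq0.
  have /(line_eqP _ (pt_neq0 g r v))[l _ el] := line_trans (line_trans l2 l1) (psiK pv).
  have [t1 tb] := t_pt v.
  by rewrite RRv HBv el -!/(cx _ _) !cxZ t1 tb; ring.
have [vC0 eGP] := on' P PC nzG0; set uw := (_, _) in vC0 eGP.
have euw1 : uw.1 = c by rewrite /= /G1 vG1 mulfK.
pose w0 := uw.2; have {}euw : uw = (c, w0) by rewrite [uw]surjective_pairing euw1.
have RP0 : RR P = 0.
  have := key1 P PC; rewrite subrr mul0r mulr0 => /esym/eqP.
  by rewrite mulf_eq0 (negPf nzG0) => /eqP.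
have R0 : R.@[pt g false (c, w0) 0] = 0.
  move: RP0; rewrite /RR eGP euw (meval_homog _ _ hR) => /eqP.
  by rewrite mulf_eq0 expf_eq0 (negPf nzG0) andbF => /eqP.
have [m pm em] := pf_local_parameter (pf_pt b' false R) (eq_ind _ (onC _) vC0 _ euw) R0.
have [M [mm [pmm emm]]] := pf_clear_denominators pm p0 p1 py (fun v vC nz => (on' v vC nz).1).
(* [a] collects the cleared denominators. At P it is nonzero because Gy + w0 G0 equals 2 w0 G0
   there, and w0 != 0 as phi P is no branch point. *)
exists (fun v => G0 v ^+ M.+1 * (Gy v + w0 * G0 v) * HB v),
  (fun v => G0 v ^+ dH.+2 * mm v * N1.[v.1]); split.
- apply: pfM => //; apply: pfM; first exact: pfX.
  by apply: pfD => //; apply: pfM => //; apply: pf_const.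
- by apply: pfM; [apply: pfM => //; exact: pfX | exact: pf_poly].
- have nzw0 : w0 != 0.
    by apply: contraNneq nzfc => w00; move: vC0; rewrite euw /onC w00 /= expr0n eq_sym.
  have eGy : Gy P = w0 * G0 P by rewrite mulrC /w0 /= mulrC divfK.
  have nzs : Gy P + w0 * G0 P != 0.
    by rewrite eGy -mulr2n -mulr_natl mulf_neq0 // mulf_neq0.
  suff nzHB : HB P != 0 by rewrite mulf_neq0 // mulf_neq0 // expf_neq0.
  have [e nze eG] : exists2 e, e != 0 & phi (pt g r P) = e *: row_eval G (pt g r P).
    by apply/(line_eqP _ GP); apply: agreeG.
  have := agreeH _ (phi_point pP) Hu; rewrite -/(row_eval H _) line_sym => l1.
  have /(line_eqP _ (pt_neq0 g r P))[l nzl el] := line_trans l1 (psiK pP).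
  apply: contraNneq nzl => HB0; have := congr1 (fun u => cx u (base g r)) el.
  rewrite /= cxZ (t_pt P).2 mulr1 => <-; rewrite eG (row_evalZ _ _ hH) cxZ.
  by rewrite /cx mxE -/Hb -/(HB P) HB0 mulr0.
move=> v vC; have cross := represents_cross (inord 0) (inord 1) rF rG (ptC vC).
rewrite -!/(cx _ _) -/(G0 v) -/(G1 v) in cross.
have [z0|nz0] := eqVneq (G0 v) 0; first by rewrite z0 !exprS !mul0r !mulr0.
have [vC' eGv] := on' v vC nz0.
have RRv : RR v = G0 v ^+ dH * R.@[pt g false (G1 v / G0 v, Gy v / G0 v) 0].
  by rewrite /RR eGv (meval_homog _ _ hR).
have k1 : (v.1 - P.1) * HB v = RR v by apply: (mulfI nz0); apply: key1.
have k2 := em _ vC'; rewrite /= in k2.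
have eN1 : N.[v.1] = N1.[v.1] * (v.1 - P.1) by rewrite eN !hornE.
have -> : G0 v ^+ M.+1 * (Gy v + w0 * G0 v) * HB v * (N.[v.1] * cxr F r v 0) =
   G0 v ^+ M.+2 * (Gy v / G0 v + w0) * RR v * (N1.[v.1] * cxr F r v 0).
  by rewrite -k1 eN1 !exprS; field.
have -> : G0 v ^+ M.+2 * (Gy v / G0 v + w0) * RR v * (N1.[v.1] * cxr F r v 0) =
   G0 v ^+ M.+2 * G0 v ^+ dH * ((G1 v / G0 v - c) * m (G1 v / G0 v, Gy v / G0 v)) * (N1.[v.1] * cxr F r v 0).
  by rewrite -k2 RRv; ring.
rewrite emm //.
have -> : cxr F r v 1 - c * cxr F r v 0 = (G1 v / G0 v - c) * cxr F r v 0.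
  by rewrite mulrBl; congr (_ - _); apply: (mulfI nz0); rewrite [LHS]mulrC -cross; field.
rewrite !exprS; ring.
Qed.

(** Completes the local condition of [pf_div] for N / (u - c): where u takes another value u - c is
    a unit, where u is infinite 1 / (u - c) is regular, and [local_div_value] treats the remaining
    points. *)
Lemma local_div F c (N : {poly K}) r P : represents F -> (f' false).[c] != 0 ->
  onC (f r) P -> (has_value c (pt g r P) -> root N P.1) ->
  exists a e, [/\ pf (f r) a, pf (f r) e, a P != 0 & forall v, onC (f r) v ->
    a v * (N.[v.1] * cxr F r v 0) = (cxr F r v 1 - c * cxr F r v 0) * e v].
Proof.
move=> rF nzfc PC rootN; have [val|] := boolP (has_value c (pt g r P)).
  exact: local_div_value (rootN val).
have pP := ptC PC; have [G rG GP] := represents_exists pP.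
rewrite (has_value_row c rG pP GP); have pfG i := pf_row G r i.
have cross i j v : onC (f r) v -> cxr F r v i * cxr G r v j = cxr F r v j * cxr G r v i.
  by move=> vC; apply: represents_cross => //; apply: ptC.
have [z0 _|nz0 /= nval] := eqVneq (cxr G r P 0) 0; last first.
  exists (fun v => cxr G r v 1 - c * cxr G r v 0), (fun v => N.[v.1] * cxr G r v 0).
  split=> [|||v vC].
  - by apply: pfB; [|apply: pfM; [exact: pf_const|]]; apply: pfG.
  - by apply: pfM; [exact: pf_poly | apply: pfG].
  - by rewrite subr_eq0.
  have := cross 0%N 1%N v vC => e.
  rewrite [LHS](_ : _ = N.[v.1] * (cxr F r v 0 * cxr G r v 1 - c * cxr F r v 0 * cxr G r v 0)); last by ring.
  by rewrite e; ring.
(* Here u has a pole; with 1 / u = x_g / x_(g+1), the unit 1 - c / u takes the place of u - c. *)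
have [zG nzG] := point_cx0 (row_eval_point rG pP GP) z0.
exists (fun v => cxr G r v g.+1 - c * cxr G r v g), (fun v => N.[v.1] * cxr G r v g).
split=> [|||v vC].
- by apply: pfB; [|apply: pfM; [exact: pf_const|]]; apply: pfG.
- by apply: pfM; [exact: pf_poly | apply: pfG].
- by rewrite (zG g) // mulr0 subr0.
have e : cxr F r v 0 * cxr G r v g.+1 = cxr F r v 1 * cxr G r v g.
  have [F0|Fv] := eqVneq (row_eval F (pt g r v)) 0; first by rewrite F0 /cx !mxE !mul0r.
  have [l el] := represents_prop rF rG (ptC vC) Fv.
  by rewrite el !cxZ mulrCA represents_glue //; ring.
rewrite [LHS](_ : _ = N.[v.1] * (cxr F r v 0 * cxr G r v g.+1 - c * cxr F r v 0 * cxr G r v g)); last by ring.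
by rewrite e; ring.
Qed.

Definition value (u : 'rV[K]_g.+3) := cx (phi u) 1 / cx (phi u) 0.

Lemma value_eqmx u w : point_of C u -> point_of C w -> (u == w)%MS -> value u = value w.
Proof.
move=> pu pw /(morphism_eqmx mphi pu pw).
move=> /(line_eqP _ (point_neq0 (phi_point pw)))[c nzc e].
by rewrite /value e !cxZ invfM mulrACA mulfV // mul1r.
Qed.

Lemma phi_value u c w : (phi u == pt g false (c, w))%MS -> value u = c /\ has_value c u.
Proof.
move=> /(line_eqP _ (pt_neq0 g false (c, w)))[l nzl e].
rewrite /value /has_value e !cxZ !cx_pt // /cpoly !hornerXn /= expr0 expr1 mulr1 nzl.
by rewrite [l * c]mulrC mulfK // eqxx.
Qed.

Lemma has_value_phi u c : point_of C u -> has_value c u ->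
  exists2 w, onC (f' false) (c, w) & (phi u == pt g false (c, w))%MS.
Proof.
move=> /phi_point pu /andP[nz0 /eqP e1].
have [[x w] [/= xC e]] := point_chart (r := false) pu nz0.
have ex : x = c.
  apply: (mulfI nz0); rewrite [RHS]mulrC -e1 [in RHS]e cxZ cx_pt // /cpoly hornerXn /= expr1 //.
rewrite ex in xC e; exists w; first exact/eqP.
by apply/(line_eqP _ (pt_neq0 g false (c, w))); exists (cx (phi u) 0).
Qed.

Lemma onC_eq_or_opp (P : {poly K}) x y w : onC P (x, y) -> onC P (x, w) -> w = y \/ w = - y.
Proof.
move=> /eqP /= e1 /eqP /= e2; have : w ^+ 2 == y ^+ 2 by rewrite e1 e2.
by rewrite eqf_sqr => /orP[] /eqP; [left | right].
Qed.

Lemma infinite_point b0 u : point_of (curve g b0) u -> cx u 0 = 0 ->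
  exists2 e : K, e = 1 \/ e = -1 & (u == pt g true (0, e))%MS.
Proof.
move=> pu u0; have [_ nzk'] := point_cx0 pu u0.
have [[z w] [/= wC e]] := point_chart (r := true) pu nzk'.
have z0 : z = 0.
  move: u0; rewrite e cxZ cx_pt // /cpoly hornerXn /= subn0 => /eqP.
  by rewrite mulf_eq0 (negPf nzk') expf_eq0 => /eqP.
exists w; last by rewrite -z0; apply/(line_eqP _ (pt_neq0 g true (z, w))); exists (cx u g.+1).
have : w ^+ 2 == 1 ^+ 2.
  by rewrite wC z0 fpoly_revE !hornE expr0n /= mulr0 !addr0 mul1r expr1n.
by rewrite eqf_sqr => /orP[] /eqP; [left | right].
Qed.

Lemma poly_roots (P : {poly K}) : P != 0 -> exists s : seq K, forall x, root P x -> x \in s.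
Proof.
move=> nzP; have [s e] := closed_field_poly_normal P; exists s => x.
by rewrite {1}e rootZ ?lead_coef_eq0 // root_prod_XsubC.
Qed.

(** It suffices that c avoid [s], the branch values of the target and the values of u at finitely
    many bad points; v1 and v2 are then the images by [psi] of the two points above c. *)
Lemma generic_value (Z : {poly K}) (s : seq K) : Z != 0 ->
  exists c w0 v1 v2, [/\ c \notin s, onC (f' false) (c, w0) /\ w0 != 0,
    [/\ onC (f false) v1, Z.[v1.1] != 0 & (phi (pt g false v1) == pt g false (c, w0))%MS],
    [/\ onC (f false) v2, Z.[v2.1] != 0 & (phi (pt g false v2) == pt g false (c, - w0))%MS]
    & forall u, point_of C u -> has_value c u ->
      (u == pt g false v1)%MS || (u == pt g false v2)%MS].
Proof.
move=> nzZ; have [sZ rZ] := poly_roots nzZ.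
have nzf' : f' false != 0.
  by have [x _] := fpoly_simple nzk nzb' nb1' false; apply: contraNneq => ->; rewrite deriv0 horner0.
have [sf rf] := poly_roots nzf'.
pose sq x : K := xchoose (@closed_nth_root K 2 x isT).
have sqE x : sq x ^+ 2 = x by apply/eqP/(xchooseP (@closed_nth_root K 2 x isT)).
(* The bad points: the two at infinity and those above the roots of Z. *)
pose pts := [:: pt g true (0, 1); pt g true (0, -1)]
  ++ [seq pt g false (x, sq (f false).[x]) | x <- sZ]
  ++ [seq pt g false (x, - sq (f false).[x]) | x <- sZ].
have [c] := closed_avoid (s ++ sf ++ [seq value u | u <- pts]).
rewrite mem_cat => /norP[ns]; rewrite mem_cat => /norP[nf nval].
have nzfc : (f' false).[c] != 0 by apply: contra nf; apply: rf.
have [w0 wC] := onC_lift (f' false) c.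
have nzw : w0 != 0.
  by apply: contraNneq nzfc => w00; move: wC; rewrite w00 /onC /= expr0n eq_sym.
have npts u : u \in pts -> value u != c.
  by move=> up; apply/negP => /eqP e; case/negP: nval; rewrite -e; apply: map_f.
have inf_on e : e = 1 \/ e = -1 -> onC (f true) (0, e).
  move=> he; have e2 : e ^+ 2 = 1 by case: he => ->; rewrite ?sqrrN expr1n.
  by rewrite /onC /= e2 fpoly_revE !hornE expr0n /= mulr0 !addr0 mul1r.
have lift w : onC (f' false) (c, w) -> exists v, [/\ onC (f false) v, Z.[v.1] != 0,
    (phi (pt g false v) == pt g false (c, w))%MS
    & (psi (pt g false (c, w)) == pt g false v)%MS].
  move=> wC'; have pw := ptC wC'; set U := psi _.
  have pU : point_of C U by have [] := mpsi pw.
  have vU : value U = c by have [] := phi_value (phiK pw).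
  have [U0|nzU] := eqVneq (cx U 0) 0.
    have [e he eU] := infinite_point pU U0.
    have /npts/eqP[] : pt g true (0, e) \in pts by case: he => ->; rewrite !inE eqxx ?orbT.
    by rewrite -vU; apply/esym; apply: value_eqmx eU => //; apply: ptC; apply: inf_on.
  have [v [/eqP vC eU]] := point_chart (r := false) pU nzU.
  have lU : (U == pt g false v)%MS.
    by apply/(line_eqP _ (pt_neq0 g false v)); exists (cx U 0).
  exists v; split=> //.
    apply/negP => Zv; have /npts/eqP[] : pt g false v \in pts.
      have vZ : v.1 \in sZ by apply: rZ.
      have sC : onC (f false) (v.1, sq (f false).[v.1]) by rewrite /onC /= sqE.
      have vC2 : onC (f false) (v.1, v.2) by rewrite -surjective_pairing.
      rewrite [v]surjective_pairing /pts !mem_cat.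
      by have [->|->] := onC_eq_or_opp sC vC2; apply/or3P; [constructor 2 | constructor 3];
        apply/mapP; exists v.1.
    by rewrite -vU; apply/esym; apply: value_eqmx lU => //; apply: ptC.
  apply: line_trans (phiK pw); rewrite line_sym; apply: (morphism_eqmx mphi) => //.
  exact: ptC.
have wCN : onC (f' false) (c, - w0) by rewrite /onC /= sqrrN.
have [v1 [v1C Z1 phi1 psi1]] := lift w0 wC; have [v2 [v2C Z2 phi2 psi2]] := lift _ wCN.
exists c, w0, v1, v2; split=> // u pu /(has_value_phi pu)[w wC' phiu].
have := psiK pu; rewrite line_sym => h.
have h2 := line_trans h (morphism_eqmx mpsi (phi_point pu) (ptC wC') phiu).
by have [ew|ew] := onC_eq_or_opp wC wC'; rewrite ew in h2; apply/orP; [left|right];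
  exact: line_trans h2 _.
Qed.

(* With u the x-coordinate of phi, the function N / (u - c) is regular on both *)
(* charts and has poles of order at most e at infinity.  Since y has poles of  *)
(* order g + 1 > e there, this function is a polynomial in x.                  *)
Lemma phi_quotient c v1 c1 (N Ns : {poly K}) e : (e < g.+1)%N ->
  (f' false).[c] != 0 -> onC (f false) v1 -> has_value c1 (pt g false v1) -> c1 != c ->
  (forall x, x != 0 -> N.[x] = x ^+ e * Ns.[x^-1]) ->
  (forall P, onC (f false) P -> has_value c (pt g false P) -> root N P.1) ->
  (forall P, onC (f true) P -> has_value c (pt g true P) -> root Ns P.1) ->
  exists2 alpha : {poly K}, (size alpha <= e.+1)%N & forall v, onC (f false) v ->
    N.[v.1] * cx (phi (pt g false v)) 0 =
    (cx (phi (pt g false v)) 1 - c * cx (phi (pt g false v)) 0) * alpha.[v.1].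
Proof.
move=> le_eg nzfc v1C val1 nc1 eNs rootN rootNs.
have p1 := ptC v1C; have [F rF Fv1] := represents_exists p1.
move: val1; rewrite (has_value_row c1 rF p1 Fv1) => /andP[nzF0 /eqP eF1].
pose d r v := cxr F r v 1 - c * cxr F r v 0.
have pfF r i : pf (f r) (fun v => row_eval F (pt g r v) 0 i) by apply: pf_row.
have pd r : pf (f r) (d r).
  by apply: pfB; [|apply: pfM; [exact: pf_const|]]; apply: pfF.
have dv1 : d false v1 != 0.
  by rewrite /d eF1 -mulrBl mulf_neq0 // subr_eq0.
have simple r := fpoly_simple nzk nzb nb1 r.
have [dF hF _] := rF.
have glueF i x y : x != 0 ->
    cxr F true (x^-1, y / x ^+ g.+1) i = (x ^- g.+1) ^+ dF * cxr F false (x, y) i.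
  by move=> nzx; rewrite pt_glue // (row_evalZ _ _ hF) cxZ.
have glueC x y : x != 0 -> onC (f false) (x, y) -> onC (f true) (x^-1, y / x ^+ g.+1).
  by move=> nzx /eqP /= e1; rewrite /onC /= expr_div_n e1 fpoly_glue.
have [Nd nzNd dNd] := pf_generic (simple false) (pd false) v1C dv1.
(* A point with x != 0 where [d] is nonzero lies in both charts, so [d] is nonzero on the chart at
   infinity as well. *)
have [x0] := poly_nonroot (mulf_neq0 nzNd (monic_neq0 (monicX K))).
rewrite hornerM hornerX mulf_eq0 negb_or => /andP[Nx0 nzx0].
have [y0 y0C] := onC_lift (f false) x0.
have dglue x y : x != 0 -> d true (x^-1, y / x ^+ g.+1) = (x ^- g.+1) ^+ dF * d false (x, y).
  by move=> nzx; rewrite /d !glueF //; ring.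
have nzS (x : K) : x != 0 -> (x ^- g.+1) ^+ dF != 0.
  by move=> nzx; rewrite expf_neq0 ?invr_eq0 ?expf_neq0.
have dv2 : d true (x0^-1, y0 / x0 ^+ g.+1) != 0.
  by rewrite dglue // mulf_neq0 ?nzS // dNd.
pose n r v := (if r then Ns else N).[v.1] * cxr F r v 0.
have pn r : pf (f r) (n r) by apply: pfM; [exact: pf_poly | apply: pfF].
have [|E0 [a ea] h0] := pf_div nz2 (simple false) (pn false) (pd false) v1C dv1.
  by move=> P PC; apply: (local_div rF nzfc PC (rootN P PC)).
have [|E1 [a' ea'] h1] := pf_div nz2 (simple true) (pn true) (pd true) (glueC _ _ nzx0 y0C) dv2.
  by move=> P PC; apply: (local_div rF nzfc PC (rootNs P PC)).
have nzf : f false != 0.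
  by have [x _] := simple false; apply: contraNneq => ->; rewrite deriv0 horner0.
(* The quotients found on the two charts agree up to x^e; this bounds the poles at infinity. *)
have glueE x y : x != 0 -> Nd.[x] != 0 -> onC (f false) (x, y) ->
    pev a (x, y) = x ^+ e * pev a' (x^-1, y / x ^+ g.+1).
  move=> nzx Ndx xyC; have xyC' := glueC x y nzx xyC.
  rewrite -ea // -ea' //; apply: (mulfI (dNd _ xyC Ndx)); rewrite -h0 //.
  apply: (mulfI (nzS x nzx)); have := h1 _ xyC'; rewrite dglue // /n /= glueF // eNs // => h.
  rewrite [RHS](_ : _ = x ^+ e * ((x ^- g.+1) ^+ dF * d false (x, y) * E1 (x^-1, y / x ^+ g.+1))); last by ring.
  by rewrite -h; ring.
have nzNf : Nd * f false != 0 by rewrite mulf_neq0.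
have coefE x : (Nd * f false).[x] != 0 -> x != 0 ->
    a.1.[x] = x ^+ e * a'.1.[x^-1] /\ a.2.[x] * x ^+ g.+1 = x ^+ e * a'.2.[x^-1].
  rewrite hornerM mulf_eq0 negb_or => /andP[Ndx fx] nzx.
  have [y yC] := onC_lift (f false) x.
  have yCN : onC (f false) (x, - y) by rewrite /onC /= sqrrN.
  have nzy : y != 0 by apply: contraNneq fx => y00; move: yC; rewrite y00 /onC /= expr0n eq_sym.
  have e1 := glueE x y nzx Ndx yC; have e2 := glueE x (- y) nzx Ndx yCN.
  rewrite /pev /= in e1 e2; have nzxk : x ^+ g.+1 != 0 by rewrite expf_neq0.
  split.
    apply: (mulfI nz2); rewrite [LHS](_ : _ = (a.1.[x] + a.2.[x] * y) + (a.1.[x] + a.2.[x] * - y)); last by ring.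
    by rewrite e1 e2; ring.
  apply: (mulfI (mulf_neq0 nz2 nzy)).
  rewrite [LHS](_ : _ = ((a.1.[x] + a.2.[x] * y) - (a.1.[x] + a.2.[x] * - y)) * x ^+ g.+1); last by ring.
  by rewrite e1 e2; field.
have s1 : (size a.1 <= e.+1)%N.
  have [->|nza] := eqVneq a.1 0; first by rewrite size_poly0.
  rewrite -[size _]addn0; apply: (size_horner_rev nzNf _ nza (q := a'.1)) => x Nx nzx.
  by rewrite expr0 mulr1; have [] := coefE x Nx nzx.
(* A nonzero multiple of y would have poles of order at least g + 1 > e at infinity. *)
have a20 : a.2 = 0.
  apply/eqP; apply: contraT => nza.
  have : (size a.2 + g.+1 <= e.+1)%N.
    apply: (size_horner_rev nzNf _ nza (q := a'.2)) => x Nx nzx.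
    by have [] := coefE x Nx nzx.
  move=> l1; have := leq_trans l1 le_eg.
  by rewrite -[X in (_ <= X)%N]add0n leq_add2r leqn0 size_poly_eq0 (negPf nza).
(* The forms F may all vanish at v. The relation is carried over to forms G that do not, through the
   cross products, which agree everywhere. *)
exists a.1 => // v vC; have pv := ptC vC; have [G rG Gv] := represents_exists pv.
have hF0 w : onC (f false) w -> N.[w.1] * cxr F false w 0 = d false w * a.1.[w.1].
  by move=> wC; rewrite -[LHS]/(n false w) h0 // ea // /pev a20 horner0 mul0r addr0.
pose h2 w := N.[w.1] * cxr G false w 0 - (cxr G false w 1 - c * cxr G false w 0) * a.1.[w.1].
have pfG i : pf (f false) (fun v => row_eval G (pt g false v) 0 i) by apply: pf_row.
have ph2 : pf (f false) h2.
  apply: pfB; apply: pfM; try exact: pf_poly; try apply: pfG.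
  by apply: pfB; [|apply: pfM; [exact: pf_const|]]; apply: pfG.
have h20 : h2 v = 0.
  apply: (pf_domain nz2 (simple false) (pfF false (inord 0)) ph2 v1C nzF0 _ vC) => w wC.
  have := represents_cross (inord 0) (inord 1) rF rG (ptC wC); rewrite -!/(cx _ _) => cr.
  rewrite [LHS](_ : _ = cxr G false w 0 * (N.[w.1] * cxr F false w 0)
    - (cxr F false w 0 * cxr G false w 1 - c * cxr F false w 0 * cxr G false w 0) * a.1.[w.1]); last by rewrite /h2; ring.
  by rewrite hF0 // cr /d; ring.
have [dG hG agreeG] := rG; have /(line_eqP _ Gv)[l nzl ->] := agreeG _ pv Gv.
rewrite !cxZ; apply/eqP; rewrite -subr_eq0; apply/eqP.
rewrite [LHS](_ : _ = l * h2 v); first by rewrite h20 mulr0.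
by rewrite /h2; ring.
Qed.

Lemma other_value c (Z : {poly K}) : Z != 0 -> exists c1 v1,
  [/\ c1 != c, onC (f false) v1, Z.[v1.1] != 0 & has_value c1 (pt g false v1)].
Proof.
move=> /(generic_value [:: c])[c1 [w [v1 [_ [nc _ [v1C Zv e] _ _]]]]].
exists c1, v1; split=> //; first by move: nc; rewrite inE.
by have [] := phi_value e.
Qed.

Lemma phi0_generic : exists2 Z : {poly K}, Z != 0 &
  forall v, onC (f false) v -> Z.[v.1] != 0 -> cx (phi (pt g false v)) 0 != 0.
Proof.
have [c [v1 [_ v1C _ val]]] := other_value 0 (oner_neq0 {poly K}).
have p1 := ptC v1C; have [F rF Fv] := represents_exists p1.
move: val; rewrite (has_value_row c rF p1 Fv) => /andP[nzF0 _].
have [Z nzZ hZ] := pf_generic (fpoly_simple nzk nzb nb1 false) (pf_row F false (inord 0)) v1C nzF0.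
exists Z => // v vC Zv; have nz := hZ v vC Zv.
have Gv : row_eval F (pt g false v) != 0 by apply: contraNneq nz => ->; rewrite mxE.
have [d _ agree] := rF; have /(line_eqP _ Gv)[l nzl ->] := agree _ (ptC vC) Gv.
by rewrite cxZ mulf_neq0.
Qed.

(* With N = (x - x_1) (x - x_2), where x_1 and x_2 are the x-coordinates of the *)
(* preimages of c, [phi_quotient] shows that u is a rational function of x.    *)
Lemma value_flip : exists2 Z : {poly K}, Z != 0 &
  forall v, onC (f false) v -> Z.[v.1] != 0 ->
    cx (phi (pt g false v)) 0 * cx (phi (pt g false (flip v))) 1 =
    cx (phi (pt g false v)) 1 * cx (phi (pt g false (flip v))) 0.
Proof.
have [c [w0 [v1 [v2 [_ [wC nzw] _ _ fib]]]]] := generic_value [::] (oner_neq0 {poly K}).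
have [c1 [v3 [nc v3C _ val3]]] := other_value c (oner_neq0 {poly K}).
pose N := ('X - v1.1%:P) * ('X - v2.1%:P).
pose Ns : {poly K} := (1 - v1.1%:P * 'X) * (1 - v2.1%:P * 'X).
have nzfc : (f' false).[c] != 0 by rewrite -(eqP wC) expf_neq0.
(* The degree e = 2 is allowed since g > 1, and [Ns] is the reversed polynomial of [N]. The
   resulting 1 / (u - c) = alpha / N depends on x only. *)
have [|x nzx|P PC valP|P PC valP|alpha _ e] :=
    phi_quotient (N := N) (Ns := Ns) (e := 2) _ nzfc v3C val3 nc.
- by [].
- by rewrite /N /Ns !hornE; field.
- rewrite rootE /N !hornE; have /orP[] := fib _ (ptC PC) valP => /line_pt_false ->;
    by rewrite subrr ?mul0r ?mulr0.
- rewrite rootE /Ns !hornE; have /orP[] := fib _ (ptC PC) valP => /line_pt_true;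
    by rewrite mulrC => ->; rewrite subrr ?mul0r ?mulr0.
exists N => [|v vC Nv]; first by rewrite mulf_neq0 ?polyXsubC_eq0.
have e1 := e v vC; have := e (flip v); rewrite onC_flip => /(_ vC) /= e2.
set a0 := cx _ 0 in e1 *; set a1 := cx _ 1 in e1 *.
set b0 := cx _ 0 in e2 *; set b1 := cx _ 1 in e2 *.
have [al0|nzal] := eqVneq alpha.[v.1] 0.
  move: e1 e2; rewrite al0 !mulr0 => /eqP; rewrite mulf_eq0 (negPf Nv) => /eqP->.
  by move=> /eqP; rewrite mulf_eq0 (negPf Nv) => /eqP->; rewrite mul0r mulr0.
apply: (mulIf nzal); apply/eqP; rewrite -subr_eq0; apply/eqP.
rewrite [LHS](_ : _ = a0 * ((b1 - c * b0) * alpha.[v.1]) - b0 * ((a1 - c * a0) * alpha.[v.1])); last by ring.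
by rewrite -e1 -e2; ring.
Qed.

(* By [value_flip] the two preimages of a generic c are conjugate, so that now *)
(* N = x - x_1 is allowed in [phi_quotient].                                   *)
Lemma phi_moebius : exists p q r s : K, p * s - q * r != 0 /\
  forall v, onC (f false) v ->
    cx (phi (pt g false v)) 1 * (r * v.1 + s) = cx (phi (pt g false v)) 0 * (p * v.1 + q).
Proof.
have [Z nzZ flipZ] := value_flip; have [Z0 nzZ0 phi0] := phi0_generic.
have nzf : f false != 0.
  by have [x _] := fpoly_simple nzk nzb nb1 false; apply: contraNneq => ->; rewrite deriv0 horner0.
have [c [w0 [v1 [v2 [_ [wC nzw] [v1C Z1 phi1] _ fib]]]]] :=
  generic_value [::] (mulf_neq0 (mulf_neq0 nzZ nzZ0) nzf).
move: Z1; rewrite 2!hornerM !mulf_eq0 !negb_or => /andP[/andP[Z1 Z01] f1].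
have [vl1 val1] := phi_value phi1.
(* The conjugate of v1 also has value c, so it is v1 or v2; it is not v1, which is no branch
   point. *)
have ev2 : flip v1 = v2.
  have := flipZ v1 v1C Z1; have /andP[nz0 /eqP ->] := val1.
  have fC : onC (f false) (flip v1) by rewrite onC_flip.
  rewrite -mulrA mulrCA => /(mulfI nz0) e.
  have valf : has_value c (pt g false (flip v1)).
    by rewrite /has_value (phi0 _ fC) //= e.
  have /orP[/line_pt_false ef|/line_pt_false //] := fib _ (ptC fC) valf.
  have y0 : v1.2 = 0.
    have := congr1 (fun v => v.2) ef => /= ey; apply: (mulfI nz2).
    by rewrite mulr0 -[RHS](subrr v1.2) -{3}ey; ring.
  by move: f1; rewrite -(eqP v1C) y0 expr0n eqxx.
pose x1 := v1.1; have x2 : v2.1 = x1 by rewrite -ev2.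
have nzfc : (f' false).[c] != 0 by rewrite -(eqP wC) expf_neq0.
have nzX : 'X - x1%:P != 0 :> {poly K} by rewrite polyXsubC_eq0.
have [c3 [v3 [nc3 v3C nz3 val3]]] := other_value c nzX.
have [|x nzx|P PC valP|P PC valP|alpha sal e] :=
    phi_quotient (N := 'X - x1%:P) (Ns := 1 - x1%:P * 'X) (e := 1) _ nzfc v3C val3 nc3.
- exact: ltnW.
- by rewrite !hornE expr1; field.
- rewrite rootE !hornE; have /orP[] := fib _ (ptC PC) valP => /line_pt_false ->;
    by rewrite ?x2 subrr.
- rewrite rootE !hornE; have /orP[] := fib _ (ptC PC) valP => /line_pt_true;
    by rewrite ?x2 mulrC => ->; rewrite subrr.
pose a0 := alpha`_0; pose a1 := alpha`_1.
have alE x : alpha.[x] = a0 + a1 * x.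
  by rewrite (horner_coef_wide _ sal) big_ord_recl big_ord1 expr0 mulr1 expr1.
(* Solving u - c = (x - x1) / (a0 + a1 x) for u gives this matrix, of determinant a0 + a1 x1. *)
exists (1 + c * a1), (c * a0 - x1), a1, a0; split; last first.
  move=> v vC; have := e v vC; rewrite alE !hornE => h.
  apply/eqP; rewrite -subr_eq0 -oppr_eq0; apply/eqP.
  set A := cx _ 0 in h *; set B := cx _ 1 in h *.
  rewrite [LHS](_ : _ = (v.1 - x1) * A - (B - c * A) * (a0 + a1 * v.1)); last by ring.
  by rewrite h subrr.
rewrite [X in X != 0](_ : _ = a0 + a1 * x1); last by ring.
(* If the determinant vanished, (u - c) a1 = 1 would make u generically constant, but u takes the
   distinct values c3 and c4. *)
apply/negP => /eqP al0; have ea0 : a0 = - (a1 * x1) by apply/eqP; rewrite -addr_eq0 al0.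
have slope c' v' : onC (f false) v' -> ('X - x1%:P).[v'.1] != 0 ->
    has_value c' (pt g false v') -> (c' - c) * a1 = 1.
  move=> vC nz /andP[nz0 /eqP e1]; have := e v' vC; rewrite e1 alE ea0.
  move: nz; rewrite !hornE => nz h; apply: (mulfI nz); apply: (mulfI nz0).
  set A := cx _ 0 in h *; rewrite mulr1 [RHS]mulrC h; ring.
have s3 := slope _ _ v3C nz3 val3.
have [c4 [w4 [v4 [_ [nc4 _ [v4C nz4 phi4] _ _]]]]] := generic_value [:: c3] nzX.
have [_ val4] := phi_value phi4; have s4 := slope _ _ v4C nz4 val4.
have nza1 : a1 != 0 by apply: contraTneq (oner_neq0 K) => a10; rewrite -s3 a10 mulr0 eqxx.
case/negP: nc4; rewrite inE; apply/eqP; apply: (addIr (- c)); apply: (mulIf nza1).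
by rewrite s3 s4.
Qed.

(** Conjugate points have the same u and distinct images, so [phi] generically commutes with y ->
    -y. A branch point is its own conjugate, hence its image has y = 0; such an image is not at
    infinity, where y != 0. *)
Lemma phi_branch_points : exists p q r s : K, p * s - q * r != 0 /\
  forall x, root (f false) x ->
    r * x + s != 0 /\ root (f' false) ((p * x + q) / (r * x + s)).
Proof.
have [p [q [r [s [det rel]]]]] := phi_moebius; exists p, q, r, s; split=> // x rx.
have nz_pair t : r * t + s = 0 -> p * t + q = 0 -> False.
  move=> e1 e2; case/negP: det; apply/eqP.
  have es : s = - (r * t) by apply/eqP; rewrite -addr_eq0 addrC e1.
  have eq : q = - (p * t) by apply/eqP; rewrite -addr_eq0 addrC e2.
  by rewrite es eq; ring.
have simple := fpoly_simple nzk nzb nb1 false.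
have nzf : f false != 0.
  by have [t _] := simple; apply: contraNneq => ->; rewrite deriv0 horner0.
pose P : K * K := (x, 0).
have PC : onC (f false) P by rewrite /onC /= expr0n eq_sym.
have flipP : flip P = P by rewrite /flip /= oppr0.
have pP := ptC PC; have [G rG GP] := represents_exists pP.
have [j Gj] : exists j, row_eval G (pt g false P) 0 j != 0.
  apply/existsP; apply: contraNT GP => /existsPn G0.
  by apply/eqP/rowP => j; have /negPn/eqP -> := G0 j; rewrite mxE.
have [Nj nzNj hNj] := pf_generic simple (pf_row G false j) PC Gj.
have [Z0 nzZ0 phi0] := phi0_generic.
have [dG hG agreeG] := rG.
have shape v : onC (f false) v -> (Nj * Z0 * f false).[v.1] != 0 ->
    exists l u w, [/\ row_eval G (pt g false v) = l *: pt g false (u, w),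
      u * (r * v.1 + s) = p * v.1 + q, onC (f' false) (u, w) &
      (phi (pt g false v) == pt g false (u, w))%MS].
  move=> vC; rewrite 2!hornerM !mulf_eq0 !negb_or => /andP[/andP[nj nz] nf].
  have pv := ptC vC; have Gv : row_eval G (pt g false v) != 0.
    have := hNj v vC nj; rewrite /=; apply: contraNneq => ->; rewrite mxE //.
  have nz0 := phi0 v vC nz.
  have [[u w] [/= uwC e]] := point_chart (r := false) (phi_point pv) nz0.
  have lphi : (phi (pt g false v) == pt g false (u, w))%MS.
    by apply/(line_eqP _ (pt_neq0 g false (u, w))); exists (cx (phi (pt g false v)) 0).
  have := agreeG _ pv Gv; rewrite line_sym => h.
  have /(line_eqP _ (pt_neq0 g false (u, w)))[l nzl el] := line_trans h lphi.
  exists l, u, w; split=> //; last exact/eqP.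
  apply: (mulfI nz0); rewrite -rel // mulrA; congr (_ * _).
  by rewrite [in RHS]e cxZ cx_pt // /cpoly hornerXn.
(* The expression [h] vanishes at generic v because phi (flip v) is conjugate to phi v. It then
   vanishes at P as well, where it equals 2 x_i y. *)
have anti i : (i <= g.+1)%N ->
    cx (row_eval G (pt g false P)) i * cy (row_eval G (pt g false P)) = 0.
  move=> li.
  pose h v := cx (row_eval G (pt g false v)) i * cy (row_eval G (pt g false (flip v)))
    + cy (row_eval G (pt g false v)) * cx (row_eval G (pt g false (flip v))) i.
  have px : pf (f false) (fun v => cx (row_eval G (pt g false v)) i) by apply: pf_row.
  have py : pf (f false) (fun v => cy (row_eval G (pt g false v))) by apply: pf_row.
  have ph : pf (f false) h.
    exact: pfD (pfM px (pf_flip py)) (pfM py (pf_flip px)).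
  have nzN : Nj * Z0 * f false != 0 by rewrite mulf_neq0 // mulf_neq0.
  have hP : h P = 0.
    apply: (pf_eq0_generic nz2 simple ph nzN _ PC) => v vC Nv.
    have fC : onC (f false) (flip v) by rewrite onC_flip.
    have [l [u [w [eG eu uwC lphi]]]] := shape v vC Nv.
    have [l' [u' [w' [eG' eu' uwC' lphi']]]] := shape _ fC Nv.
    rewrite /= in eu'; have uu : u' = u.
      have [z|nz] := eqVneq (r * v.1 + s) 0; last by apply: (mulIf nz); rewrite eu eu'.
      by case: (nz_pair v.1 z); rewrite -eu z mulr0.
    rewrite uu in eG' uwC' lphi'; have ww : w' = - w.
      have [ew|//] := onC_eq_or_opp uwC uwC'; rewrite ew in lphi'.
      rewrite line_sym in lphi'; have lf := line_trans lphi lphi'.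
      have := morphism_eqmx mpsi (phi_point (ptC vC)) (phi_point (ptC fC)) lf.
      move=> h1; have := psiK (ptC vC); rewrite line_sym => h2.
      have /line_pt_false ef := line_trans (line_trans h2 h1) (psiK (ptC fC)).
      have y0 : v.2 = 0.
        have := congr1 (fun v => v.2) ef => /= ey; apply: (mulfI nz2).
        by rewrite mulr0 -[RHS](subrr v.2) {3}ey; ring.
      by move: Nv; rewrite hornerM -(eqP vC) y0 expr0n mulr0 eqxx.
    by rewrite /h eG eG' !cxZ !cyZ !cx_pt // !cy_pt /= ww; ring.
  move: hP; rewrite /h flipP => hP; apply: (mulfI nz2); rewrite mulr0 -[RHS]hP; ring.
have pGP := row_eval_point rG pP GP; have /point_of_curveP[_ hq _] := pGP.
have Gy : cy (row_eval G (pt g false P)) = 0.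
  apply/eqP; apply: contraT => nzy; have Gi i : (i <= g.+1)%N -> cx (row_eval G (pt g false P)) i = 0.
    by move=> li; apply/eqP; move/eqP: (anti i li); rewrite mulf_eq0 (negPf nzy) orbF.
  by move/eqP: hq; rewrite !Gi // mulr0 addr0 mul0r expf_eq0 (negPf nzy).
have [G0|nz0] := eqVneq (cx (row_eval G (pt g false P)) 0) 0.
  have [_ nzk'] := point_cx0 pGP G0.
  by move/eqP: hq; rewrite Gy G0 mulr0 !addr0 expr0n eq_sym mulf_eq0 (negPf nzk').
have [[u w] [/= uwC e]] := point_chart (r := false) pGP nz0.
have w0 : w = 0.
  by move: Gy; rewrite e cyZ cy_pt => /eqP; rewrite mulf_eq0 (negPf nz0) => /eqP.
have eu : u * (r * x + s) = p * x + q.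
  have /(line_eqP _ GP)[l nzl eG] := agreeG _ pP GP.
  have := rel P PC; rewrite eG !cxZ {1}e cxZ !cx_pt // /cpoly hornerXn /= expr1.
  set A := cx _ 0 => h; apply: (mulfI (mulf_neq0 nzl nz0)); rewrite -/A -[RHS]h; ring.
have nzd : r * x + s != 0.
  by apply/negP => /eqP z; apply: (nz_pair x z); rewrite -eu z mulr0.
by split=> //; rewrite -eu mulfK // rootE -uwC w0 expr0n.
Qed.

End CurveMap.

(** * Cross ratios of the branch points *)

Definition cross_ratio (F : fieldType) (a b c d : F) :=
  ((a - c) * (b - d)) / ((a - d) * (b - c)).

Lemma cross_ratio_moebius (F : fieldType) (p q r s a b c d : F) :
  p * s - q * r != 0 -> a != d -> b != c ->
  r * a + s != 0 -> r * b + s != 0 -> r * c + s != 0 -> r * d + s != 0 ->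
  let M x := (p * x + q) / (r * x + s) in
  [/\ M a != M d, M b != M c & cross_ratio (M a) (M b) (M c) (M d) = cross_ratio a b c d].
Proof.
move=> det nad nbc na nb nc nd M.
have diff x y : r * x + s != 0 -> r * y + s != 0 ->
    M x - M y = (p * s - q * r) * (x - y) / ((r * x + s) * (r * y + s)).
  by move=> nx ny; rewrite /M; field; rewrite nx ny.
have neqM x y : r * x + s != 0 -> r * y + s != 0 -> x != y -> M x != M y.
  move=> nx ny nxy; rewrite -subr_eq0 diff // mulf_neq0 ?invr_eq0 ?mulf_neq0 //.
  by rewrite subr_eq0.
split; try exact: neqM.
rewrite /cross_ratio !diff //; rewrite -subr_eq0 in nad; rewrite -subr_eq0 in nbc.
field; rewrite nad nbc na nb nc nd /=; move: det; rewrite ?mulf_neq0 ?expf_neq0 //.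
Qed.

Section CrossRatios.

Variables (K : closedFieldType) (p m : nat) (tau : {rmorphism K -> K}).
Hypotheses (charK : p \in [pchar K]) (m_gt0 : (0 < m)%N).
Hypothesis tauE : forall x, tau x = x ^+ (p ^ m).

(* By hypothesis the finite set of cross ratios of roots of f is contained in  *)
(* its image by Frobenius, which has the same size; so Frobenius permutes it.  *)
Lemma cross_ratio_frob_fixed (f : {poly K}) (u v w z : K) :
  f != 0 ->
  (forall a b c d, root f a -> root f b -> root f c -> root f d -> a != d -> b != c ->
     exists a' b' c' d', [/\ [/\ root f a', root f b', root f c' & root f d'],
       a' != d', b' != c' & cross_ratio a b c d = tau (cross_ratio a' b' c' d')]) ->
  root f u -> root f v -> root f w -> root f z -> u != z -> v != w ->
  frob_fixed p (cross_ratio u v w z).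
Proof.
move=> nzf step ru rv rw rz nuz nvw.
have [rs ers] := closed_field_poly_normal f.
have rsP x : root f x = (x \in rs).
  by rewrite ers rootZ ?lead_coef_eq0 // root_prod_XsubC.
pose quads := [seq (x, y) | x <- [seq (a, b) | a <- rs, b <- rs],
                            y <- [seq (a, b) | a <- rs, b <- rs]].
pose good (t : (K * K) * (K * K)) := (t.1.1 != t.2.2) && (t.1.2 != t.2.1).
pose R := undup [seq cross_ratio t.1.1 t.1.2 t.2.1 t.2.2 | t <- quads & good t].
have RP x : reflect (exists a b c d, [/\ [/\ root f a, root f b, root f c & root f d],
    a != d, b != c & x = cross_ratio a b c d]) (x \in R).
  rewrite mem_undup; apply: (iffP mapP) => [[t]|].
    rewrite mem_filter => /andP[/andP[n1 n2] /allpairsP[[x1 x2] /= [h1 h2 et]] ->].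
    move: h1 h2 => /allpairsP[[a b] /= [ra rb e1]] /allpairsP[[c d] /= [rc rd e2]].
    rewrite et e1 e2 /= in n1 n2 *; exists a, b, c, d; rewrite !rsP.
    by split=> //; split.
  move=> [a [b [c [d [[ra rb rc rd] nad nbc ->]]]]]; exists ((a, b), (c, d)) => //.
  rewrite mem_filter /good /= nad nbc /=; rewrite !rsP in ra rb rc rd.
  by apply/allpairsP; exists ((a, b), (c, d)); split=> //; apply/allpairsP;
    [exists (a, b) | exists (c, d)].
have subR : {subset R <= [seq tau x | x <- R]}.
  move=> x /RP[a [b [c [d [[ra rb rc rd] nad nbc ->]]]]].
  have [a' [b' [c' [d' [h nad' nbc' ->]]]]] := step a b c d ra rb rc rd nad nbc.
  by apply: map_f; apply/RP; exists a', b', c', d'.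
have uR : uniq R by apply: undup_uniq.
have [_ eqR] := uniq_min_size uR subR (eq_leq (size_map _ _)).
(* Permuting the cross ratios, [tau] fixes the polynomial that has them as roots, and
   [frob_fixed_root] applies. *)
pose P := \prod_(x <- R) ('X - x%:P).
have tauP : map_poly tau P = P.
  have -> : map_poly tau P = \prod_(y <- [seq tau x | x <- R]) ('X - y%:P).
    by rewrite /P rmorph_prod big_map; apply: eq_bigr => x _; rewrite /= map_polyXsubC.
  apply: perm_big; apply: uniq_perm; [|exact: uR|by move=> x; rewrite eqR].
  by rewrite map_inj_uniq //; apply: fmorph_inj.
apply: (frob_fixed_root (P := P) charK).
- by rewrite monic_neq0 // monic_prod_XsubC.
- by move=> i; exists m => //; rewrite -tauE -coef_map /= tauP.
by rewrite root_prod_XsubC; apply/RP; exists u, v, w, z.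
Qed.

Lemma frob_fixed_root_map (P : {poly K}) (z : K) :
  map_poly tau P = P -> P != 0 -> root P z -> frob_fixed p z.
Proof.
move=> tauP nzP; apply: (frob_fixed_root charK nzP) => i.
by exists m => //; rewrite -tauE -coef_map /= tauP.
Qed.

End CrossRatios.

(** * The parameter of a curve isomorphic to its Frobenius twist *)

Section NonIsotrivial.

Variables (K : closedFieldType) (p g : nat) (b : K).
Hypotheses (charK : p \in [pchar K]) (nz2 : (2%:R : K) != 0).
Hypotheses (nzk : (g.+1%:R : K) != 0) (g_gt1 : (1 < g)%N).
Hypotheses (nzb : b != 0) (nb1 : b != 1).

Lemma two_roots_Xn1 : exists z1 z2 : K, [/\ z1 ^+ g.+1 = -1, z2 ^+ g.+1 = -1 & z1 != z2].
Proof.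
pose P : {poly K} := 'X^(g.+1) + 1%:P.
have szP : size P = g.+2 by rewrite size_XnaddC.
have rootP' z : root P z -> z ^+ g.+1 = -1.
  by rewrite rootE /P !hornE addr_eq0 => /eqP.
have /closed_rootP[z1 r1] : size P != 1%N by rewrite szP.
have /factor_theorem[P1 eP] := r1.
have nzP1 : P1 != 0 by apply/eqP => P10; move: szP; rewrite eP P10 mul0r size_poly0.
have szP1 : size P1 = g.+1.
  by move: szP; rewrite eP size_Mmonic ?monicXsubC // size_XsubC addn2 => -[].
have /closed_rootP[z2 r2] : size P1 != 1%N by rewrite szP1 eqSS; case: (g) g_gt1.
exists z1, z2; split; try exact: rootP'.
  by apply: rootP'; rewrite eP rootM r2.
apply: contraTneq r2 => <-; have nz1 : z1 != 0.
  apply: contraTneq isT => z0; have := rootP' z1 r1; rewrite z0 expr0n /= => /eqP.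
  by rewrite eq_sym oppr_eq0 oner_eq0.
have : P^`().[z1] = P1.[z1].
  by rewrite eP derivM derivXsubC !hornE subrr mulr0 add0r mulr1.
rewrite /P derivD derivC addr0 derivXn hornerMn hornerXn rootE => <-.
by rewrite -mulr_natr mulf_neq0 ?expf_neq0.
Qed.

(** Let z1, z2 be roots of x^k = -1 and gam^k = b. The cross ratio of the branch points z1, z2, z1
    gam, z2 gam is fixed by a power of Frobenius, and gam satisfies a quadratic equation over z1, z2
    and this cross ratio. *)
Lemma isomorphic_twist_frob_fixed (m : nat) (tau : {rmorphism K -> K}) :
  (0 < m)%N -> (forall x, tau x = x ^+ (p ^ m)) ->
  isomorphic (curve g b) (curve g (tau b)) -> frob_fixed p b.
Proof.
move=> m_gt0 tauE [phi [psi [mphi mpsi psiK phiK]]].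
have p_pr := pcharf_prime charK.
have nztb : tau b != 0 by rewrite fmorph_eq0.
have ntb1 : tau b != 1 by rewrite -(rmorph1 tau) (inj_eq (fmorph_inj tau)).
have [al [be [ga [de [det br]]]]] :=
  phi_branch_points nz2 nzk g_gt1 nzb nb1 nztb ntb1 mphi mpsi psiK phiK.
pose f := fpoly g b false.
have nzf : f != 0.
  have [x _] := fpoly_simple nzk nzb nb1 false.
  by apply: contraNneq => f0; rewrite -/f f0 deriv0 horner0.
have rootf x : root f x = (x ^+ g.+1 == -1) || (x ^+ g.+1 == - b).
  by rewrite rootE /f fpolyE !hornE mulf_eq0 !addr_eq0.
(* The branch points of the twist are the images by [tau] of those of the curve, so Moebius
   invariance supplies the hypothesis of [cross_ratio_frob_fixed]. *)
have twist_root x : root (fpoly g (tau b) false) x -> exists2 x', root f x' & x = tau x'.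
  have q0 : (0 < p ^ m)%N by rewrite expn_gt0 prime_gt0.
  have [y /eqP ey] := @closed_nth_root K (p ^ m) x q0.
  have {}ey : x = tau y by rewrite tauE.
  rewrite ey rootE fpolyE !hornE mulf_eq0 !addr_eq0 -rmorphXn => h; exists y => //.
  by rewrite -(rmorph1 tau) -!rmorphN !(inj_eq (fmorph_inj tau)) in h; rewrite rootf.
have cr_fixed u v w z : root f u -> root f v -> root f w -> root f z -> u != z -> v != w ->
    frob_fixed p (cross_ratio u v w z).
  apply: (cross_ratio_frob_fixed charK m_gt0 tauE nzf) => a c d e ra rc rd re nae ncd.
  have [na ra'] := br a ra; have [nc rc'] := br c rc.
  have [nd rd'] := br d rd; have [ne re'] := br e re.
  have [nM1 nM2 eM] := cross_ratio_moebius det nae ncd na nc nd ne.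
  have [a' fa ea] := twist_root _ ra'; have [c' fc ec] := twist_root _ rc'.
  have [d' fd ed] := twist_root _ rd'; have [e' fe ee] := twist_root _ re'.
  rewrite -eM; rewrite ea ec ed ee in nM1 nM2 *.
  exists a', c', d', e'; split=> //.
  - by apply: contraNneq nM1 => ->.
  - by apply: contraNneq nM2 => ->.
  by rewrite /cross_ratio fmorph_div !rmorphM !rmorphB.
have [z1 [z2 [e1 e2 nz12]]] := two_roots_Xn1.
have fixz (z : K) : z ^+ g.+1 = -1 -> frob_fixed p z.
  move=> ez; apply: (frob_fixed_root_map charK m_gt0 tauE (P := 'X^(g.+1) + 1%:P)).
  - by rewrite rmorphD /= map_polyXn map_polyC /= rmorph1.
  - by rewrite monic_neq0 // monicE lead_coefE size_XnaddC //= coefD coefXn eqxx coefC addr0.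
  by rewrite rootE !hornE ez addNr.
have nzz (z : K) : z ^+ g.+1 = -1 -> z != 0.
  move=> ez; apply: contraTneq isT => z0; move/eqP: ez.
  by rewrite z0 expr0n /= eq_sym oppr_eq0 oner_eq0.
have [nz1 nz2'] := (nzz z1 e1, nzz z2 e2).
have [gam /eqP egam] := @closed_nth_root K g.+1 b isT.
have rz (z : K) : z ^+ g.+1 = -1 -> root f z by move=> ez; rewrite rootf ez eqxx.
have rzg (z : K) : z ^+ g.+1 = -1 -> root f (z * gam).
  by move=> ez; rewrite rootf exprMn ez egam mulN1r eqxx orbT.
have nzg (z z' : K) : z ^+ g.+1 = -1 -> z' ^+ g.+1 = -1 -> z != z' * gam.
  move=> ez ez'; apply: contraNneq nb1 => e.
  have := congr1 (fun x => x ^+ g.+1) e; rewrite /= exprMn ez ez' egam mulN1r.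
  by move/oppr_inj => <-.
have [c ec] : exists c, c = cross_ratio z1 z2 (z1 * gam) (z2 * gam) by eexists.
have fixc : frob_fixed p c by rewrite ec; apply: cr_fixed; do ?[exact: rz | exact: rzg | exact: nzg].
have [l l_gt0 hl] : exists2 l, (0 < l)%N & forall x, x \in [:: c; z1; z2] -> x ^+ (p ^ l) = x.
  by apply: frob_fixed_seq => x; rewrite !inE => /or3P[] /eqP->; [|apply: fixz..].
have [sig esig] := frobenius_iter l charK.
have [sc s1 s2] : [/\ sig c = c, sig z1 = z1 & sig z2 = z2].
  by rewrite !esig !hl ?inE ?eqxx ?orbT.
(* The definition of the cross ratio with denominators cleared and gam replaced by X. *)
pose P : {poly K} := c%:P * (z1%:P - z2%:P * 'X) * (z2%:P - z1%:P * 'X)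
  - (z1 * z2)%:P * (1 - 'X) * (1 - 'X).
have sigP : map_poly sig P = P.
  rewrite /P polyCM !(rmorphB, rmorphM, rmorph1) /=.
  by rewrite !map_polyC !map_polyX /= sc s1 s2.
have rP : root P gam.
  rewrite rootE /P !hornE.
  have n1 : z1 - z2 * gam != 0 by rewrite subr_eq0 nzg.
  have n2 : z2 - z1 * gam != 0 by rewrite subr_eq0 nzg.
  by apply/eqP; rewrite ec /cross_ratio; field; rewrite n1 n2.
have nzP : P != 0.
  (* If P were zero, its value at 1 would give c = 0, and then its value at 0 would give z1 z2 =
     0. *)
  apply/negP => /eqP P0.
  have n12 : z1 - z2 != 0 by rewrite subr_eq0.
  have n21 : z2 - z1 != 0 by rewrite subr_eq0 eq_sym.
  have c0 : c = 0.
    apply: (mulIf (mulf_neq0 n12 n21)).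
    have := congr1 (fun Q : {poly K} => Q.[1]) P0; rewrite /P !hornE => e.
    by rewrite mul0r -[RHS]e; ring.
  have : z1 * z2 = 0.
    have := congr1 (fun Q : {poly K} => Q.[0]) P0; rewrite /P c0 !hornE => e.
    by rewrite -[RHS]oppr0 -e; ring.
  by move/eqP; rewrite mulf_eq0 (negPf nz1) (negPf nz2').
have [n n_gt0 en] := frob_fixed_root_map charK l_gt0 esig sigP nzP rP.
by exists n => //; rewrite -egam exprAC en.
Qed.

End NonIsotrivial.

(** * Rational points *)

Lemma dvdn_succ_cube x : (x.+1 %| (x ^ 3).+1)%N.
Proof.
case: x => [|x]; first by rewrite exp0n.
by apply/dvdnP; exists (x.+1 * x).+1; rewrite !expnS expn0; lia.
Qed.

(** Since x + 1 divides x^3 + 1, taking powers of 3 as exponents yields a divisibility chain. *)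
Lemma dvdn_succ_pow3 p i n : (i <= n)%N -> ((p ^ 3 ^ i).+1 %| (p ^ 3 ^ n).+1)%N.
Proof.
move=> /subnK <-; elim: (n - i)%N => [|l IHl]; first by rewrite add0n.
by apply: dvdn_trans IHl _; rewrite addSn expnSr expnM dvdn_succ_cube.
Qed.

Section Points.

Variables (F : fieldType) (p g N : nat) (t : F).
Hypotheses (charF : p \in [pchar F]) (p_odd : odd p).
Hypothesis t_inj : injective (fun n => t ^+ n).

Definition top := ((p ^ 3 ^ N).+1)%N.

Definition parameter := t ^+ (2 * g.+1 * top)%N.

Definition cofactor i := (top %/ (p ^ 3 ^ i).+1)%N.

(* With q = p^(3^i), s = t^(2 cofactor i) satisfies b = s^(k (q + 1)), so     *)
(* s^k + b = s^k (s^k + 1)^q and (s^k + 1) (s^k + b) is a square.             *)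
Definition abscissa i := t ^+ (2 * cofactor i)%N.

Definition ordinate i :=
  (t ^+ cofactor i) ^+ g.+1 * (abscissa i ^+ g.+1 + 1) ^+ ((p ^ 3 ^ i).+1)./2%N.

Lemma cofactorE i : (i <= N)%N -> (cofactor i * (p ^ 3 ^ i).+1 = top)%N.
Proof. by move=> li; rewrite /cofactor divnK // dvdn_succ_pow3. Qed.

Lemma abscissa_inj i j : (i <= N)%N -> (j <= N)%N -> abscissa i = abscissa j -> i = j.
Proof.
move=> li lj /t_inj/eqP; rewrite eqn_pmul2l // => /eqP e.
have p_gt1 : (1 < p)%N by apply: prime_gt1 (pcharf_prime charF).
have := cofactorE li; rewrite e -(cofactorE lj) => /eqP; rewrite eqn_pmul2l.
  by rewrite eqSS !eqn_exp2l // => /eqP.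
have := cofactorE lj; rewrite /top; by case: (cofactor j).
Qed.

Lemma ordinateE i : (i <= N)%N ->
  ordinate i ^+ 2 = (fpoly g parameter false).[abscissa i].
Proof.
move=> li; set q := (p ^ 3 ^ i)%N; set s := abscissa i.
have eb : parameter = s ^+ g.+1 * (s ^+ g.+1) ^+ q.
  rewrite /parameter /s /abscissa -(cofactorE li) -/q -exprS -!exprM; congr (_ ^+ _); lia.
have frq : (s ^+ g.+1 + 1) ^+ q = (s ^+ g.+1) ^+ q + 1.
  have [tau etau] := frobenius_iter (3 ^ i) charF.
  by rewrite -!etau rmorphD rmorph1.
have es : s = t ^+ cofactor i * t ^+ cofactor i by rewrite -exprD addnn -mul2n.
(* As p is odd, q + 1 is even, so the half in [ordinate] is exact. *)
have odd_q : odd q by rewrite oddX p_odd orbT.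
have eq_half : ((q.+1)./2 * 2 = q.+1)%N by rewrite muln2 even_halfK //= odd_q.
have e1 : ((s ^+ g.+1 + 1) ^+ (q.+1)./2) ^+ 2 = (s ^+ g.+1 + 1) * ((s ^+ g.+1) ^+ q + 1).
  by rewrite -exprM eq_half exprS frq.
have e2 : ((t ^+ cofactor i) ^+ g.+1) ^+ 2 = s ^+ g.+1.
  by rewrite -exprM mulnC exprM expr2 -es.
by rewrite fpolyE !hornE eb /ordinate -/q -/s exprMn e1 e2; ring.
Qed.

Lemma curve_points : at_least_points (curve g parameter) N.
Proof.
exists [seq pt g false (abscissa i, ordinate i) | i <- iota 0 N]; split.
- by rewrite size_map size_iota.
- apply/allP => u /mapP[i]; rewrite mem_iota add0n => /andP[_ li] ->.
  by apply: pt_on; apply: ordinateE; apply: ltnW.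
rewrite pairwise_map; have := iota_uniq 0 N; rewrite uniq_pairwise.
apply: (sub_in_pairwise (P := [pred i | (i < N)%N])) => [i j /= li lj|].
  apply: contra => /line_pt_false e; apply/eqP.
  by apply: abscissa_inj (ltnW li) (ltnW lj) _; case: e.
by apply/allP => i; rewrite mem_iota add0n.
Qed.

End Points.

(** * The curves over F_p(t) *)

Lemma expr_gen_inj (F : fieldType) (m n : nat) :
  tofrac ('X : {poly F}) ^+ m = tofrac 'X ^+ n -> m = n.
Proof.
rewrite -!tofracXn => /eqP; rewrite tofrac_eq => /eqP/(congr1 (fun P : {poly F} => size P)).
by rewrite !size_polyXn => -[].
Qed.

Lemma pchar_Fpt (p : nat) : prime p -> p \in [pchar Fpt p].
Proof.
move=> p_pr; rewrite inE p_pr /=; have := pchar_Fp p_pr; rewrite inE => /andP[_ /eqP p0].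
have -> : p%:R = tofrac ((p%:R : 'F_p)%:P : {poly 'F_p}) by rewrite !rmorph_nat.
by rewrite p0 !rmorph0.
Qed.

(** The bound g + 1 < p makes 2 and k nonzero in every extension. Isotriviality would make the image
    of b in K, hence b itself, fixed by a power of Frobenius. *)
Lemma curve_Fpt (p g : nat) (b : Fpt p) : (1 < g)%N -> (g.+1 < p)%N -> prime p ->
  b != 0 -> b != 1 -> (forall l, (0 < l)%N -> b ^+ (p ^ l) <> b) ->
  smooth_geom_irreducible_curve (curve g b) /\ ~ isotrivial (curve g b).
Proof.
move=> hg gp p_pr nzb nb1 transc.
have unitK (K : closedFieldType) (iota : {rmorphism Fpt p -> K}) :
    [/\ p \in [pchar K], (2%:R : K) != 0, (g.+1%:R : K) != 0, iota b != 0 & iota b != 1].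
  have charK : p \in [pchar K] by rewrite (fmorph_pchar iota) pchar_Fpt.
  have nz_nat n : (0 < n < p)%N -> (n%:R : K) != 0.
    by case/andP=> n0 np; rewrite -(dvdn_pcharf charK) gtnNdvd.
  split=> //.
  - by apply: nz_nat => /=; apply: leq_ltn_trans gp; apply: leqW.
  - exact: nz_nat.
  - by rewrite fmorph_eq0.
  by rewrite -(rmorph1 iota) (inj_eq (fmorph_inj iota)).
split=> [K iota _|]; first rewrite base_change_curve.
  by have [_ ? ? ? ?] := unitK K iota; apply: curve_smooth_irreducible.
case/(isotrivial_frobenius p_pr) => K [iota [m [tau [m_gt0 tauE iso]]]].
have [charK nz2 nzk nzib nib1] := unitK K iota.
rewrite !base_change_curve in iso.
have [l l_gt0] := isomorphic_twist_frob_fixed charK nz2 nzk hg nzib nib1 m_gt0 tauE iso.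
by rewrite -rmorphXn => /fmorph_inj; apply: transc.
Qed.

Lemma exists_curve_Fpt (p g N : nat) : (1 < g)%N -> (g.+1 < p)%N -> prime p ->
  exists b : Fpt p, [/\ smooth_geom_irreducible_curve (curve g b),
    has_genus (curve g b) g, ~ isotrivial (curve g b)
    & at_least_points (curve g b) N].
Proof.
move=> hg gp p_pr.
have [t t_inj] : exists t : Fpt p, injective (fun n => t ^+ n).
  by exists (tofrac ('X : {poly 'F_p})) => m n; apply: expr_gen_inj.
have p_odd : odd p.
  by case: (even_prime p_pr) gp => // -> ; rewrite ltnS ltnNge ltnW.
have nzt : t != 0.
  by apply/eqP => t0; have := @t_inj 1%N 2%N; rewrite /= t0 !expr0n => /(_ erefl).
exists (parameter p g N t).
have e_gt0 : (0 < 2 * g.+1 * top p N)%N by rewrite !muln_gt0.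
have nzb : parameter p g N t != 0 by apply: expf_neq0.
have nb1 : parameter p g N t != 1.
  by apply/eqP => b1; have := t_inj _ 0%N b1 => e0; rewrite e0 in e_gt0.
have [|smooth non_iso] := curve_Fpt hg gp p_pr nzb nb1.
  (* Distinct powers of t differ, so comparing exponents gives p^l = 1. *)
  move=> l l_gt0; rewrite /parameter -exprM => /t_inj/eqP.
  rewrite -[X in _ == X]muln1 eqn_pmul2l // -[1%N](expn0 p) eqn_exp2l ?prime_gt1 //.
  by rewrite -leqn0 leqNgt l_gt0.
split=> //; first exact: curve_genus.
by apply: curve_points => //; apply: pchar_Fpt.
Qed.

Local Close Scope ring_scope.

Theorem mainTheorem2 (g : nat) (hg : 1 < g) :
  exists exceptions : seq nat,
    forall p : nat, prime p -> 2 < p -> p \notin exceptions ->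
    forall N : nat, 0 < N ->
    exists (n : nat) (C : seq {mpoly (Fpt p)[n.+1]}),
      [/\ smooth_geom_irreducible_curve C,
          has_genus C g,
          ~ isotrivial C
        & at_least_points C N].
Proof.
(* The exceptions are the numbers up to g + 1, so the remaining primes satisfy g + 1 < p. *)
exists (iota 0 g.+2) => p p_pr _; rewrite mem_iota add0n -leqNgt => gp N _.
by have [b curve_b] := exists_curve_Fpt N hg gp p_pr; exists g.+2, (curve g b).
Qed.
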